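(* Consider the incremental cycle detection problem on $n$ vertices with $m$ arc insertions, processed by the message-passing algorithm Insert described below, halting when a cycle is detected. For an appropriate choice of the random $q$-labeling (for graphs of constant degree, a $q$-labeling with $q=\sqrt{\log n/n}$; for general graphs, a $q$-arc labeling with $q\approx 1/\sqrt m$), the expected total number of messages sent by the algorithm is $O(m^{3/2}\sqrt{\log n})$. Moreover, with high probability each message contains $O(\log^2 n)$ bits, and with high probability each message is processed in $O(\log n)$ time.
   Context: Problem: arcs are inserted one by one into an initially arc-less directed graph on vertex set $V$, $|V|=n$; the algorithm must report when an inserted arc closes a directed cycle. Vertices are processors communicating along arcs (in both directions). Random rankings: a $q$-labeling makes each vertex independently ranked with probability $q$, and the ranked set $L$ receives a uniformly random injective ranking (distinct ranks, random relative order); unranked vertices have rank $\infty$. A $q$-arc labeling makes each arc independently ranked with probability $q$, each ranked arc receiving a random rank (distinct w.h.p.); the rank of a vertex is the minimum rank of its ranked incoming arcs (if any; otherwise $\infty$). Labels (of the current DAG): $P(v)$ = vertices with a path to $v$, $S(v)$ = vertices reachable from $v$ ($v\in P(v)\cap S(v)$), $D(x,y)=S(x)\cap P(y)$; $A_1(v)=P(v)\cap L$; for $i\ge1$, if $A_i(v)\neq\emptyset$, $\ell_i(v)$ = minimum-rank vertex of $A_i(v)$ and $A_{i+1}(v)=(D(\ell_i(v),v)\setminus\{\ell_i(v)\})\cap L$; $k(v)$ = $0$ if $A_1(v)=\emptyset$, else largest $i$ with $A_i(v)\ne\emptyset$; $\ell(v)=(\ell_1(v),\ldots,\ell_{k(v)}(v))$;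 $\rho(v)=(r(\ell_1(v)),\ldots,r(\ell_{k(v)}(v)),+\infty)$ compared lexicographically ($+\infty$ above all integers). $\mathrm{LCP}(x,y)$ = longest common prefix of $\ell(x),\ell(y)$. Insert$(u,v)$: (1) if $\rho(u)>_{\mathrm{lex}}\rho(v)$, return; (2) run Cycle-Detect$(u,v)$; (3) if no cycle detected and $\rho(u)<_{\mathrm{lex}}\rho(v)$, call Update$(u,v)$. Cycle-Detect$(u,v)$: Backward search: $u$ sends $\langle v,\ell(u)\rangle$ to its in-neighbors; a vertex $w$ receiving it over arc $e$: if $w\ne v$, $\ell(w)=\ell(u)$ and it is the first receipt, forwards it to all in-neighbors; if $\rho(w)>_{\mathrm{lex}}\rho(u)$ or $w$ has no in-neighbors, replies ''no-cycle'' over $e$; if $w=v$, replies ''cycle'' over $e$; a vertex first receiving ''cycle'' forwards it to one out-neighbor from which it received the search message, and a vertex that received ''no-cycle'' from all in-neighbors sends ''no-cycle'' to all out-neighbors from which it received the search message. Forward search (if $\rho(u)<_{\mathrm{lex}}\rho(v)$): $v$ sends $\ell(u)$ to its out-neighbors; a vertex $w$ receiving it over arc $e$: if $w$ was reached by the backward search, replies ''cycle''; if $\rho(u)<_{\mathrm{lex}}\rho(w)$ and first receipt, forwards to all out-neighbors; if $\rho(u)\ge_{\mathrm{lex}}\rho(w)$ or no out-neighbors, replies ''no-cycle''; replies propagate back symmetrically. A cycle is detected if $u$ (backward) or $v$ (forward) receives ''cycle''. Update$(x,y)$ (one message from $x$ to $y$): write $\ell(x)=\mathrm{LCP}(x,y)\|\zeta$;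 let $\zeta'$ be the longest prefix of $\zeta$ whose vertices all have rank $<r(y)$; set $\ell(y)=\mathrm{LCP}(x,y)\|\zeta'\|y$ if $y$ ranked, else $\ell(y)=\mathrm{LCP}(x,y)\|\zeta'$; if $\ell(y)$ changed, call Update$(y,w)$ for all arcs $(y,w)$.
   Formalization: General graphs: message bound only if ranked vertices do not forward backward queries, or in-degrees are O(√(m log n)); q up to √(log n/m); arc-label ranks fixed by all m arcs. Constant degree: m=Ω(n). Update replaces ℓ(y) only if ρ(x)<ρ(y). *)

(* Defs.v *)
(* MathComp world; MathComp-Analysis only for [ln], [Num.sqrt] and [powR]. *)
From HB Require Import structures.
From mathcomp Require Import all_boot all_order all_algebra all_fingroup.
From mathcomp Require Import reals exp.

Set Implicit Arguments.
Unset Strict Implicit.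
Unset Printing Implicit Defensive.

Import Order.TTheory GRing.Theory Num.Theory.

Local Open Scope nat_scope.

(** * Ranks and labels *)

(* [None] is the infinite rank of an unranked vertex. *)
Definition rank := option nat.

Definition rank_lt (a b : rank) : bool :=
  match a, b with
  | Some i, Some j => i < j
  | Some _, None => true
  | None, _ => false
  end.

Definition rank_min (a b : rank) : rank := if rank_lt b a then b else a.

Fixpoint lex_lt (s t : seq rank) : bool :=
  match s, t with
  | x :: s', y :: t' => rank_lt x y || ((x == y) && lex_lt s' t')
  | [::], _ :: _ => true
  | _, [::] => false
  end.

Definition graph (n : nat) := seq ('I_n * 'I_n).

Definition in_nbrs n (G : graph n) (w : 'I_n) : seq 'I_n :=
  [seq e.1 | e <- G & e.2 == w].
Definition out_nbrs n (G : graph n) (w : 'I_n) : seq 'I_n :=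
  [seq e.2 | e <- G & e.1 == w].

Definition arc n (G : graph n) : rel 'I_n := [rel x y | (x, y) \in G].

(* D(x, y) = S(x) :&: P(y) *)
Definition between n (G : graph n) (x y : 'I_n) : {set 'I_n} :=
  [set z | connect (arc G) x z && connect (arc G) z y].

Definition ranked n (r : 'I_n -> rank) : {set 'I_n} := [set x | r x != None].

(* The sequence l_i(v), l_(i+1)(v), ... when A = A_i(v); the sets A_i(v) strictly
   decrease, so that k = n steps exhaust them. *)
Fixpoint label_from n (r : 'I_n -> rank) (G : graph n) (v : 'I_n) (k : nat)
    (A : {set 'I_n}) : seq 'I_n :=
  if k is k'.+1 then
    if [pick x in A | [forall y in A, ~~ rank_lt (r y) (r x)]] is Some x then
      x :: label_from r G v k' ((between G x v :\ x) :&: ranked r)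
    else [::]
  else [::].

(* The label of [v] in the graph [G]. *)
Definition dag_label n (r : 'I_n -> rank) (G : graph n) (v : 'I_n) : seq 'I_n :=
  label_from r G v n ([set x | connect (arc G) x v] :&: ranked r).

Definition rho n (r : 'I_n -> rank) (l : seq 'I_n) : seq rank :=
  rcons [seq r x | x <- l] None.

Fixpoint lcp (T : eqType) (s t : seq T) : seq T :=
  match s, t with
  | x :: s', y :: t' => if x == y then x :: lcp s' t' else [::]
  | _, _ => [::]
  end.

Definition set_at n (T : Type) (f : 'I_n -> T) (x : 'I_n) (y : T) : 'I_n -> T :=
  fun z => if z == x then y else f z.

(** * Messages *)

Inductive msg (n : nat) : Type :=
  | BackwardQuery of 'I_n & seq 'I_n    (* the message <v, l(u)> *)
  | ForwardQuery of seq 'I_n            (* the message l(u) *)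
  | Answer of bool                      (* true: "cycle", false: "no-cycle" *)
  | UpdateMsg of seq 'I_n.              (* the label l(x) sent by Update(x, y) *)
Arguments Answer {n} _.

(* A label is sent as the list of its vertices together with their ranks; an
   identifier or a rank fills one machine word. *)
Definition msg_words n (p : msg n) : nat :=
  match p with
  | BackwardQuery _ l => 2 + 2 * size l
  | ForwardQuery l => 1 + 2 * size l
  | Answer _ => 1
  | UpdateMsg l => 1 + 2 * size l
  end.

(* Messages are words over {0, 1, ",", ";"}, each letter taking two bits: an
   identifier has [up_log 2 n] digits, the rank [k] has [(trunc_log 2 k).+1], and
   each of them is followed by a separator. Four more letters hold the kind of
   message, the boolean of an answer and an end marker. *)
Definition label_letters n (r : 'I_n -> rank) (l : seq 'I_n) : nat :=
  \sum_(x <- l)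
    ((up_log 2 n).+1 + (trunc_log 2 (if r x is Some k then k else 0)).+2).

Definition msg_bits n (r : 'I_n -> rank) (p : msg n) : nat :=
  2 * (4 + match p with
           | BackwardQuery _ l => (up_log 2 n).+1 + label_letters r l
           | ForwardQuery l => label_letters r l
           | Answer _ => 0
           | UpdateMsg l => label_letters r l
           end).

(* A message sent and processed. The time is the number of word operations spent
   on the message: writing it (so that a vertex sending k messages is charged
   through these messages) plus handling it at the receiver. *)
Record event (n : nat) := Event {
  ev_src : 'I_n;
  ev_dst : 'I_n;
  ev_msg : msg n;
  ev_time : nat
}.

(* Number of positions read to compare two sequences, or to find their longest
   common prefix. *)
Definition scan_time (T : eqType) (s t : seq T) : nat := (size (lcp s t)).+1.

(** * Cycle-Detect *)

(* Both searches are instances of a single flooding protocol: [root] sends the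
   query to its [next] neighbours; on a query, [verdict w = Some b] means that
   [w] answers [b] at once, and [None] that it takes part in the search. *)
Record search_state (n : nat) := SearchState {
  senders : 'I_n -> seq 'I_n;   (* whom a query was received from, oldest first *)
  nays : 'I_n -> nat;           (* how many "no-cycle" answers were received *)
  ayes : 'I_n -> bool           (* whether "cycle" was received *)
}.

Definition search_init n : search_state n :=
  SearchState (fun=> [::]) (fun=> 0) (fun=> false).

(* (source, destination, content): [None] is the query, [Some b] the answer b *)
Definition packet (n : nat) := ('I_n * 'I_n * option bool)%type.

Section Search.
Context {n : nat} (next : 'I_n -> seq 'I_n) (root : 'I_n) (query : msg n)
  (verdict : 'I_n -> option bool) (query_time : 'I_n -> nat).

(* A vertex without [next] neighbours has vacuously received "no-cycle" from all
   of them, hence answers "no-cycle" to its first query. *)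
Definition receive_query (st : search_state n) (s w : 'I_n) :
    search_state n * seq (packet n) :=
  let st' := SearchState (set_at (senders st) w (rcons (senders st w) s))
                         (nays st) (ayes st) in
  match verdict w with
  | Some b => (st', [:: (w, s, Some b)])
  | None =>
      if nays st w == size (next w) then (st', [:: (w, s, Some false)])
      else if senders st w is [::] then (st', [seq (w, x, None) | x <- next w])
      else (st', [::])
  end.

Definition receive_answer (st : search_state n) (w : 'I_n) (b : bool) :
    search_state n * seq (packet n) :=
  if b then
    if ayes st w then (st, [::])
    else (SearchState (senders st) (nays st) (set_at (ayes st) w true),
          if w == root then [::]
          else [seq (w, x, Some true) | x <- take 1 (senders st w)])
  else
    let k := (nays st w).+1 in
    (SearchState (senders st) (set_at (nays st) w k) (ayes st),
     if (k == size (next w)) && (w != root)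
     then [seq (w, x, Some false) | x <- senders st w] else [::]).

(* Messages are delivered in first-in first-out order, until none is left. *)
Fixpoint flood (fuel : nat) (st : search_state n) (queue : seq (packet n)) :
    seq (event n) * search_state n :=
  match fuel, queue with
  | k.+1, (s, w, c) :: queue' =>
      let: (e, (st', sent)) :=
        match c with
        | None => (Event s w query (msg_words query + query_time w),
                   receive_query st s w)
        | Some b => (Event s w (Answer b) (msg_words (@Answer n b) + 1),
                     receive_answer st w b)
        end in
      let: (tr, st'') := flood k st' (queue' ++ sent) in (e :: tr, st'')
  | _, _ => ([::], st)
  end.

Definition search (fuel : nat) : seq (event n) * search_state n :=
  flood fuel (search_init n) [seq (root, x, None) | x <- next root].

End Search.

(* [G] contains the arc (u, v) being inserted. In each search an arc carries at
   most one query and one answer, so [2 * size G] bounds the number of messages.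

   With [skip = false] a vertex w <> v with l(w) = l(u) forwards the backward
   query to all its in-neighbours. With [skip = true] it does so only if it is
   unranked (a ranked one behaves as if it had no in-neighbours): a proper
   ancestor of a ranked vertex w never has the label of w, so nothing is lost,
   whereas forwarding costs the in-degree of w at every search reaching w.

   A label different from l(u) met by the backward search has
   rho(w) > rho(u), since rho is nonincreasing along arcs. *)
Definition backward_search n (skip : bool) (r : 'I_n -> rank) (G : graph n)
    (lab : 'I_n -> seq 'I_n) (u v : 'I_n) : seq (event n) * search_state n :=
  search
    (fun w => if [&& skip, r w != None & w != v] then [::] else in_nbrs G w)
    u (BackwardQuery v (lab u))
    (fun w => if w == v then Some true
              else if lab w == lab u then None else Some false)
    (fun w => 1 + scan_time (lab w) (lab u)
              + scan_time (rho r (lab w)) (rho r (lab u)))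
    (2 * size G).

Definition forward_search n (r : 'I_n -> rank) (G : graph n)
    (lab : 'I_n -> seq 'I_n) (reached : pred 'I_n) (u v : 'I_n) :
    seq (event n) * search_state n :=
  search
    (out_nbrs G) v (ForwardQuery (lab u))
    (fun w => if reached w then Some true
              else if lex_lt (rho r (lab u)) (rho r (lab w)) then None
              else Some false)
    (fun w => 1 + scan_time (rho r (lab u)) (rho r (lab w)))
    (2 * size G).

Definition cycle_detect n (skip : bool) (r : 'I_n -> rank) (G : graph n)
    (lab : 'I_n -> seq 'I_n) (u v : 'I_n) : seq (event n) * bool :=
  let: (btr, bst) := backward_search skip r G lab u v in
  if ayes bst u then (btr, true)
  else if lex_lt (rho r (lab u)) (rho r (lab v)) then
    let reached := [pred w | (w == u) || (senders bst w != [::])] in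
    let: (ftr, fst) := forward_search r G lab reached u v in
    (btr ++ ftr, ayes fst v)
  else (btr, false).

(** * Update *)

Definition updated_label n (r : 'I_n -> rank) (lx ly : seq 'I_n) (y : 'I_n) :
    seq 'I_n :=
  let c := lcp lx ly in
  let zeta := drop (size c) lx in
  let zeta' := take (find (fun x => ~~ rank_lt (r x) (r y)) zeta) zeta in
  c ++ zeta' ++ (if r y != None then [:: y] else [::]).

(* One message from x to y, then recursive calls for the out-arcs of y if the
   label of y has changed. As in the call made by Insert, the label of y is only
   replaced if rho(x) < rho(y): otherwise l(x) carries nothing new for y, whose
   label already is that of the current graph. On an acyclic graph the calls are
   nested at most n deep, so that n units of fuel suffice. *)
Fixpoint update n (r : 'I_n -> rank) (G : graph n) (fuel : nat) (x y : 'I_n)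
    (lab : 'I_n -> seq 'I_n) : ('I_n -> seq 'I_n) * seq (event n) :=
  if fuel is k.+1 then
    let p := UpdateMsg (lab x) in
    let t := msg_words p + scan_time (rho r (lab x)) (rho r (lab y)) in
    if lex_lt (rho r (lab x)) (rho r (lab y)) then
      let l := updated_label r (lab x) (lab y) y in
      (* longest common prefix, ranks compared to r(y), label written, old and
         new label compared *)
      let t' := t + scan_time (lab x) (lab y) + (size l).+1 + size l
                + scan_time l (lab y) in
      if l == lab y then (lab, [:: Event x y p t'])
      else
        foldl (fun st w => let: (lab', tr) := update r G k y w st.1 in
                           (lab', st.2 ++ tr))
              (set_at lab y l, [:: Event x y p t']) (out_nbrs G y)
    else (lab, [:: Event x y p t])
  else (lab, [::]).

(** * Insert *)

(* The result consists of the new labels, the messages sent, and whether a cycle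
   was detected; [G] contains the arc (u, v). *)
Definition insert n (skip : bool) (r : 'I_n -> rank) (G : graph n)
    (lab : 'I_n -> seq 'I_n) (u v : 'I_n) :
    ('I_n -> seq 'I_n) * seq (event n) * bool :=
  if lex_lt (rho r (lab v)) (rho r (lab u)) then (lab, [::], false)
  else
    let: (tr, cycle) := cycle_detect skip r G lab u v in
    if ~~ cycle && lex_lt (rho r (lab u)) (rho r (lab v)) then
      let: (lab', utr) := update r G n u v lab in (lab', tr ++ utr, false)
    else (lab, tr, cycle).

Fixpoint insert_all n (skip : bool) (r : 'I_n -> rank) (G : graph n)
    (lab : 'I_n -> seq 'I_n) (arcs : seq ('I_n * 'I_n)) : seq (event n) :=
  if arcs is (u, v) :: arcs' then
    let G' := rcons G (u, v) in
    let: (lab', tr, cycle) := insert skip r G' lab u v in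
    if cycle then tr else tr ++ insert_all skip r G' lab' arcs'
  else [::].

(* All the messages sent while the given arcs are inserted one by one into the
   arc-less graph, until a cycle is detected. *)
Definition run n (skip : bool) (r : 'I_n -> rank) (arcs : seq ('I_n * 'I_n)) :
    seq (event n) :=
  insert_all skip r [::] (dag_label r [::]) arcs.

(** * Random rankings *)

(* (L, s): the set of ranked items, and a permutation whose values on L are the
   ranks; with s uniform, the order of the ranks on L is uniform. *)
Definition ranking (k : nat) := ({set 'I_k} * 'S_k)%type.

Definition ranking_rank k (w : ranking k) (i : 'I_k) : rank :=
  if i \in w.1 then Some (w.2 i : nat) else None.

(* Arc labeling: the i-th inserted arc has rank [ranking_rank w i], and the rank of
   a vertex, fixed throughout, is the minimum over its incoming arcs in [a]. *)
Definition arc_ranking_rank n m (a : m.-tuple ('I_n * 'I_n)) (w : ranking m)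
    (v : 'I_n) : rank :=
  foldr rank_min None
    [seq ranking_rank w i | i <- enum 'I_m & (tnth a i).2 == v].

Local Open Scope ring_scope.

Definition ranking_mass (R : realType) k (q : R) (w : ranking k) : R :=
  q ^+ #|w.1| * (1 - q) ^+ (k - #|w.1|) / (k`!)%:R.

Definition expect (R : realType) k (q : R) (X : ranking k -> R) : R :=
  \sum_w ranking_mass q w * X w.

Definition prob (R : realType) k (q : R) (E : pred (ranking k)) : R :=
  \sum_(w | E w) ranking_mass q w.

Definition num_messages (R : realType) n (tr : seq (event n)) : R := (size tr)%:R.

Definition bits_at_most (R : realType) n (r : 'I_n -> rank) (b : R)
    (tr : seq (event n)) : bool :=
  all (fun e => (msg_bits r (ev_msg e))%:R <= b) tr.

Definition time_at_most (R : realType) n (b : R) (tr : seq (event n)) : bool :=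
  all (fun e => (ev_time e)%:R <= b) tr.

(* Main.v *)
Require Import Defs.
From HB Require Import structures.
From mathcomp Require Import all_boot all_order all_algebra all_fingroup.
From mathcomp Require Import archimedean boolp reals sequences exp.
From mathcomp Require Import zify ring lra.

(**
  The label of a vertex is the lexicographic minimum, over the walks ending there,
  of the stack obtained by reading the walk and letting each ranked vertex pop the
  larger ranks. Update is a depth-first relaxation of these labels. A call that
  changes nothing would change nothing by recursing either, so the successive
  labels of a vertex are prefix minima of a sequence of walks that depends on the
  arcs only, not on the ranks.

  Let W be such a sequence and x the vertex of smallest rank on it. The prefix minima
  are those of the walks preceding the first visit to x, followed by those of the
  suffixes after x. As x is uniform, and as the graph is acyclic, the vertices seen
  before x are on average half of all vertices, and so are those seen after x.
  This bounds the expected number of prefix minima of N ranked items by N + 1, and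
  the expectation of the sum of 2^(length) over them by (N + 1)(N + 2), whence the
  logarithmic length of all labels. The same works when the ranked items are arcs,
  each of them standing for its head.

  The cost of the updates and of the forward searches is paid by label changes. The
  backward search from u only visits one ranked vertex and ancestors of u lying in a
  set of vertices without ranked element, chosen among n + 1 sets that do not depend
  on the ranks; such a set receives O(log n / q) arcs with high probability.
*)
Set Implicit Arguments.
Unset Strict Implicit.
Unset Printing Implicit Defensive.

Import Order.TTheory GRing.Theory Num.Theory.

(* [path.arc] shadows the arc relation of [Defs]. *)
Local Notation arc := Defs.arc.

Local Open Scope nat_scope.

(** * Labels as stacks along walks *)

(** Both averages come from one recurrence. Give weight z^l to a label of length l. If c items are
    relevant, the smallest of them leaves, over its c equally likely choices, at most 0, ..., c-1
    items before its first visit and at most 0, ..., c-1 after it, whence c T(c) <= (1 + z) (T(0) +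
    ... + T(c-1)). For z = 1 this counts labels; for z = 2 the bound is still polynomial, so
    Markov's inequality makes long labels unlikely.

    With k items, label changes cost about k q messages per arc, and backward searches about log n /
    q per insertion. These balance at q = sqrt(log n / k); for arcs, k = m, this is the origin of
    the factor sqrt(log n) above 1 / sqrt m.

    The segment searched from u is selected by the last vertex of the label of u, hence by the
    ranks, which forces a union bound over all n + 1 candidates. The single ranked vertex met may
    forward to all its in-neighbours at every search; this is paid by a bound on in-degrees, or
    avoided by [skip]. *)

Lemma rank_ltxx a : rank_lt a a = false.
Proof. by case: a => //= i; rewrite ltnn. Qed.

Lemma rank_lt_trans : transitive rank_lt.
Proof. by case=> [j|] [i|] [k|] //=; apply: ltn_trans. Qed.

Lemma rank_lt_total a b : a != b -> ~~ rank_lt a b -> rank_lt b a.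
Proof.
by case: a b => [i|] [j|] //; rewrite (inj_eq Some_inj) /=; case: ltngtP.
Qed.

Lemma lex_ltxx s : lex_lt s s = false.
Proof. by elim: s => //= x s ->; rewrite rank_ltxx eqxx. Qed.

Lemma lex_lt_trans : transitive lex_lt.
Proof.
move=> t s u; elim: t s u => [|b t IHt] [|a s] [|c u] //=.
case/orP=> [ab|/andP[/eqP-> st]] /orP[bc|/andP[/eqP<- tu]].
- by rewrite (rank_lt_trans ab bc).
- by rewrite ab.
- by rewrite bc.
- by rewrite eqxx (IHt _ _ st tu) orbT.
Qed.

Lemma lex_lt_total s t : ~~ lex_lt s t -> ~~ lex_lt t s -> s = t.
Proof.
elim: s t => [|a s IHs] [|b t] //=.
rewrite !negb_or => /andP[ab st] /andP[ba ts].
have eqab : a = b by apply/eqP/negP => /negP/rank_lt_total/(_ ab); rewrite (negPf ba).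
by move: st ts; rewrite eqab eqxx => /IHs e /e ->.
Qed.

Section Labels.
Variables (n : nat) (r : 'I_n -> rank).
Hypothesis r_inj : forall x y, r x = r y -> r x != None -> x = y.
Implicit Types (x y z : 'I_n) (l a b c : seq 'I_n).

Definition label_lt a b := lex_lt (rho r a) (rho r b).
Definition label_le a b := ~~ label_lt b a.

Lemma label_lexx l : label_le l l.
Proof. by rewrite /label_le /label_lt lex_ltxx. Qed.

Lemma label_lt_trans : transitive label_lt.
Proof. move=> b a c; exact: lex_lt_trans. Qed.

Lemma label_lt_le a b : label_lt a b -> label_le a b.
Proof.
by move=> ab; apply/negP => /(label_lt_trans ab); rewrite /label_lt lex_ltxx.
Qed.

Lemma label_le_lt_trans a b c : label_le a b -> label_lt b c -> label_lt a c.
Proof.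
move=> ab bc; case: (boolP (label_lt a b)) => [/label_lt_trans->//|ba].
by rewrite /label_lt (lex_lt_total ba ab).
Qed.

Lemma label_lt_le_trans a b c : label_lt a b -> label_le b c -> label_lt a c.
Proof.
move=> ab bc; case: (boolP (label_lt b c)) => [/(label_lt_trans ab)//|cb].
by rewrite /label_lt -(lex_lt_total cb bc).
Qed.

Lemma label_le_trans a b c : label_le a b -> label_le b c -> label_le a c.
Proof.
move=> ab bc; apply/negP => /(label_le_lt_trans bc).
by apply/negP.
Qed.

(** The infinite rank closing [rho] has nothing above it, so strict sortedness also forces every
    vertex of the label to be ranked. *)
Definition wf_label l := sorted rank_lt (rho r l).

Lemma rho_cons x l : rho r (x :: l) = r x :: rho r l.
Proof. by []. Qed.

Lemma wf_label_cons x l : wf_label (x :: l) = path rank_lt (r x) (rho r l).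
Proof. by []. Qed.

Lemma wf_label_behead x l : wf_label (x :: l) -> wf_label l.
Proof. exact: path_sorted. Qed.

Lemma path_rho_ranked i l : path rank_lt i (rho r l) -> i != None.
Proof. by case: i l => [i|] [|x l]. Qed.

Lemma wf_label_ranked l x : wf_label l -> x \in l -> r x != None.
Proof.
elim: l => //= y l IHl wf; rewrite inE => /predU1P[->|/IHl->//].
  by apply: path_rho_ranked wf.
exact: wf_label_behead wf.
Qed.

Lemma label_lt_cons x a b : label_lt (x :: a) (x :: b) = label_lt a b.
Proof. by rewrite /label_lt !rho_cons /= rank_ltxx eqxx. Qed.

Lemma label_le_cons x a b : label_le (x :: a) (x :: b) = label_le a b.
Proof. by rewrite /label_le label_lt_cons. Qed.

Lemma label_le_anti a b : wf_label a -> wf_label b ->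
  label_le a b -> label_le b a -> a = b.
Proof.
move=> wa wb ba ab; have: rho r a = rho r b by apply: lex_lt_total.
elim: a b wa wb {ab ba} => [|x a IHa] [|y b] //=.
- by move=> _ /path_rho_ranked; rewrite /rho /= => + [e]; rewrite -e.
- by move=> /path_rho_ranked + _; rewrite /rho /= => + [e]; rewrite e.
- move=> wa wb; rewrite !rho_cons => -[rxy e].
  rewrite (r_inj rxy (path_rho_ranked wa)) (IHa b) //.
    exact: path_sorted wa.
  exact: path_sorted wb.
Qed.

Definition ranked_seq y : seq 'I_n := if r y != None then [:: y] else [::].

(** The bottom of the stack comes first. As ranks increase along it, popping the ranks not below
    [r y] amounts to keeping the longest prefix of smaller ones; an unranked [y] pops nothing from a
    well-formed stack. *)
Fixpoint push l y :=
  if l is x :: l' then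
    if rank_lt (r x) (r y) then x :: push l' y else ranked_seq y
  else ranked_seq y.

Lemma path_ranked_seq i y : i != None -> rank_lt i (r y) || (r y == None) ->
  path rank_lt i (rho r (ranked_seq y)).
Proof.
by rewrite /ranked_seq; case ry: (r y) => [j|]; rewrite /rho /= ?ry; case: i => //= i _; rewrite ?orbF => ->.
Qed.

Lemma wf_ranked_seq y : wf_label (ranked_seq y).
Proof. by rewrite /ranked_seq /wf_label; case ry: (r y) => [j|]; rewrite /rho /= ?ry. Qed.

Lemma path_push i l y : path rank_lt i (rho r l) -> rank_lt i (r y) || (r y == None) ->
  path rank_lt i (rho r (push l y)).
Proof.
elim: l i => [|x l IHl] i il iy; first exact: path_ranked_seq (path_rho_ranked il) iy.
rewrite /=; case: ifP => xy; last exact: path_ranked_seq (path_rho_ranked il) iy.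
by move: il; rewrite !rho_cons /= => /andP[-> xl]; apply: IHl; rewrite ?xy.
Qed.

Lemma wf_push l y : wf_label l -> wf_label (push l y).
Proof.
case: l => [|x l] /= wl; first exact: wf_ranked_seq.
case: ifP => xy; last exact: wf_ranked_seq.
by rewrite wf_label_cons path_push ?xy.
Qed.

Lemma mem_push l y x : x \in push l y -> (x \in l) || ((x == y) && (r y != None)).
Proof.
elim: l => [|z l IHl] /=; rewrite /ranked_seq; first by case: ifP; rewrite ?inE ?andbT.
case: ifP => _; rewrite ?inE; first by case/predU1P=> [->|/IHl]; rewrite ?eqxx // -orbA => ->; rewrite orbT.
by rewrite /ranked_seq; case: ifP => //; rewrite inE andbT => _ ->; rewrite orbT.
Qed.

Lemma push_unranked l y : wf_label l -> r y = None -> push l y = l.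
Proof.
move=> + ry; elim: l => [|x l IHl] /=; rewrite /ranked_seq ry //= => wl.
rewrite IHl ?(wf_label_behead wl) //.
by move: (path_rho_ranked wl); case: (r x).
Qed.

Lemma push_ranked l y : r y != None -> exists c, push l y = rcons c y.
Proof.
move=> ry; elim: l => [|x l [c IHl]] /=; rewrite /ranked_seq ry; first by exists [::].
by case: ifP => _; [exists (x :: c); rewrite IHl | exists [::]].
Qed.

Lemma push_lt l y : wf_label l -> y \notin l -> r y != None ->
  label_lt (push l y) l.
Proof.
move=> + + ry; elim: l => [|x l IHl] /=; rewrite /ranked_seq ry.
  by rewrite /label_lt /rho /=; case: (r y) ry.
rewrite inE negb_or => wl /andP[yx yl]; case: ifP => xy.
  by rewrite label_lt_cons IHl // (wf_label_behead wl).
rewrite /label_lt !rho_cons /= rank_lt_total ?xy //.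
apply: contra_neq yx => /esym e; exact: r_inj e ry.
Qed.

Lemma push_le l y : wf_label l -> y \notin l -> label_le (push l y) l.
Proof.
move=> wl yl; case: (boolP (r y == None)) => [/eqP/push_unranked-> //|ry].
  exact: label_lexx.
by apply: label_lt_le; apply: push_lt.
Qed.

(** At the first difference, let [x] in the smaller label face [z] in the larger. If [y] pops [x] it
    pops [z] too, and the results agree; if [x] stays, it faces [z], [y] or the end, all of larger
    rank. Monotonicity lets minima over walks be computed arc by arc. *)
Lemma push_mono a b y : wf_label a -> wf_label b -> label_le a b ->
  label_le (push a y) (push b y).
Proof.
elim: a b => [|x a IHa] [|z b].
- by move=> *; apply: label_lexx.
- move=> _ /path_rho_ranked rz.
  by rewrite /label_le /label_lt {1}/rho /=; case: (r z) rz.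
- move=> /path_rho_ranked rx _ _ /=.
  case: ifP => xy; last exact: label_lexx.
  apply: label_lt_le; rewrite /label_lt rho_cons /ranked_seq.
  by case: ifP => ry; rewrite /rho /= ?xy //; case: (r x) rx.
move=> wa wb; rewrite /label_le {1}/label_lt /= negb_or => /andP[zx].
case: eqP => /= [ezx ab|/eqP nzx _].
  rewrite ezx; case: ifP => xy; last by rewrite -/(label_le _ _) label_lexx.
  rewrite /label_lt !rho_cons /= ezx rank_ltxx eqxx /=.
  by apply: IHa ab; [apply: wf_label_behead wa|apply: wf_label_behead wb].
have xz := rank_lt_total nzx zx.
have rx := path_rho_ranked wa; rewrite -/(label_le _ _).
case: ifP => xy; last first.
  case: ifP => zy; last exact: label_lexx.
  by rewrite (rank_lt_trans xz zy) in xy.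
apply: label_lt_le; rewrite /label_lt rho_cons.
case: ifP => zy; first by rewrite rho_cons /= xz.
by rewrite /ranked_seq; case: ifP => ry; rewrite /rho /= ?xy //; case: (r x) rx.
Qed.

(** A label ending with [y] has only ranks below [r y] before it, so [y] pops just itself and
    returns. Writing [lab y] as [push (lab y) y] makes it comparable, by [push_mono], with
    [push (lab x) y]. *)
Lemma push_id b y : wf_label b -> (r y != None -> exists c, b = rcons c y) ->
  push b y = b.
Proof.
move=> wb bl; case: (boolP (r y == None)) => [/eqP/push_unranked->//|ry].
have {bl}[c bc] := bl ry; move: wb; rewrite bc.
elim: c {bc} => [|x c IHc] /= wb; first by rewrite rank_ltxx /ranked_seq ry.
rewrite (IHc (wf_label_behead wb)) //.
have : all (rank_lt (r x)) (rho r (rcons c y)).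
  by rewrite order_path_min //; apply: rank_lt_trans.
by rewrite /rho map_rcons !all_rcons => /and3P[_ -> _].
Qed.

Lemma push_cat c l y : all (fun x => rank_lt (r x) (r y)) c ->
  push (c ++ l) y = c ++ push l y.
Proof. by elim: c => //= x c IHc /andP[-> /IHc->]. Qed.

Lemma push_find l y : push l y =
  take (find (fun x => ~~ rank_lt (r x) (r y)) l) l ++ ranked_seq y.
Proof. by elim: l => //= x l ->; case: ifP. Qed.

Lemma mem_prefix (T : eqType) (s t : seq T) : prefix s t -> {subset s <= t}.
Proof. by case/prefixP=> s' -> x xs; rewrite mem_cat xs. Qed.

Lemma lcp_prefix (T : eqType) (s t : seq T) :
  s = lcp s t ++ drop (size (lcp s t)) s /\ prefix (lcp s t) t.
Proof.
elim: s t => [|x s IHs] [|y t] //=; case: eqP => //= <-.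
by have [<- ->] := IHs t; rewrite eqxx.
Qed.

(** Update keeps the common prefix without comparing its ranks with [r y]. This is sound because a
    ranked [y] ends its own label, so that the common prefix, which avoids [y], has only smaller
    ranks. *)
Lemma updated_label_push a b y : wf_label b -> y \notin a ->
  (r y != None -> exists c, b = rcons c y) ->
  updated_label r a b y = push a y.
Proof.
move=> wb ya bl; rewrite /updated_label.
have [ea pb] := lcp_prefix a b; set c := lcp a b in ea pb *.
rewrite [in RHS]ea push_cat ?push_find //.
apply/allP=> x xc; case: (boolP (r y == None)) => ry.
  have /(wf_label_ranked wb) : x \in b by apply: mem_prefix pb _ xc.
  by rewrite (eqP ry); case: (r x).
have {bl}[b' eb] := bl ry.
have xy : x != y by apply: contraNneq ya => <-; rewrite ea mem_cat xc.
have : x \in b by apply: mem_prefix pb _ xc.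
rewrite eb mem_rcons inE (negPf xy) /= => /splitPr xb'; move: wb; rewrite eb.
case: xb' => p1 p2; rewrite rcons_cat /wf_label /rho map_cat rcons_cat.
move/cat_sorted2 => [_] /=.
rewrite map_rcons => /(order_path_min rank_lt_trans).
by rewrite !all_rcons => /and3P[].
Qed.

Definition stack (p : seq 'I_n) := foldl push [::] p.

Lemma stack_rcons p y : stack (rcons p y) = push (stack p) y.
Proof. by rewrite /stack foldl_rcons. Qed.

Lemma wf_stack p : wf_label (stack p).
Proof. by elim/last_ind: p => // p y IHp; rewrite stack_rcons wf_push. Qed.

Lemma mem_stack p x : x \in stack p -> (x \in p) && (r x != None).
Proof.
elim/last_ind: p => // p y IHp; rewrite stack_rcons mem_rcons inE => /mem_push.
by case/orP=> [/IHp/andP[-> ->]|/andP[/eqP->]]; rewrite ?orbT // eqxx.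
Qed.

(** A ranked vertex is on top just after it is read. Hence only unranked vertices are read after the
    vertex that ends on top, and they leave the stack unchanged. *)
Lemma stack_last p x c : stack p = rcons c x ->
  exists p1 p2, p = rcons p1 x ++ p2 /\ stack (rcons p1 x) = rcons c x.
Proof.
elim/last_ind: p => [|p y IHp]; first by case: c.
move=> e; case: (boolP (r y == None)) => ry.
  move: e; rewrite stack_rcons push_unranked ?wf_stack ?(eqP ry) // => e.
  have [p1 [p2 [-> e']]] := IHp e; exists p1, (rcons p2 y).
  by rewrite rcons_cat.
have := e; rewrite stack_rcons.
have [c' ->] := push_ranked (stack p) ry.
by move/rcons_inj => [_ eyx]; exists p, [::]; rewrite cats0 -eyx e eyx.
Qed.

(** The vertex of smallest rank pops all that precedes it and is never popped: this is the source of
    the recursion in [records]. *)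
Lemma stack_min p1 p2 x : r x != None ->
  {in p1, forall y, ~~ rank_lt (r y) (r x)} ->
  {in p2, forall y, rank_lt (r x) (r y)} ->
  stack (p1 ++ x :: p2) = x :: stack p2.
Proof.
move=> rx p1x p2x; rewrite /stack foldl_cat /= -/(stack _).
have -> : push (stack p1) x = [:: x].
  have := @mem_stack p1; case: (stack p1) => [|y l] /=; rewrite /ranked_seq rx //.
  by move/(_ y (mem_head _ _))/andP => [/p1x/negPf->].
elim/last_ind: p2 p2x => // p2 y IHp p2x; rewrite !foldl_rcons IHp => [|z zp].
  by rewrite /= p2x // mem_rcons mem_head.
by apply: p2x; rewrite mem_rcons inE zp orbT.
Qed.

Definition is_best (W : seq (seq 'I_n)) l :=
  (exists2 p, p \in W & l = stack p) /\ {in W, forall p, label_le l (stack p)}.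

Lemma is_best_wf W l : is_best W l -> wf_label l.
Proof. by case=> -[p _ ->] _; apply: wf_stack. Qed.

Lemma is_best_catl W W' a b : is_best W a -> is_best W' b -> label_le a b ->
  is_best (W ++ W') a.
Proof.
move=> [[p pW ea] aW] [_ bW'] ab; split; first by exists p; rewrite // mem_cat pW.
move=> q; rewrite mem_cat => /orP[/aW//|/bW'].
exact: label_le_trans.
Qed.

Lemma is_best_catr W W' a b : is_best W a -> is_best W' b -> label_le b a ->
  is_best (W ++ W') b.
Proof.
move=> [_ aW] [[p pW' eb] bW'] ba; split.
  by exists p; rewrite // mem_cat pW' orbT.
move=> q; rewrite mem_cat => /orP[/aW|/bW'//].
exact: label_le_trans.
Qed.

Lemma is_best_push W a y : is_best W a ->
  is_best [seq rcons p y | p <- W] (push a y).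
Proof.
move=> [[p pW ->] aW]; split.
  by exists (rcons p y); rewrite ?stack_rcons //; apply/mapP; exists p.
by move=> _ /mapP[q qW ->]; rewrite stack_rcons push_mono ?wf_stack ?aW.
Qed.

End Labels.

(** * Prefix minima of a sequence of walks *)

Section Records.
Variable n : nat.
Implicit Types (x y z : 'I_n) (W : seq (seq 'I_n)) (o : seq (option 'I_n)).

Definition after x (p : seq 'I_n) := drop (index x p).+1 p.

(* The best labels of the prefixes of [W], when [o] lists the vertices by
   increasing rank; [None] stands for an unranked item. *)
Fixpoint records o W : seq (seq 'I_n) :=
  match o with
  | [::] => nseq (W != [::]) [::]
  | None :: o' => records o' W
  | Some x :: o' =>
      records o' (take (find (fun p => x \in p) W) W) ++
      [seq x :: l | l <- records o' [seq after x p | p <- W & x \in p]]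
  end.

Lemma records_nil o : records o [::] = [::].
Proof. by elim: o => [|[x|] o IHo] //=; rewrite IHo. Qed.

Lemma mem_after x p y : y \in after x p -> y \in p.
Proof. exact: mem_drop. Qed.

Lemma after_notin x p : uniq p -> x \notin after x p.
Proof.
case: (boolP (x \in p)) => [/splitPr[p1 p2]|/memNindex xp _]; last first.
  by rewrite /after xp drop_oversize.
rewrite cat_uniq /= negb_or => /and3P[_ /andP[xp1 _] /andP[xp2 _]].
by rewrite /after index_cat (negPf xp1) /= eqxx addn0 -cat_rcons drop_size_cat // size_rcons.
Qed.

(** If the head [x] of [o] occurs in [W0], a best walk goes through [x], its label starts with [x],
    and the rest is the best label of the suffixes after [x]; otherwise [W0] ends before the first
    visit to [x]. The hypotheses tie [r] to [o] only for vertices occurring in [W], because [r]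
    stays fixed while [o] loses its head. *)
Lemma mem_records (r : 'I_n -> rank) o W W0 l :
  (forall p, p \in W -> uniq p) ->
  (forall p y, p \in W -> y \in p -> (r y != None) = (Some y \in o)) ->
  (forall p p' y z, p \in W -> p' \in W -> y \in p -> z \in p' ->
     index (Some y) o < index (Some z) o -> rank_lt (r y) (r z)) ->
  prefix W0 W -> is_best r W0 l -> l \in records o W.
Proof.
elim: o W W0 l => [|[x|] o IHo] W W0 l uW unr rlt preW bW /=.
- case: W preW uW unr {rlt} => [|p0 W]; first by case: W0 bW => [[[]]|].
  move=> preW _ unr.
  case: bW => -[p pW0 ->] _; rewrite inE; apply/eqP.
  case e: (stack r p) => [|y l'] //.
  have : y \in stack r p by rewrite e mem_head.
  move/mem_stack/andP => [yp]; rewrite (unr p) //.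
  exact: mem_prefix preW _ pW0.
- have rx p y : p \in W -> y \in p -> x != y ->
      forall p', p' \in W -> x \in p' -> rank_lt (r x) (r y).
    move=> pW yp xy p' p'W xp'; apply: (rlt p' p) => //=.
    by rewrite eqxx (inj_eq Some_inj) (negPf xy).
  rewrite mem_cat; case: (boolP (has (fun p => x \in p) W0)) => [xW0|].
    apply/orP; right.
    have [p' p'W0 xp'] : exists2 p', p' \in W0 & x \in p' by apply/hasP.
    have p'W : p' \in W := mem_prefix preW p'W0.
    have stackx p : p \in W -> x \in p -> r x != None ->
        stack r p = x :: stack r (after x p).
      move=> pW xp rx0; have up := uW p pW.
      case/splitPr: xp pW up => p1 p2 pW up.
      rewrite /after index_cat; move: up; rewrite cat_uniq /= negb_or.
      case/and3P=> _ /andP[xp1 _] /andP[xp2 _].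
      rewrite (negPf xp1) /= eqxx addn0 -cat_rcons drop_size_cat ?size_rcons //.
      rewrite cat_rcons; apply: stack_min => // y yp.
        have xy: x != y by apply: contraNneq xp1 => ->.
        have := rx (p1 ++ x :: p2) y pW; rewrite mem_cat yp => /(_ isT xy _ p'W xp').
        by case: (r x) (r y) => [i|] [j|] //= /ltnW; rewrite leqNgt.
      have xy: x != y by apply: contraNneq xp2 => ->.
      by apply: (rx (p1 ++ x :: p2) y _ _ xy p'); rewrite // mem_cat inE yp !orbT.
    have rx0 : r x != None by rewrite (unr p') // mem_head.
    case: bW => -[p pW0 el] lW0; have pW := mem_prefix preW pW0.
    (* A walk avoiding [x] has an empty stack or one starting above [r x], so it would lose against
       [p']. *)
    have xp : x \in p.
      apply/negPn/negP => xp; have := lW0 p' p'W0.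
      rewrite el /label_le (stackx p') // => /negP; apply.
      rewrite /label_lt rho_cons.
      have := @mem_stack n r p; case: (stack r p) => [|y l'] /=.
        by rewrite /rho /=; case: (r x) rx0.
      move=> /(_ y (mem_head _ _))/andP[yp _].
      rewrite (rx p y pW yp _ p') //.
      by apply/eqP => e; rewrite e yp in xp.
    rewrite el stackx // map_f //.
    apply: (IHo _ [seq after x q | q <- W0 & x \in q]).
    + by move=> ? /mapP[q]; rewrite mem_filter => /andP[_ /uW uq] ->; apply: drop_uniq.
    + move=> ? y /mapP[q]; rewrite mem_filter => /andP[_ qW] -> yq.
      rewrite (unr q y qW (mem_after yq)) inE (inj_eq Some_inj).
      by case: eqP yq => // ->; rewrite (negPf (after_notin _ _)) ?uW.
    + move=> ? ? y z /mapP[q]; rewrite mem_filter => /andP[_ qW] ->.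
      move=> /mapP[q']; rewrite mem_filter => /andP[_ q'W] -> yq zq' lt.
      apply: (rlt q q') => //=; [exact: mem_after yq|exact: mem_after zq'|].
      case: eqP => [[xy]|_]; first by move: yq; rewrite -xy (negPf (after_notin _ _)) ?uW.
      case: eqP => [[xz]|_]; first by move: zq'; rewrite -xz (negPf (after_notin _ _)) ?uW.
      by rewrite ltnS.
    + case/prefixP: preW => W1 ->; rewrite filter_cat map_cat; exact: prefix_prefix.
    split; first by exists (after x p); rewrite ?map_f // mem_filter xp.
    move=> ? /mapP[q]; rewrite mem_filter => /andP[xq qW0] ->.
    have := lW0 q qW0; rewrite el (stackx p) // (stackx q) ?label_le_cons //.
    exact: mem_prefix preW _ qW0.
  move=> xW0; apply/orP; left.
  set i := find _ W.
  have pre : prefix W0 (take i W).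
    case/prefixP: preW => W1 eW; rewrite /i eW find_cat (negPf xW0) take_cat.
    by rewrite ltnNge leq_addr /= addKn; apply: prefix_prefix.
  have mW p : p \in take i W -> (p \in W) /\ (x \notin p).
    move=> pi; split; first exact: mem_take pi.
    have : ~~ has (fun p => x \in p) (take i W).
      by rewrite has_take_leq ?find_size // ltnn.
    by move/hasPn; apply.
  apply: (IHo _ W0) pre bW.
  + by move=> p /mW[/uW].
  + move=> p y /mW[pW xp] yp; rewrite (unr p) // inE (inj_eq Some_inj).
    by case: eqP yp => // ->; rewrite (negPf xp).
  + move=> p p' y z /mW[pW xp] /mW[p'W xp'] yp zp' lt; apply: (rlt p p') => //=.
    case: eqP => [[xy]|_]; first by rewrite xy yp in xp.
    case: eqP => [[xz]|_]; first by rewrite xz zp' in xp'.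
    by rewrite ltnS.
exact: (IHo _ W0) preW bW.
Qed.

End Records.

Lemma sum_permutations (T : eqType) (F : seq T -> nat) (e : seq T) :
  uniq e -> e != [::] ->
  \sum_(s <- permutations e) F s =
  \sum_(x <- e) \sum_(s <- permutations (rem x e)) F (x :: s).
Proof.
move=> ue e0.
transitivity (\sum_(s <- [seq x :: s | x <- e, s <- permutations (rem x e)]) F s);
  last by rewrite big_allpairs_dep.
apply: perm_big; apply: uniq_perm; first exact: permutations_uniq.
  apply: allpairs_uniq_dep => // [x _|]; first exact: permutations_uniq.
  by move=> [x s] [y t] _ _ /= [-> ->].
move=> s; rewrite mem_permutations; apply/idP/allpairsPdep.
  case: s => [|x s] es; first by move/perm_size: es e0; rewrite -size_eq0 => <-.
  have xe : x \in e by rewrite -(perm_mem es) mem_head.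
  exists x, s; split=> //; rewrite mem_permutations -(perm_cons x).
  by rewrite (perm_trans es) // perm_to_rem.
case=> x [t [xe te ->]]; rewrite mem_permutations in te.
by rewrite perm_sym (perm_trans (perm_to_rem xe)) // perm_cons perm_sym.
Qed.

(** Once [s] is sorted by decreasing key, only later entries can have a smaller key than a given
    one, so the counts are at most [size s - 1], ..., 0; ties only lower them. *)
Lemma sum_count_lt (T : eqType) (key : T -> nat) (f : nat -> nat) (s : seq T) :
  {homo f : i j / i <= j} ->
  \sum_(i <- s) f (count (fun j => key j < key i) s) <= \sum_(j < size s) f j.
Proof.
move=> fmono; pose ge := (fun i j => key j <= key i).
have ge_tr : transitive ge by move=> j i k ij jk; apply: leq_trans jk ij.
have ge_tot : total ge by move=> i j; apply: leq_total.
have : sorted ge (sort ge s) by apply: sort_sorted.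
have ps : perm_eq (sort ge s) s by rewrite perm_sort.
rewrite -(perm_big _ ps) -(perm_size ps) /=.
under eq_bigr => i _ do rewrite -(seq.permP ps).
elim: (sort ge s) => [|m t IHt] /=; first by rewrite !big_nil.
move=> mt; rewrite big_cons big_ord_recr /= addnC ltnn leq_add //.
  have /allP mint := order_path_min ge_tr mt.
  rewrite big_seq (eq_bigr (fun i => f (count (fun j => key j < key i) t))).
    by rewrite -big_seq; apply/IHt/(path_sorted mt).
  by move=> i /mint; rewrite /ge leqNgt => /negPf->.
by apply: fmono; apply: count_size.
Qed.

Section RecordCount.
Variables (n : nat) (T : eqType) (h : T -> option 'I_n) (pos : 'I_n -> nat).
Variables (z : nat) (f : nat -> nat).
Hypothesis f_mono : {homo f : i j / i <= j}.
Hypothesis f0 : 0 < f 0.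
(** Equality holds for [j.+1] when [z = 1] and for [j.+1 * j.+2] when [z = 2]. *)
Hypothesis f_sum : forall c, z.+1 * (\sum_(j < c) f j) <= c * f c.
Implicit Types (x y : 'I_n) (W : seq (seq 'I_n)) (e : seq T).

Definition occurs W i := if h i is Some x then has (fun p => x \in p) W else false.

Definition weight (ls : seq (seq 'I_n)) := \sum_(l <- ls) z ^ size l.

Lemma weight_cat l1 l2 : weight (l1 ++ l2) = weight l1 + weight l2.
Proof. exact: big_cat. Qed.

Lemma weight_map_cons x ls : weight [seq x :: l | l <- ls] = z * weight ls.
Proof.
by rewrite /weight big_map big_distrr /=; apply: eq_bigr => l _; rewrite expnS.
Qed.

Definition before x W := take (find (fun p : seq 'I_n => x \in p) W) W.
Definition suffixes x W := [seq after x p | p <- W & x \in p].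

Lemma weight_records o x W :
  weight (records (Some x :: o) W) =
  weight (records o (before x W)) + z * weight (records o (suffixes x W)).
Proof. by rewrite /= weight_cat weight_map_cons. Qed.

Lemma records_skip i o W : ~~ occurs W i -> records (h i :: o) W = records o W.
Proof.
rewrite /occurs; case: (h i) => //= x xW; rewrite (hasNfind xW) take_size.
suff -> : [seq p <- W | x \in p] = [::] by rewrite records_nil cats0.
by apply/eqP; rewrite -size_eq0 size_filter eqn0Ngt -has_count.
Qed.

(** One position function serves all walks, so the vertices seen after [x] on any of them lie among
    those of position below [pos x]. This is the form in which acyclicity enters the count. *)
Definition descending p := sorted (fun x y => pos y < pos x) p.

Lemma descending_uniq p : descending p -> uniq p.
Proof.
by apply: sorted_uniq => [b a c ab bc|a]; [apply: ltn_trans bc ab|rewrite ltnn].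
Qed.

Lemma descending_after x p : descending p -> x \in p ->
  {in after x p, forall y, pos y < pos x}.
Proof.
move=> + xp; case/splitPr: xp => p1 p2 dp y.
have := descending_uniq dp; rewrite cat_uniq /= negb_or => /and3P[_ /andP[xp1 _] _].
rewrite /after index_cat (negPf xp1) /= eqxx addn0 -cat_rcons drop_size_cat ?size_rcons //.
have tr : transitive (fun x y => pos y < pos x) by move=> b a c ab bc; apply: ltn_trans bc ab.
by case/cat_sorted2: dp => _ /(order_path_min tr)/allP; apply.
Qed.

Lemma has_find_lt (A : pred (seq 'I_n)) (B : pred (seq 'I_n)) W :
  has B (take (find A W) W) -> find B W < find A W.
Proof.
elim: W => //= p W IHW; case: ifP => //= _.
by case: (B p) => //= /IHW.
Qed.

(* Split according to the item of smallest rank: if its vertex occurs in [W], then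
   sorting the relevant items by first visit, resp. by position, shows that the
   counts left in [before] and [suffixes] are at most 0, 1, ..., c - 1. *)
Lemma sum_weight_records e W : uniq e -> {in W, forall p, descending p} ->
  \sum_(s <- permutations e) weight (records [seq h i | i <- s] W)
    <= (size e)`! * f (count (occurs W) e).
Proof.
move: {2}(size e) (erefl (size e)) => N.
elim: N e W => [|N IHN] e W sizee ue dW.
  have -> : e = [::] by apply: size0nil.
  rewrite /= big_seq1 /weight /=; case: W {dW} => [|p W] /=; first by rewrite big_nil.
  by rewrite big_seq1 /= fact0 mul1n.
rewrite sum_permutations //; last by rewrite -size_eq0 sizee.
set c := count (occurs W) e.
(* First-visit times serve for the walks before [x], positions for the suffixes after it: in both
   cases the items left over have a strictly smaller key than [i], and [sum_count_lt] applies. *)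
pose fst i := if h i is Some x then find (fun p => x \in p) W else 0.
pose ps i := if h i is Some x then pos x else 0.
pose e' := [seq i <- e | occurs W i].
have size_rem' i : i \in e -> size (rem i e) = N by move=> ie; rewrite size_rem // sizee.
have dsub W' i : i \in e -> {in W', forall p, descending p} ->
    \sum_(s <- permutations (rem i e)) weight (records [seq h i | i <- s] W')
      <= N`! * f (count (occurs W') (rem i e)).
  by move=> ie dW'; rewrite -[in leqRHS](size_rem' i ie); apply: IHN; rewrite ?size_rem' ?rem_uniq.
have cnt_rem W' i (P : pred T) : {in e, forall j, occurs W' j -> P j && occurs W j} ->
    count (occurs W') (rem i e) <= count P e'.
  move=> sub; apply: (@leq_trans (count (occurs W') e)).
    by apply: leq_count_subseq; apply: rem_subseq.
  rewrite count_filter.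
  rewrite (@eq_in_count _ _ (fun j => occurs W' j && (P j && occurs W j))).
    by apply: sub_count => j /= /andP[].
  by move=> j /sub; case: (occurs W' j) => // ->.
rewrite (bigID (occurs W)) /= -big_filter -/e' [X in _ + X]big_seq_cond.
have le1 : \sum_(i <- e') \sum_(s <- permutations (rem i e))
      weight (records [seq h j | j <- i :: s] W) <= N`! * (c * f c).
  apply: leq_trans (_ : N`! * (z.+1 * (\sum_(j < c) f j)) <= _); last by rewrite leq_mul2l f_sum orbT.
  have sc : size e' = c by rewrite size_filter.
  apply: (@leq_trans (\sum_(i <- e') N`! * (f (count (fun j => fst j < fst i) e')
     + z * f (count (fun j => ps j < ps i) e')))).
    rewrite big_seq [leqRHS]big_seq; apply: leq_sum => i.
    rewrite mem_filter => /andP[iW ie].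
    case hi: (h i) iW => [x|]; rewrite /occurs hi // => xW.
    under eq_bigr => s _ do rewrite /= hi weight_records.
    rewrite big_split /= -big_distrr /= mulnDr leq_add //.
      apply: leq_trans (dsub (before x W) i ie _) _.
        by move=> p /mem_take; apply: dW.
      rewrite leq_mul2l f_mono ?orbT //; apply: cnt_rem => j je.
      rewrite /occurs /fst hi; case: (h j) => // y yW.
      rewrite has_find_lt //=; case/hasP: yW => p /mem_take pW yp.
      by apply/hasP; exists p.
    rewrite mulnCA leq_mul2l.
    apply/orP; right; apply: leq_trans (dsub (suffixes x W) i ie _) _.
      move=> p /mapP[q]; rewrite mem_filter => /andP[_ /dW qW] ->.
      exact: drop_sorted.
    rewrite leq_mul2l f_mono ?orbT //; apply: cnt_rem => j je.
    rewrite /occurs /ps hi; case: (h j) => // y /hasP[p /mapP[q]].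
    rewrite mem_filter => /andP[xq qW] -> yq.
    rewrite (descending_after (dW _ qW) xq) //=.
    by apply/hasP; exists q => //; apply: mem_after yq.
  rewrite -big_distrr /= leq_mul2l big_split -big_distrr /= mulSn.
  by rewrite leq_add ?orbT // -sc ?leq_mul2l sum_count_lt ?orbT.
(* A smallest item that occurs nowhere in [W] just disappears from the order, and the relevant items
   remain; there are [N.+1 - c] such choices. *)
have le2 : \sum_(i <- e | (i \in e) && ~~ occurs W i)
   \sum_(s <- permutations (rem i e)) weight (records [seq h j | j <- i :: s] W)
   <= (N.+1 - c) * (N`! * f c).
  apply: (@leq_trans (\sum_(i <- e | (i \in e) && ~~ occurs W i) N`! * f c)).
    apply: leq_sum => i /andP[ie iW].
    under eq_bigr => s _ do rewrite map_cons records_skip //.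
    apply: leq_trans (dsub W i ie dW) _.
    by rewrite leq_mul2l f_mono ?orbT //; apply: leq_count_subseq; apply: rem_subseq.
  rewrite -big_seq_cond big_const_seq iter_addn_0 mulnC leq_mul2r -sizee /c.
  by rewrite -(count_predC (occurs W) e) addKn leqnn orbT.
have cN : c <= N.+1 by rewrite -sizee count_size.
rewrite sizee factS; apply: leq_trans (leq_add le1 le2) _.
rewrite mulnCA -mulnDl subnKC // mulnA //.
Qed.

End RecordCount.

(** * Flooding searches *)

Section Flooding.
Variables (n : nat) (next : 'I_n -> seq 'I_n) (root : 'I_n) (query : msg n).
Variables (verdict : 'I_n -> option bool) (query_time : 'I_n -> nat).
(** [Q] contains all vertices that may forward the query. [d] increases whenever the query is
    forwarded, so a positive answer, which travels back to first senders, can only end at the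
    root. *)
Variables (Q : pred 'I_n) (d : 'I_n -> nat).
Hypothesis Q_root : Q root.
Hypothesis Q_next : forall w x, Q w -> x \in next w -> verdict x = None -> Q x.
Hypothesis root_next : forall w, Q w -> root \in next w -> verdict root != None.
Hypothesis d_next : forall w x, Q w -> x \in next w -> verdict x = None -> d w < d x.
Implicit Types (st : search_state n) (q sent : seq (packet n)) (w x y s a : 'I_n).

Definition expanded st w :=
  (w == root) || ((senders st w != [::]) && (verdict w == None)).

(* The queries received by [x] that are still to be answered. *)
Definition pending st x :=
  if (verdict x != None) || (nays st x == size (next x)) then [::]
  else if ayes st x then behead (senders st x) else senders st x.

Definition queries_from q a := count (fun p => (p.1.1 == a) && (p.2 == None)) q.
Definition answers_to q a := count (fun p => (p.1.2 == a) && (p.2 != None)) q.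

Definition sum_pending (F : seq 'I_n -> nat) st := \sum_x F (pending st x).
Definition unexpanded_cost st := \sum_(w | Q w && ~~ expanded st w) 2 * size (next w).

(** Each query of [a] is in transit, held by its receiver, answered in transit, or answered and
    counted. Hence, while an answer to [a] is on its way, [a] has not yet heard from all its [next]
    neighbours. Several positive answers are counted once in [ayes], whence an inequality in
    [answers_le]. *)
Definition unanswered st q a := queries_from q a + answers_to q a
  + sum_pending (count_mem a) st + nays st a + ayes st a.

Definition sent_along_arc st s w := [/\ Q s, w \in next s & expanded st s].

(** Once the queue is empty, [query_sent] says that every query has arrived, and the two clauses on
    positive answers that each of them has been passed on: this is the completeness extracted in
    [searchP]. *)
Record search_inv st q : Prop := SearchInv {
  query_arc : forall s w, (s, w, None) \in q -> sent_along_arc st s w;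
  sender_arc : forall s w, s \in senders st w -> sent_along_arc st s w;
  query_sent : forall w x, expanded st w -> x \in next w ->
    ((w, x, None) \in q) || (w \in senders st x);
  aye_sent : forall w s, verdict w = Some true -> s \in senders st w ->
    ((w, s, Some true) \in q) || ayes st s;
  aye_forwarded : forall w, w != root -> ayes st w ->
    exists s t, senders st w = s :: t /\ ((w, s, Some true) \in q) || ayes st s;
  answers_le : forall a, unanswered st q a <= expanded st a * size (next a)
}.

(* A query in transit weighs 2 and an answer, sent or owed, weighs 1, so that every
   delivery lowers the potential. *)
Definition potential st q := size q + count (fun p => p.2 == None) q
  + sum_pending size st + unexpanded_cost st.

Lemma root_senders st q : search_inv st q -> verdict root = None ->
  senders st root = [::].
Proof.
move=> inv vr; case e: (senders st root) => [|s t] //.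
have [|Qs rs _] := @sender_arc _ _ inv s root; first by rewrite e mem_head.
by have := root_next Qs rs; rewrite vr.
Qed.

Lemma sum_pending_at st st' w (F : seq 'I_n -> nat) :
  (forall x, x != w -> pending st' x = pending st x) ->
  sum_pending F st' + F (pending st w) = sum_pending F st + F (pending st' w).
Proof.
move=> eq; rewrite /sum_pending (bigD1 w) //= [in RHS](bigD1 w) //= addnAC [in RHS]addnAC.
by congr (_ + _); [apply: addnC|apply: eq_bigr => x /eq->].
Qed.

Section Query.
Variables (st : search_state n) (q : seq (packet n)) (s w : 'I_n).
Hypothesis inv : search_inv st ((s, w, None) :: q).

Let st' := SearchState (set_at (senders st) w (rcons (senders st w) s))
                       (nays st) (ayes st).

Lemma query_received : sent_along_arc st s w.
Proof. by apply: (query_arc inv); rewrite mem_head. Qed.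

Lemma query_pending x : x != w -> pending st' x = pending st x.
Proof. by rewrite /pending /= /set_at => /negPf->. Qed.

Lemma query_expanded x :
  expanded st' x = expanded st x || ((x == w) && (verdict w == None)).
Proof.
rewrite /expanded /= /set_at; case: (eqVneq x w) => [->|_]; last by rewrite orbF.
have -> : rcons (senders st w) s != [::] by case: (senders st w).
by case: (w == root); case: (senders st w != [::]); case: (verdict w == None).
Qed.

Lemma query_senders x : {subset senders st x <= senders st' x}.
Proof.
by move=> y; rewrite /= /set_at; case: eqP => // ->; rewrite mem_rcons inE orbC => ->.
Qed.

Lemma query_inv sent :
  {in sent, forall p, p.2 = None -> [/\ p.1.1 = w, p.1.2 \in next w & verdict w = None]} ->
  (~~ expanded st w -> verdict w = None -> {in next w, forall x, (w, x, None) \in sent}) ->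
  (verdict w = Some true -> (w, s, Some true) \in sent) ->
  (forall a, unanswered st' (q ++ sent) a <= expanded st' a * size (next a)) ->
  search_inv st' (q ++ sent).
Proof.
move=> sentQ sentN sentT ans; have [Qs ws exps] := query_received.
have ex x : expanded st x -> expanded st' x by rewrite query_expanded => ->.
have arc a b : sent_along_arc st a b -> sent_along_arc st' a b by case=> ? ? /ex.
split=> //.
- move=> a b; rewrite mem_cat => /orP[abq|/sentQ /(_ erefl) [/= -> bw vw]].
    by apply/arc/(query_arc inv); rewrite inE abq orbT.
  split=> //; first exact: Q_next Qs ws vw.
  by rewrite query_expanded eqxx vw orbT.
- move=> a b; rewrite /= /set_at; case: eqP => [->|_ ab]; last exact/arc/(sender_arc inv).
  by rewrite mem_rcons inE => /predU1P[->|ab]; apply/arc => //; apply: (sender_arc inv).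
- move=> a x ea xa; rewrite mem_cat; case: (boolP (expanded st a)) => [ea'|nea].
    have := query_sent inv ea' xa; rewrite inE => /orP[/predU1P[[-> ->]|->//]|/query_senders->].
      by rewrite /= /set_at eqxx mem_rcons mem_head orbT.
    by rewrite orbT.
  move: ea; rewrite query_expanded (negPf nea) => /andP[/eqP ea /eqP vw].
  by rewrite ea sentN ?orbT // -ea.
- move=> a b va; rewrite /= /set_at mem_cat; case: eqP va => [->|_] va ba.
    move: ba; rewrite mem_rcons inE => /predU1P[->|ba]; first by rewrite sentT ?orbT.
    by have := aye_sent inv va ba; rewrite inE => /orP[/predU1P[//|->]|->] //; rewrite orbT.
  by have := aye_sent inv va ba; rewrite inE => /orP[/predU1P[//|->]|->] //; rewrite orbT.
- move=> a ar /(aye_forwarded inv ar)[b [t [eb bt]]].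
  have bt' : ((a, b, Some true) \in q ++ sent) || ayes st b.
    by move: bt; rewrite inE mem_cat => /orP[/predU1P[//|->]|->] //; rewrite orbT.
  rewrite /= /set_at; case: eqP => [ea|_]; last by exists b, t.
  by exists b, (rcons t s); rewrite -ea eb.
Qed.

Lemma queries_from_cons a : queries_from ((s, w, None) :: q) a = (s == a) + queries_from q a.
Proof. by rewrite /queries_from /= andbT. Qed.

Lemma answers_to_cons a : answers_to ((s, w, None) :: q) a = answers_to q a.
Proof. by rewrite /answers_to /= andbF. Qed.

Lemma query_unexpanded_le : unexpanded_cost st' <= unexpanded_cost st.
Proof.
rewrite /unexpanded_cost big_mkcond [leqRHS]big_mkcond leq_sum // => x _.
by rewrite query_expanded negb_or; case: (Q x); case: (expanded st x) => //=; case: ifP.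
Qed.

Lemma query_sum_pending (F : seq 'I_n -> nat) :
  sum_pending F st' + F (pending st w) = sum_pending F st + F (pending st' w).
Proof. by apply: sum_pending_at; apply: query_pending. Qed.

Lemma receive_query_inv : let: (st1, sent) := receive_query next verdict st s w in
  search_inv st1 (q ++ sent) /\
  potential st1 (q ++ sent) < potential st ((s, w, None) :: q).
Proof.
have [Qs ws exps] := query_received.
have cats p a : queries_from (q ++ p) a = queries_from q a + queries_from p a /\
                answers_to (q ++ p) a = answers_to q a + answers_to p a.
  by rewrite /queries_from /answers_to !count_cat.
have exle a : expanded st a * size (next a) <= expanded st' a * size (next a).
  by rewrite leq_mul2r query_expanded; case: (expanded st a); rewrite orbT.
(* Covers the two situations in which [w] replies at once: a verdict, or all negative answers
   already in. In neither does [w] owe an answer, before or after. *)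
have imm b : pending st w = [::] -> pending st' w = [::] ->
    (verdict w = Some true -> b = true) ->
    (~~ expanded st w -> verdict w = None -> next w = [::]) ->
    search_inv st' (q ++ [:: (w, s, Some b)]) /\
    potential st' (q ++ [:: (w, s, Some b)]) < potential st ((s, w, None) :: q).
  move=> p0 p0' vb nx; split.
    apply: query_inv.
    - by move=> p; rewrite inE => /eqP->.
    - by move=> e v x; rewrite nx.
    - by move=> /vb->; rewrite mem_head.
    - move=> a; apply: leq_trans (exle a); apply: leq_trans (answers_le inv a).
      rewrite /unanswered queries_from_cons answers_to_cons.
      have [-> ->] := cats [:: (w, s, Some b)] a.
      have := query_sum_pending (count_mem a); rewrite p0 p0' !addn0 => ->.
      by rewrite /queries_from /answers_to /= andbF andbT; lia.
  have := query_sum_pending size; rewrite p0 p0' !addn0 => e.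
  rewrite /potential size_cat count_cat /= -e.
  have := query_unexpanded_le. lia.
rewrite /receive_query -/st'.
case vw: (verdict w) => [b|].
  by apply: imm; rewrite ?vw ?/pending ?vw //; case=> ->.
have Qw : Q w by apply: Q_next Qs ws vw.
have wr : w != root by apply/eqP => e; move: (root_next Qs); rewrite -e vw => /(_ ws).
have answ := answers_le inv w.
case: (boolP (nays st w == size (next w))) => [nw|nw].
  apply: imm; rewrite ?vw // /pending /= ?vw ?nw //= => /negPf ew _.
  apply: size0nil; rewrite -(eqP nw); move: answ; rewrite ew /unanswered; lia.
have pw l : pending (SearchState l (nays st) (ayes st)) w = if ayes st w then behead (l w) else l w.
  by rewrite /pending /= vw (negPf nw).
have pst : pending st w = if ayes st w then behead (senders st w) else senders st w.
  by rewrite /pending /= vw (negPf nw).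
have pst' : pending st' w = if ayes st w then behead (rcons (senders st w) s) else rcons (senders st w) s.
  by rewrite pw /= /set_at eqxx.
case es: (senders st w) => [|s0 t].
  have ew : expanded st w = false by rewrite /expanded es /= (negPf wr).
  have aw : ayes st w = false by move: answ; rewrite ew /unanswered; case: (ayes st w) => //; lia.
  rewrite aw es /= in pst pst'.
  split.
    apply: query_inv.
    - by move=> p /mapP[x xw ->] _ /=; split; rewrite ?vw.
    - by move=> _ _ x xw; apply/mapP; exists x.
    - by rewrite vw.
    - move=> a; have := answers_le inv a.
      rewrite /unanswered queries_from_cons answers_to_cons.
      have [-> ->] := cats [seq (w, x, None) | x <- next w] a.
      have := query_sum_pending (count_mem a); rewrite pst pst' /=.
      have -> : queries_from [seq (w, x, None) | x <- next w] a = (w == a) * size (next w).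
        rewrite /queries_from count_map.
        rewrite (eq_count (a2 := if w == a then predT else pred0)); last first.
          by move=> x /=; case: (w == a).
        by case: (w == a); rewrite ?count_predT ?count_pred0 ?mul1n.
      have -> : answers_to [seq (w, x, None) | x <- next w] a = 0.
        rewrite /answers_to count_map (eq_count (a2 := pred0)) ?count_pred0 // => x.
        by rewrite /= andbF.
      rewrite query_expanded vw eqxx andbT [a == w]eq_sym.
      case: (eqVneq w a) => [<-|_]; rewrite ?ew ?orbF /=; last by lia.
      have -> : (s == w) = false by apply/eqP => e; rewrite -e exps in ew.
      lia.
  rewrite /potential size_cat count_cat size_map.
  have -> : count (fun p => p.2 == None) [seq (w, x, None : option bool) | x <- next w] = size (next w).
    by rewrite count_map -[RHS]count_predT; apply: eq_count.
  have := query_sum_pending size; rewrite pst pst' /= addn0 => ->.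
  have -> : unexpanded_cost st = 2 * size (next w) + unexpanded_cost st'.
    rewrite /unexpanded_cost (bigD1 w) ?Qw ?ew //=; congr (_ + _); apply: eq_bigl => x.
    by rewrite query_expanded vw andbT; case: (Q x); case: (expanded st x); case: (x == w).
  rewrite /=; lia.
split.
  apply: query_inv.
  - by move=> p.
  - by rewrite /expanded es vw /= orbT.
  - by rewrite vw.
  - move=> a; apply: leq_trans (exle a); apply: leq_trans (answers_le inv a).
    rewrite /unanswered queries_from_cons answers_to_cons cats0.
    have := query_sum_pending (count_mem a); rewrite pst pst' es.
    by case: (ayes st w) => /=; rewrite -cats1 count_cat /=; lia.
rewrite /potential cats0 /=.
have := query_sum_pending size; rewrite pst pst' es.
have := query_unexpanded_le.
case: (ayes st w) => /=; rewrite size_rcons; lia.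
Qed.

End Query.

Section Answer.
Variables (st : search_state n) (q : seq (packet n)) (s w : 'I_n) (b : bool).
Hypothesis inv : search_inv st ((s, w, Some b) :: q).

Lemma answer_expanded : expanded st w /\ nays st w + ayes st w < size (next w).
Proof.
have := answers_le inv w; rewrite /unanswered /answers_to /= eqxx /=.
by case: (expanded st w); lia.
Qed.

Lemma answer_inv nys ays sent :
  let st' := SearchState (senders st) nys ays in
  (forall x, ayes st x -> ays x) -> (b -> ays w) ->
  {in sent, forall p, p.2 != None} ->
  (forall y, y != root -> ays y -> ~~ ayes st y ->
     exists s1 t, senders st y = s1 :: t /\ (y, s1, Some true) \in sent) ->
  (forall a, unanswered st' (q ++ sent) a <= expanded st a * size (next a)) ->
  search_inv st' (q ++ sent).
Proof.
move=> st' mono aw sentA new ans.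
have flag y x : ((y, x, Some true) \in (s, w, Some b) :: q) || ayes st x ->
    ((y, x, Some true) \in q ++ sent) || ays x.
  rewrite inE mem_cat => /orP[/predU1P[[_ -> bT]|->//]|/mono->]; last by rewrite orbT.
  by rewrite aw -?bT ?orbT.
split=> //=.
- move=> a x; rewrite mem_cat => /orP[axq|/sentA//].
  by apply: (query_arc inv); rewrite inE axq orbT.
- by move=> a x; apply: (sender_arc inv).
- move=> a x ea xa; have := query_sent inv ea xa.
  by rewrite inE mem_cat => /orP[/predU1P[//|->]|->]; rewrite ?orbT.
- by move=> a x va xa; apply/flag/(aye_sent inv).
- move=> a ar aa; case: (boolP (ayes st a)) => [/(aye_forwarded inv ar)|naa].
    by case=> s1 [t [-> /flag]]; exists s1, t.
  have [s1 [t [-> s1t]]] := new a ar aa naa.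
  by exists s1, t; rewrite mem_cat s1t orbT.
Qed.

Lemma queries_from_answer a : queries_from ((s, w, Some b) :: q) a = queries_from q a.
Proof. by rewrite /queries_from /= andbF. Qed.

Lemma answers_to_answer a : answers_to ((s, w, Some b) :: q) a = (w == a) + answers_to q a.
Proof. by rewrite /answers_to /= andbT. Qed.

Lemma receive_answer_inv : let: (st1, sent) := receive_answer next root st w b in
  search_inv st1 (q ++ sent) /\
  potential st1 (q ++ sent) < potential st ((s, w, Some b) :: q).
Proof.
have [ew nw] := answer_expanded.
have cats p a : queries_from (q ++ p) a = queries_from q a + queries_from p a /\
                answers_to (q ++ p) a = answers_to q a + answers_to p a.
  by rewrite /queries_from /answers_to !count_cat.
have vw : w != root -> verdict w = None.
  by move=> wr; move: ew; rewrite /expanded (negPf wr) => /andP[_ /eqP].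
have p_root : pending st root = [::].
  rewrite /pending; case vr: (verdict root) => //=.
  by rewrite (root_senders inv vr) /= !if_same.
have pw : w != root -> pending st w = if ayes st w then behead (senders st w) else senders st w.
  by move=> wr; rewrite /pending vw //= ltn_eqF //; apply: leq_ltn_trans nw; apply: leq_addr.
have answers_sent (l : seq 'I_n) c a : queries_from [seq (w, x, Some c) | x <- l] a = 0 /\
    answers_to [seq (w, x, Some c) | x <- l] a = count_mem a l.
  rewrite /queries_from /answers_to !count_map; split.
    by rewrite (eq_count (a2 := pred0)) ?count_pred0 // => x /=; rewrite andbF.
  by apply: eq_count => x /=; rewrite andbT.
have queries_sent (l : seq 'I_n) c : count (fun p => p.2 == None) [seq (w, x, Some c) | x <- l] = 0.
  by rewrite count_map (eq_count (a2 := pred0)) ?count_pred0.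
have pend0 nys ays x : nays st x = nys x -> ayes st x = ays x ->
    pending (SearchState (senders st) nys ays) x = pending st x.
  by rewrite /pending /= => -> ->.
have stale : search_inv (SearchState (senders st) (nays st) (ayes st)) (q ++ [::]) -> 
  potential st (q ++ [::]) < potential st ((s, w, Some b) :: q).
  by rewrite /potential cats0 /=; lia.
rewrite /receive_answer; case eb: b.
  case: (boolP (ayes st w)) => aw.
    have inv1 : search_inv (SearchState (senders st) (nays st) (ayes st)) (q ++ [::]).
      apply: answer_inv => // [y _ ->//|a].
      apply: leq_trans (answers_le inv a).
      rewrite /unanswered queries_from_answer answers_to_answer cats0.
      have -> F : sum_pending F (SearchState (senders st) (nays st) (ayes st)) = sum_pending F st.
        by apply: eq_bigr => x _; rewrite pend0.
      by rewrite /=; lia.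
    split; last exact: stale.
    by case: (st) inv1.
  set ays := set_at (ayes st) w true.
  have ays_mono x : ayes st x -> ays x by rewrite /ays /set_at; case: eqP.
  have pend x : x != w -> pending (SearchState (senders st) (nays st) ays) x = pending st x.
    by move=> xw; rewrite pend0 // /ays /set_at (negPf xw).
  have sums F := sum_pending_at F pend.
  have uc : unexpanded_cost (SearchState (senders st) (nays st) ays) = unexpanded_cost st by [].
  case: (eqVneq w root) => [wr|wr].
    have pr' : pending (SearchState (senders st) (nays st) ays) w = [::].
      move: p_root; rewrite /pending -wr /=; case: ifP => // _.
      by rewrite (negPf aw) /ays /set_at eqxx => ->.
    have pr : pending st w = [::] by rewrite wr.
    split.
      apply: answer_inv => //.
      - by rewrite /ays /set_at eqxx.
      - by move=> y yr; rewrite /ays /set_at; case: eqP => [e|_ ->//]; rewrite e wr eqxx in yr.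
      move=> a; apply: leq_trans (answers_le inv a).
      rewrite /unanswered queries_from_answer answers_to_answer cats0.
      have := sums (count_mem a); rewrite pr pr' !addn0 => -> /=.
      rewrite /ays /set_at [a == w]eq_sym; case: (eqVneq w a) => [<-|_]; lia.
    rewrite /potential cats0 uc /=; have := sums size; rewrite pr pr'; lia.
  case es: (senders st w) => [|s1 t].
    by move: ew; rewrite /expanded (negPf wr) es.
  have pw1 : pending st w = s1 :: t by rewrite pw // (negPf aw) es.
  have pw2 : pending (SearchState (senders st) (nays st) ays) w = t.
    rewrite /pending /= vw //= ltn_eqF; last by apply: leq_ltn_trans nw; apply: leq_addr.
    by rewrite /ays /set_at eqxx es.
  have -> : take 1 (s1 :: t) = [:: s1] by rewrite /= take0.
  split.
    apply: answer_inv => //.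
    - by rewrite /ays /set_at eqxx.
    - by move=> p; rewrite inE => /eqP->.
    - move=> y yr; rewrite /ays /set_at; case: eqP => [-> _ _|_ ->//].
      by exists s1, t; rewrite mem_head.
    move=> a; apply: leq_trans (answers_le inv a).
    rewrite /unanswered queries_from_answer answers_to_answer.
    have [-> ->] := cats [seq (w, x, Some true) | x <- [:: s1]] a.
    have [-> ->] := answers_sent [:: s1] true a.
    have := sums (count_mem a); rewrite pw1 pw2 /=.
    rewrite /ays /set_at [a == w]eq_sym; case: (eqVneq w a) => [<-|_]; lia.
  rewrite /potential size_cat count_cat uc /=; have := sums size; rewrite pw1 pw2 /=; lia.
set nys := set_at (nays st) w (nays st w).+1.
have pend x : x != w -> pending (SearchState (senders st) nys (ayes st)) x = pending st x.
  by move=> xw; rewrite pend0 // /nys /set_at (negPf xw).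
have sums F := sum_pending_at F pend.
have uc : unexpanded_cost (SearchState (senders st) nys (ayes st)) = unexpanded_cost st by [].
case: ifP => [/andP[full wr]|nfull].
  have aw : ayes st w = false.
    by move: nw; rewrite -(eqP full); case: (ayes st w) => //; rewrite addn1 ltnn.
  have pw1 : pending st w = senders st w by rewrite pw // aw.
  have pw2 : pending (SearchState (senders st) nys (ayes st)) w = [::].
    by rewrite /pending /= /nys /set_at eqxx full orbT.
  split.
    apply: answer_inv => //.
    - by rewrite eb.
    - by move=> p /mapP[x _ ->].
    - by move=> y _ ->.
    move=> a; apply: leq_trans (answers_le inv a).
    rewrite /unanswered queries_from_answer answers_to_answer.
    have [-> ->] := cats [seq (w, x, Some false) | x <- senders st w] a.
    have [-> ->] := answers_sent (senders st w) false a.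
    have := sums (count_mem a); rewrite pw1 pw2 /=.
    rewrite /nys /set_at [a == w]eq_sym; case: (eqVneq w a) => [<-|_]; lia.
  rewrite /potential size_cat count_cat queries_sent size_map uc /=.
  by have := sums size; rewrite pw1 pw2 /=; lia.
have pw' : pending (SearchState (senders st) nys (ayes st)) w = pending st w.
  case: (eqVneq w root) => [wr|wr].
    move: p_root; rewrite wr /pending /=; case vr: (verdict root) => //=.
    by rewrite (root_senders inv vr) /= !if_same.
  rewrite pw // /pending /= vw //= /nys /set_at eqxx.
  by move: nfull; rewrite wr andbT => ->.
split.
  apply: answer_inv; rewrite ?eb //; first by move=> y _ ->.
  move=> a; apply: leq_trans (answers_le inv a).
  rewrite /unanswered queries_from_answer answers_to_answer cats0.
  have := sums (count_mem a); rewrite pw' => /addIn -> /=.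
  rewrite /nys /set_at [a == w]eq_sym; case: (eqVneq w a) => [<-|_]; lia.
rewrite /potential cats0 uc /=; have := sums size; rewrite pw'; lia.
Qed.

End Answer.

Lemma flood_inv fuel st q : search_inv st q -> potential st q <= fuel ->
  let: (tr, st') := flood next root query verdict query_time fuel st q in
  [/\ size tr <= potential st q, search_inv st' [::] &
     forall e, List.In e tr ->
       (ev_msg e = query /\ ev_time e = msg_words query + query_time (ev_dst e)) \/
       (exists b, ev_msg e = Answer b /\ ev_time e = 2)].
Proof.
elim: fuel st q => [|k IHk] st [|[[s w] c] q] inv pot /=; try by split=> // e [].
set X := (match c with None => _ | _ => _ end).
have [e [st1 [sent [-> [eE inv1 pot1]]]]] : exists e st1 sent, X = (e, (st1, sent)) /\
   [/\ ((ev_msg e = query /\ ev_time e = msg_words query + query_time (ev_dst e)) \/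
       (exists b, ev_msg e = Answer b /\ ev_time e = 2)),
      search_inv st1 (q ++ sent) & potential st1 (q ++ sent) < potential st ((s, w, c) :: q)].
  rewrite /X; case: c inv {pot X} => [b|] inv.
    have := receive_answer_inv inv; case: receive_answer => st1 sent [inv1 pot1].
    by exists (Event s w (Answer b) (1 + 1)), st1, sent; split=> //; split=> //; right; exists b.
  have := receive_query_inv inv; case: receive_query => st1 sent [inv1 pot1].
  by exists (Event s w query (msg_words query + query_time w)), st1, sent; split=> //; split=> //; left.
have := IHk st1 (q ++ sent) inv1 (leq_trans pot1 pot).
case: flood => tr st2 [sz inv2 evs]; split=> //=.
  exact: leq_ltn_trans sz pot1.
by move=> e' [<-//|/evs].
Qed.

Definition search_cost := 2 * \sum_(w | Q w) size (next w).

Lemma search_init_inv :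
  search_inv (search_init n) [seq (root, x, None) | x <- next root].
Proof.
have er : expanded (search_init n) root by rewrite /expanded eqxx.
have e0 w : expanded (search_init n) w = (w == root) by rewrite /expanded /= orbF.
split=> //.
- by move=> s w /mapP[x xr [-> ->]].
- move=> w x; rewrite e0 => /eqP-> xr; apply/orP; left.
  by apply/mapP; exists x.
move=> a; rewrite /unanswered /= !addn0.
have -> : sum_pending (count_mem a) (search_init n) = 0.
  by apply: big1 => x _; rewrite /pending /= !if_same.
rewrite /queries_from /answers_to !count_map addn0 e0.
rewrite [X in _ + X](eq_count (a2 := pred0)) ?count_pred0 => [|x]; last by rewrite /= andbF.
rewrite (eq_count (a2 := if a == root then predT else pred0)).
  by case: eqP => [->|]; rewrite ?count_predT ?count_pred0 ?mul1n addn0.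
by move=> x /=; rewrite andbT eq_sym; case: (a == root).
Qed.

Lemma search_init_potential :
  potential (search_init n) [seq (root, x, None) | x <- next root] = search_cost.
Proof.
rewrite /potential /search_cost size_map count_map.
rewrite (eq_count (a2 := predT)) ?count_predT //.
have -> : sum_pending size (search_init n) = 0.
  by apply: big1 => x _; rewrite /pending /= !if_same.
rewrite big_distrr /= [in RHS](bigD1 root) //= /unexpanded_cost addn0 mul2n addnn.
congr (_ + _); apply: eq_bigl => w.
by rewrite /expanded /= orbF.
Qed.

Lemma searchP fuel : search_cost <= fuel ->
  let: (tr, st) := search next root query verdict query_time fuel in
  [/\ size tr <= search_cost,
      {in next root, forall x, senders st x != [::]},
      forall w, senders st w != [::] -> verdict w = None ->
        {in next w, forall x, senders st x != [::]},
      forall w, senders st w != [::] -> verdict w = Some true -> ayes st root &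
      forall e, List.In e tr ->
       (ev_msg e = query /\ ev_time e = msg_words query + query_time (ev_dst e)) \/
       (exists b, ev_msg e = Answer b /\ ev_time e = 2)].
Proof.
rewrite -search_init_potential => /(flood_inv search_init_inv).
rewrite /search; case: flood => tr st [sz inv evs].
have ne w s : s \in senders st w -> senders st w != [::] by case: (senders st w).
split=> //.
- move=> x xr; apply: (ne x root).
  by have := query_sent inv _ xr; rewrite in_nil /=; apply; rewrite /expanded eqxx.
- move=> w sw vw x xw; apply: (ne x w).
  by have := query_sent inv _ xw; rewrite in_nil /=; apply; rewrite /expanded sw vw orbT.
(* A positive answer goes from [w] to its first sender, whose [d] is smaller, so the chain reaches
   the root. *)
have up w : ayes st w -> w != root -> verdict w = None -> ayes st root.
  have [k] := ubnP (d w); elim: k w => // k IHk w dk aw wr vw.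
  have [s [t [es]]] := aye_forwarded inv wr aw; rewrite in_nil /= => as_.
  have [Qs ws es'] : sent_along_arc st s w by apply: (sender_arc inv); rewrite es mem_head.
  case: (eqVneq s root) => [<-//|sr]; apply: (IHk s) => //.
    by apply: leq_trans (d_next Qs ws vw) _.
  by move: es'; rewrite /expanded (negPf sr) => /andP[_ /eqP].
move=> w; case es: (senders st w) => [//|s t] _ vw.
have sw : s \in senders st w by rewrite es mem_head.
have := aye_sent inv vw sw; rewrite in_nil /= => as_.
have [_ _ es'] := sender_arc inv sw.
case: (eqVneq s root) => [<-|sr] //; apply: up as_ (sr) _.
by move: es'; rewrite /expanded (negPf sr) => /andP[_ /eqP].
Qed.

End Flooding.

(** * Update *)

Section Acyclic.
Variable n : nat.
Implicit Types (G : graph n) (x y z w : 'I_n) (p : seq 'I_n).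

Definition acyclic G := all (fun e => ~~ connect (arc G) e.2 e.1) G.

Lemma acyclicP G : reflect (forall x y, (x, y) \in G -> ~~ connect (arc G) y x) (acyclic G).
Proof.
apply: (iffP allP) => [ac x y /ac//|ac [x y] /=]; exact: ac.
Qed.

Lemma mem_out_nbrs G x y : (y \in out_nbrs G x) = ((x, y) \in G).
Proof.
apply/mapP/idP => [[[a b]]|xy]; last by exists (x, y); rewrite // mem_filter /= eqxx.
by rewrite mem_filter => /andP[/eqP /= <- ab] ->.
Qed.

Lemma mem_in_nbrs G x y : (x \in in_nbrs G y) = ((x, y) \in G).
Proof.
apply/mapP/idP => [[[a b]]|xy]; last by exists (x, y); rewrite // mem_filter /= eqxx.
by rewrite mem_filter => /andP[/eqP /= <- ab] ->.
Qed.

(** Counting reachable vertices gives a measure that drops along arcs and is at most [n]. It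
    provides the position of [descending], the recursion depth of Update and the measure [d] of both
    searches. *)
Definition height G x := #|[set y | connect (arc G) x y]|.

Lemma height_gt0 G x : 0 < height G x.
Proof. by apply/card_gt0P; exists x; rewrite inE connect0. Qed.

Lemma height_le G x : height G x <= n.
Proof. by rewrite -[leqRHS]card_ord; apply: max_card. Qed.

Lemma height_lt G x y : acyclic G -> (x, y) \in G -> height G y < height G x.
Proof.
move=> /acyclicP ac xy; apply: proper_card; apply/properP; split.
  by apply/subsetP => z; rewrite !inE; apply: connect_trans; apply: connect1.
by exists x; rewrite !inE ?connect0 ?ac.
Qed.

Lemma sub_connect G G' : {subset G <= G'} ->
  forall x y, connect (arc G) x y -> connect (arc G') x y.
Proof. by move=> sub; apply: connect_sub => x y xy; apply/connect1/sub. Qed.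

Lemma connect_rcons G u v x y : connect (arc (rcons G (u, v))) x y ->
  connect (arc G) x y \/ (connect (arc G) x u /\ connect (arc G) v y).
Proof.
case/connectP => p; elim: p x => [|z p IHp] x /=; first by move=> _ ->; left; apply: connect0.
rewrite {1}/Defs.arc /= mem_rcons inE => /andP[xz zp] yp.
case: (IHp z zp yp) => [zy|[zu vy]].
  case/predU1P: xz => [[-> ez]|xz]; first by right; rewrite connect0 -ez.
  by left; apply: connect_trans zy; apply: connect1.
case/predU1P: xz => [[-> _]|xz]; first by right; rewrite connect0.
by right; split=> //; apply: connect_trans zu; apply: connect1.
Qed.

Lemma acyclic_rcons G u v : acyclic G ->
  acyclic (rcons G (u, v)) = ~~ connect (arc G) v u.
Proof.
move=> ac; have sub : {subset G <= rcons G (u, v)} by move=> e; rewrite mem_rcons inE orbC => ->.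
apply/idP/idP => [/acyclicP ac'|nvu].
  have := ac' u v; rewrite mem_rcons mem_head => /(_ isT).
  by apply: contra; apply: sub_connect.
apply/acyclicP => x y; rewrite mem_rcons inE => xy; apply/negP => /connect_rcons yx.
case/predU1P: xy => [[ex ey]|xy].
  by rewrite ex ey in yx; case: yx => [|[]]; rewrite (negPf nvu).
case: yx => [yx|[yu vx]]; first by rewrite (negPf (acyclicP _ ac _ _ xy)) in yx.
case/negP: nvu; apply: connect_trans vx _; apply: connect_trans yu; exact: connect1.
Qed.

Definition walk_to G z p := if p is x :: p' then path (arc G) x p' && (last x p' == z) else false.

Lemma walk_to1 G z : walk_to G z [:: z].
Proof. by rewrite /= eqxx. Qed.

Lemma walk_to_rcons G x y p : walk_to G x p -> (x, y) \in G -> walk_to G y (rcons p y).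
Proof.
case: p => //= a p /andP[ap /eqP lx] xy.
by rewrite rcons_path ap lx last_rcons eqxx andbT.
Qed.

Lemma walk_to_cat G x y p p' : walk_to G x p -> path (arc G) x p' -> last x p' = y ->
  walk_to G y (p ++ p').
Proof.
elim/last_ind: p' y => [|p' z IHp'] y wp; first by rewrite cats0 => _ <-.
rewrite rcons_path last_rcons -rcons_cat => /andP[xp' pz] <-.
by apply: walk_to_rcons pz; apply: IHp'.
Qed.

Lemma sub_walk_to G G' z p : {subset G <= G'} -> walk_to G z p -> walk_to G' z p.
Proof.
move=> sub; case: p => //= x p /andP[xp ->]; rewrite andbT.
by apply: sub_path xp => a b; apply: sub.
Qed.

Lemma walk_to_last G z p : walk_to G z p -> exists p', p = rcons p' z.
Proof.
case/lastP: p => // p x; exists p; case: p H => [|a p] /=; first by move/eqP->.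
by rewrite last_rcons => /andP[_ /eqP->].
Qed.

Lemma walk_to_connect G z p x : walk_to G z p -> x \in p -> connect (arc G) x z.
Proof.
case: p => //= a p /andP[ap /eqP lz] xp; case/splitPl: xp ap lz => p1 p2 lx.
rewrite cat_path lx last_cat lx => /andP[_ xp2] <-.
by apply/connectP; exists p2.
Qed.

Lemma walk_to_prefix G z p x p' : walk_to G z (rcons p x ++ p') -> walk_to G x (rcons p x).
Proof.
case: p => [|a p] /=; first by rewrite eqxx.
rewrite cat_path last_cat last_rcons eqxx andbT.
by case/andP=> /andP[].
Qed.

Lemma walk_to_descending G z p : acyclic G -> walk_to G z p -> descending (height G) p.
Proof.
move=> ac; case: p => //= x p /andP[xp _].
by apply: sub_path xp => a b; apply: height_lt.
Qed.

End Acyclic.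

(** * Update as a depth-first relaxation *)

Section Update.
Variables (n : nat) (r : 'I_n -> rank).
Hypothesis r_inj : forall x y, r x = r y -> r x != None -> x = y.
Implicit Types (G : graph n) (x y z w : 'I_n) (p : seq 'I_n).
Implicit Types (lab : 'I_n -> seq 'I_n) (H W : 'I_n -> seq (seq 'I_n)).

(* The vertex sequences along which labels would be sent if every call of
   Update recursed, whether or not the label has changed. *)
Fixpoint extend G k x y H :=
  if k is k'.+1 then
    foldl (fun H w => extend G k' y w H)
          (set_at H y (H y ++ [seq rcons p y | p <- H x])) (out_nbrs G y)
  else H.

Lemma extend_prefix G k x y H z : prefix (H z) (extend G k x y H z).
Proof.
elim: k x y H => [|k IHk] x y H /=; first exact: prefix_refl.
set H1 := set_at _ _ _.
have : prefix (H z) (H1 z).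
  by rewrite /H1 /set_at; case: eqP => [->|_]; [apply: prefix_prefix|apply: prefix_refl].
elim: (out_nbrs G y) H1 => //= w ws IHws H1 p1; apply: IHws.
exact: prefix_trans p1 (IHk _ _ _).
Qed.

Definition walks G H := (forall z, [:: z] \in H z) /\ (forall z p, p \in H z -> walk_to G z p).

Lemma walks_extend G k x y H : (x, y) \in G -> walks G H -> walks G (extend G k x y H).
Proof.
move=> + [H1 wH]; suff w : (x, y) \in G -> (forall z p, p \in extend G k x y H z -> walk_to G z p).
  move=> /w wE; split=> // z; have /prefixP[s ->] := extend_prefix G k x y H z.
  by rewrite mem_cat H1.
elim: k x y H wH {H1} => [|k IHk] x y H wH xy //=.
set H1 := set_at _ _ _.
have : forall z p, p \in H1 z -> walk_to G z p.
  move=> z p; rewrite /H1 /set_at; case: eqP => [->|_]; last exact: wH.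
  rewrite mem_cat => /orP[/wH//|/mapP[q /wH qx ->]].
  exact: walk_to_rcons qx xy.
have : {subset out_nbrs G y <= out_nbrs G y} by [].
elim: {1 3}(out_nbrs G y) H1 => //= w ws IHws H1 sub wH1; apply: IHws.
  by move=> t tw; apply: sub; rewrite inE tw orbT.
by apply: IHk => //; rewrite -mem_out_nbrs sub ?mem_head.
Qed.

Definition tracks lab H := forall z, is_best r (H z) (lab z).

Definition relaxed lab x y := label_le r (lab y) (push r (lab x) y).

(** In the middle of Update, arcs leaving the vertices on the call stack may not be relaxed yet;
    those further down are, and this is what a recursive call starts from. *)
Definition relaxed_below G lab y :=
  forall a b, connect (arc G) y a -> (a, b) \in G -> relaxed lab a b.

Lemma relaxed_below_out G lab y w : (y, w) \in G ->
  relaxed_below G lab y -> relaxed_below G lab w.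
Proof.
move=> yw rel a b wa; apply: rel; apply: connect_trans wa; exact: connect1.
Qed.

(** Recursing where Update stops only adds walks whose stacks do not beat the present labels, since
    all arcs met are relaxed. So the walks may be collected as if Update always recursed, without
    looking at ranks. *)
Lemma tracks_extend G k x y lab H : tracks lab H -> relaxed lab x y ->
  relaxed_below G lab y -> tracks lab (extend G k x y H).
Proof.
elim: k x y H => [|k IHk] x y H tr xy below //=.
set H1 := set_at _ _ _.
have : tracks lab H1.
  move=> z; rewrite /H1 /set_at; case: eqP => [->|_]; last exact: tr.
  by apply: is_best_catl xy => //; apply: is_best_push.
have : {subset out_nbrs G y <= out_nbrs G y} by [].
elim: {1 3}(out_nbrs G y) H1 => //= w ws IHws H1 sub tr1; apply: IHws.
  by move=> t tw; apply: sub; rewrite inE tw orbT.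
have yw : (y, w) \in G by rewrite -mem_out_nbrs sub ?mem_head.
apply: IHk => //; first exact: below (connect0 _ _) yw.
exact: relaxed_below_out below.
Qed.

Lemma tracks_wf lab H x : tracks lab H -> wf_label r (lab x).
Proof. by move/(_ x)/is_best_wf. Qed.

Lemma tracks_connect G lab H x y : tracks lab H -> walks G H ->
  x \in lab y -> connect (arc G) x y.
Proof.
move=> tr [_ wH] xy; have [[p pH e] _] := tr y; move: xy; rewrite e.
by move=> /mem_stack/andP[xp _]; apply: walk_to_connect (wH _ _ pH) xp.
Qed.

Lemma tracks_rcons G lab H y : tracks lab H -> walks G H -> r y != None ->
  exists c, lab y = rcons c y.
Proof.
move=> tr [_ wH] ry; have [[p pH ->] _] := tr y.
have [p' ->] := walk_to_last (wH _ _ pH).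
by rewrite stack_rcons; apply: push_ranked.
Qed.

Section Cost.
Variables (W recd : 'I_n -> seq (seq 'I_n)) (deg : 'I_n -> nat) (J : nat).
Hypothesis recdP : forall z ps l, prefix ps (W z) -> is_best r ps l -> l \in recd z.
Hypothesis recd_size : forall z l, l \in recd z -> size l <= J.

Definition smaller z l := count (fun l' => label_lt r l' l) (recd z).

(** A new label at [z] causes at most [deg z] recursive calls, paid by the drop in the number of
    records below the current label. *)
Definition label_potential lab := \sum_z deg z * smaller z (lab z).

Definition msg_label (p : msg n) : seq 'I_n :=
  match p with
  | BackwardQuery _ l => l
  | ForwardQuery l => l
  | Answer _ => [::]
  | UpdateMsg l => l
  end.

(** The time bound comes from an Update message that computes a new label: [1 + 2 * J] to write it,
    [J + 2] to compare the [rho] sequences, [J + 1] for each of the two label scans and for the rank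
    comparisons, and [J] to write the label. *)
Definition light (e : event n) :=
  size (msg_label (ev_msg e)) <= J /\ ev_time e <= 7 * J + 6.

Lemma smaller_lt z l l' : l' \in recd z -> label_lt r l' l -> smaller z l' < smaller z l.
Proof.
move=> l'z ll; rewrite /smaller.
have : count_mem l' (recd z) + count (fun l0 => label_lt r l0 l') (recd z) <=
   count (fun l0 => label_lt r l0 l) (recd z).
  rewrite -count_predUI [X in _ + X](eq_count (a2 := pred0)) ?count_pred0 ?addn0; last first.
    by move=> l0 /=; case: eqP => // ->; rewrite /label_lt lex_ltxx.
  by apply: sub_count => l0 /= /predU1P[->//|/label_lt_trans]; apply.
apply: leq_trans; rewrite -add1n leq_add2r -has_count has_pred1; exact: l'z.
Qed.

Lemma smaller_le z l l' : label_le r l' l -> smaller z l' <= smaller z l.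
Proof.
by move=> ll; apply: sub_count => l0 /= /label_lt_le_trans; apply.
Qed.

Lemma scan_time_le (T : eqType) (s t : seq T) : scan_time s t <= (size s).+1.
Proof.
rewrite /scan_time ltnS; elim: s t => [|a s IHs] [|b t] //=.
by case: eqP => //= _; rewrite ltnS.
Qed.

Lemma size_rho l : size (rho r l) = (size l).+1.
Proof. by rewrite /rho size_rcons size_map. Qed.

Lemma label_potential_set lab y l : l \in recd y -> label_lt r l (lab y) ->
  label_potential (set_at lab y l) + deg y <= label_potential lab.
Proof.
move=> ly ll; rewrite /label_potential (bigD1 y) //= [leqRHS](bigD1 y) //=.
rewrite {1}/set_at eqxx addnAC leq_add //.
  by rewrite -mulnSr leq_mul2l smaller_lt ?orbT.
by apply: leq_sum => z zy; rewrite /set_at (negPf zy).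
Qed.

(** In the cost clause, the unit is the message of this call and all others are paid by the
    potential. Keeping the walk lists prefixes of the final [W] makes every intermediate label a
    prefix minimum, hence a member of [recd]. *)
Lemma update_ok G k x y lab H :
  acyclic G -> (forall z, size (out_nbrs G z) <= deg z) ->
  (x, y) \in G -> height G y <= k ->
  tracks lab H -> walks G H -> relaxed_below G lab y ->
  (forall z, prefix (extend G k x y H z) (W z)) ->
  let: (lab', tr) := update r G k x y lab in
  [/\ tracks lab' (extend G k x y H),
      forall z, label_le r (lab' z) (lab z) /\ (~~ connect (arc G) y z -> lab' z = lab z),
      relaxed lab' x y /\ relaxed_below G lab' y,
      size tr + label_potential lab' <= (label_potential lab).+1 &
      forall e, List.In e tr -> light e].
Proof.
move=> ac dG; have acP := acyclicP _ ac.
elim: k x y lab H => [|k IHk] x y lab H xy hy tr wH below pre.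
  by have := height_gt0 G y; lia.
have yx : y \notin lab x.
  by apply: contra (acP _ _ xy) => /(tracks_connect tr wH).
have lrec z : lab z \in recd z.
  apply: (recdP _ (tr z)); exact: prefix_trans (extend_prefix _ _ _ _ _ _) (pre z).
have lsz z : size (lab z) <= J by apply: recd_size.
have wfl z := tracks_wf z tr.
have lasty : r y != None -> exists c, lab y = rcons c y by apply: tracks_rcons tr wH.
rewrite /=; set p := UpdateMsg _.
set t := 1 + 2 * size (lab x) + scan_time (rho r (lab x)) (rho r (lab y)).
have tle : t <= 3 * J + 3.
  rewrite /t /p /=; have := scan_time_le (rho r (lab x)) (rho r (lab y)).
  rewrite size_rho; have := lsz x; lia.
(* Serves both cases in which the label of [y] stays: the label of [x] is not below it, or
   recomputing gives the old value. *)
have same : relaxed lab x y -> forall t', t' <= 7 * J + 6 ->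
   [/\ tracks lab (extend G k.+1 x y H),
      forall z, label_le r (lab z) (lab z) /\ (~~ connect (arc G) y z -> lab z = lab z),
      relaxed lab x y /\ relaxed_below G lab y,
      size [:: Event x y p t'] + label_potential lab <= (label_potential lab).+1 &
      forall e, List.In e [:: Event x y p t'] -> light e].
  move=> rel t' t'J; split=> //.
  - exact: tracks_extend.
  - by move=> z; split=> //; apply: label_lexx.
  - by move=> e [<-|[]]; split=> //; apply: lsz.
case: ifP => lt; last first.
  apply: same; last by lia.
  by rewrite /relaxed -[lab y](@push_id n r _ y) ?push_mono // /label_le /label_lt lt.
rewrite updated_label_push //; set l := push r (lab x) y.
have lely : label_le r l (lab y).
  rewrite -[lab y](@push_id n r _ y) // /l; apply: push_mono => //.
  exact: label_lt_le.
have lle : [/\ size l <= J, l \in recd y & is_best r (H y ++ [seq rcons p y | p <- H x]) l].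
  have best : is_best r (H y ++ [seq rcons p y | p <- H x]) l.
    by apply: is_best_catr lely => //; apply: is_best_push.
  suff lr : l \in recd y by split; rewrite ?(recd_size lr).
  apply: (recdP _ best); apply: prefix_trans (pre y) => /=.
  set H1 := set_at _ _ _.
  have -> : H y ++ [seq rcons p y | p <- H x] = H1 y by rewrite /H1 /set_at eqxx.
  elim: (out_nbrs G y) H1 => [|w ws IHws] H1 /=; first exact: prefix_refl.
  exact: prefix_trans (extend_prefix _ _ _ _ _ _) (IHws _).
have {lle} [lJ lr best] := lle.
have t'J : t + scan_time (lab x) (lab y) + (size l).+1 + size l + scan_time l (lab y) <= 7 * J + 6.
  set s1 := scan_time (lab x) _; set s2 := scan_time l _.
  have s1J : s1 <= J.+1 by apply: leq_trans (scan_time_le _ _) _; rewrite ltnS.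
  have s2J : s2 <= J.+1 by apply: leq_trans (scan_time_le _ _) _; rewrite ltnS.
  lia.
case: eqP => [ely|/eqP nly].
  by apply: same t'J; rewrite /relaxed -/l ely label_lexx.
have {lely} lely : label_lt r l (lab y).
  case: (boolP (label_lt r l (lab y))) => // nlt; case/eqP: nly.
  apply: (label_le_anti r_inj) => //; exact: wf_push.
set t' := _ + scan_time l _ in t'J *; set lab1 := set_at lab y l.
have lab1y : lab1 y = l by rewrite /lab1 /set_at eqxx.
have lab1n z : z != y -> lab1 z = lab z by rewrite /lab1 /set_at => /negPf->.
have lab1le z : label_le r (lab1 z) (lab z).
  rewrite /lab1 /set_at; case: eqP => [->|_]; last exact: label_lexx.
  exact: label_lt_le.
set H1 := set_at H y _ in pre *.
have tr1 : tracks lab1 H1.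
  by move=> z; rewrite /lab1 /H1 /set_at; case: eqP.
have wH1 : walks G H1.
  case: wH => H1z wHz; split=> [z|z q]; rewrite /H1 /set_at.
    by case: eqP => [->|_]; rewrite ?mem_cat H1z.
  case: eqP => [->|_]; last exact: wHz.
  rewrite mem_cat => /orP[/wHz//|/mapP[q' /wHz qx ->]].
  exact: walk_to_rcons qx xy.
have nyy a : (y, a) \in G -> ~~ connect (arc G) a y by apply: acP.
(* [ws] lists the out-neighbours still to be called. By acyclicity no recursive call changes the
   label of [y], so arcs already relaxed at [y] stay relaxed; the term [size ws] reserves one
   message for each remaining call. *)
pose loop ws labc Hc (trc : seq (event n)) :=
  [/\ tracks labc Hc /\ walks G Hc,
      forall z, label_le r (labc z) (lab1 z) /\ (~~ (connect (arc G) y z && (z != y)) -> labc z = lab1 z),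
      (forall a b, connect (arc G) y a -> a != y -> (a, b) \in G -> relaxed labc a b) /\
      (forall b, (y, b) \in G -> b \notin ws -> relaxed labc y b),
      size trc + label_potential labc + size ws <= (label_potential lab).+1 &
      forall e, List.In e trc -> light e].
have init : loop (out_nbrs G y) lab1 H1 [:: Event x y p t'].
  split=> //.
  - by move=> z; split=> //; apply: label_lexx.
  - split=> [a b ya ay ab|b yb]; last by rewrite mem_out_nbrs yb.
    rewrite /relaxed (lab1n a) //; apply: label_le_trans (lab1le b) _.
    exact: below ya ab.
  - have := label_potential_set lr lely; have := dG y; rewrite -/lab1 /=; lia.
  - by move=> e [<-|[]]; split=> //; apply: lsz.
suff fin ws labc Hc trc : {subset ws <= out_nbrs G y} -> loop ws labc Hc trc ->
    (forall z, prefix (foldl (fun H w => extend G k y w H) Hc ws z) (W z)) ->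
    let: (lab', tr) := foldl (fun st w => let: (lab', tr) := update r G k y w st.1 in
                           (lab', st.2 ++ tr)) (labc, trc) ws in
    loop [::] lab' (foldl (fun H w => extend G k y w H) Hc ws) tr.
  have := fin _ _ _ _ (fun _ => id) init pre.
  case: foldl => lab' tr' [[trk _] le [rel1 rel2] cost ev]; split=> //.
  - move=> z; have [lez off] := le z; split; first exact: label_le_trans lez (lab1le z).
    move=> nyz; rewrite off ?(negPf nyz) // lab1n //.
    by apply: contraNneq nyz => ->; apply: connect0.
  - split=> [|a b ya ab].
      have [_ eqx] := le x; have [ley _] := le y.
      rewrite /relaxed eqx; last by rewrite (negPf (acP _ _ xy)).
      rewrite lab1n; first by rewrite -/l -lab1y.
      by apply: contraTneq (connect0 (arc G) y) => exy; rewrite -{2}exy acP.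
    case: (eqVneq a y) => [ea|ay]; last exact: rel1.
    by rewrite ea; apply: rel2 => //; rewrite -ea.
  - by move: cost; rewrite addn0.
elim: ws labc Hc trc => [|w ws IHws] labc Hc trc sub inv pre1 //=.
have yw : (y, w) \in G by rewrite -mem_out_nbrs sub ?mem_head.
have sub' : {subset ws <= out_nbrs G y} by move=> z zw; rewrite sub // inE zw orbT.
have [[trk wk] le [rel1 rel2] cost ev] := inv.
have beloww : relaxed_below G labc w.
  move=> a b wa ab; apply: rel1 ab; first by apply: connect_trans wa; apply: connect1.
  by apply: contraTneq wa => ->; apply: nyy.
have prew z : prefix (extend G k y w Hc z) (W z).
  apply: prefix_trans (pre1 z) => /=.
  elim: (ws) (extend G k y w Hc) => [|w' ws' IHws'] H' /=; first exact: prefix_refl.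
  exact: prefix_trans (extend_prefix _ _ _ _ _ _) (IHws' _).
have hw : height G w <= k by have := height_lt ac yw; lia.
have := IHk y w labc Hc yw hw trk wk beloww prew.
case: update => lab2 tr2 [trk2 le2 [rel2w rel2b] cost2 ev2].
apply: IHws => //.
have eqy : lab2 y = labc y by apply: (le2 y).2; apply: nyy.
split.
- by split=> //; apply: walks_extend.
- move=> z; have [lez off] := le z; have [lez2 off2] := le2 z.
  split=> [|nyz]; first exact: label_le_trans lez2 lez.
  rewrite off2 ?off //; apply: contra nyz => wz.
  have yz : connect (arc G) y z by apply: connect_trans wz; apply: connect1.
  by rewrite yz; apply: contraTneq wz => ->; apply: nyy.
- split=> [a b ya ay ab|b yb].
    case: (boolP (connect (arc G) w a)) => [wa|nwa]; first exact: rel2b wa ab.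
    rewrite /relaxed (le2 a).2 //; apply: label_le_trans (le2 b).1 _.
    exact: rel1.
  case: (eqVneq b w) => [-> _|bw bws]; first exact: rel2w.
  rewrite /relaxed eqy; apply: label_le_trans (le2 b).1 _.
  by apply: rel2 => //; rewrite inE negb_or bw.
- by move: cost cost2; rewrite size_cat /=; lia.
- by move=> e /List.in_app_iff[/ev|/ev2].
Qed.

End Cost.
End Update.

(** * Insert *)

Lemma sum_size_filter_eq (T : eqType) (I : finType) (f : T -> I) (s : seq T) :
  \sum_i size [seq x <- s | f x == i] = size s.
Proof.
elim: s => [|x s IHs] /=; first by rewrite big1.
rewrite -IHs (bigD1 (f x)) //= [in RHS](bigD1 (f x)) //= eqxx -addSn; congr (_ + _).
by apply: eq_bigr => i; rewrite eq_sym => /negPf->.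
Qed.

Section Degrees.
Variable n : nat.
Implicit Types G : graph n.

Lemma sum_in_nbrs G : \sum_w size (in_nbrs G w) = size G.
Proof.
rewrite -[RHS](sum_size_filter_eq snd); apply: eq_bigr => w _.
by rewrite size_map.
Qed.

Lemma sum_out_nbrs G : \sum_w size (out_nbrs G w) = size G.
Proof.
rewrite -[RHS](sum_size_filter_eq fst); apply: eq_bigr => w _.
by rewrite size_map.
Qed.

Lemma prefix_in_nbrs G G' w : prefix G G' -> size (in_nbrs G w) <= size (in_nbrs G' w).
Proof. by case/prefixP => s ->; rewrite !size_map filter_cat size_cat leq_addr. Qed.

Lemma prefix_out_nbrs G G' w : prefix G G' -> size (out_nbrs G w) <= size (out_nbrs G' w).
Proof. by case/prefixP => s ->; rewrite !size_map filter_cat size_cat leq_addr. Qed.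

End Degrees.

Section Stacks.
Variables (n : nat) (r : 'I_n -> rank).
Hypothesis r_inj : forall x y, r x = r y -> r x != None -> x = y.

Lemma stack_cat_le p q : uniq (p ++ q) -> label_le r (stack r (p ++ q)) (stack r p).
Proof.
elim/last_ind: q => [|q y IHq]; first by rewrite cats0 label_lexx.
rewrite -rcons_cat rcons_uniq => /andP[ypq upq]; rewrite stack_rcons.
apply: label_le_trans (IHq upq); apply: push_le (wf_stack _ _) _ => //.
by apply: contra ypq => /mem_stack/andP[].
Qed.

Lemma stack_cat_lt p q z : uniq (p ++ q) -> z \in q -> r z != None ->
  label_lt r (stack r (p ++ q)) (stack r p).
Proof.
move=> u zq rz; case/splitPr: zq u => q1 q2; rewrite -cat_rcons catA => u.
apply: label_le_lt_trans (stack_cat_le u) _.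
move: u; rewrite cat_uniq => /andP[+ _]; rewrite -rcons_cat rcons_uniq => /andP[zpq upq].
rewrite stack_rcons; apply: label_lt_le_trans (stack_cat_le upq).
apply: push_lt rz => //; first exact: wf_stack.
by apply: contra zpq => /mem_stack/andP[].
Qed.

End Stacks.

(** [Some x] is meant for a label of [u] ending with [x], and [None] for an empty label. *)
Definition segment n (G : graph n) (u : 'I_n) (ox : option 'I_n) : {set 'I_n} :=
  if ox is Some x then between G x u :\ x else [set z | connect (arc G) z u].

Section Insert.
Variables (n : nat) (r : 'I_n -> rank) (skip : bool).
Hypothesis r_inj : forall x y, r x = r y -> r x != None -> x = y.
Implicit Types (G : graph n) (x y z w u v : 'I_n) (p : seq 'I_n).
Implicit Types (lab : 'I_n -> seq 'I_n) (H : 'I_n -> seq (seq 'I_n)).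

Record run_inv G lab H : Prop := RunInv {
  inv_acyclic : acyclic G;
  inv_tracks : tracks r lab H;
  inv_walks : walks G H;
  inv_relaxed : forall x y, (x, y) \in G -> relaxed r lab x y
}.

Section State.
Variables (G : graph n) (lab : 'I_n -> seq 'I_n) (H : 'I_n -> seq (seq 'I_n)).
Hypothesis inv : run_inv G lab H.

Lemma inv_wf x : wf_label r (lab x).
Proof. exact: tracks_wf (inv_tracks inv). Qed.

Lemma inv_notin x y : (x, y) \in G -> y \notin lab x.
Proof.
move=> xy; apply: contra (acyclicP _ (inv_acyclic inv) _ _ xy).
exact: tracks_connect (inv_tracks inv) (inv_walks inv).
Qed.

Lemma connect_label_le x y : connect (arc G) x y -> label_le r (lab y) (lab x).
Proof.
case/connectP => p; elim: p x => [|z p IHp] x /=; first by move=> _ ->; apply: label_lexx.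
case/andP=> xz zp yp; apply: label_le_trans (IHp z zp yp) _.
apply: label_le_trans (inv_relaxed inv xz) _.
by apply: push_le; [exact: r_inj|exact: inv_wf|exact: inv_notin].
Qed.

Lemma label_eq x y : label_le r (lab x) (lab y) -> label_le r (lab y) (lab x) -> lab x = lab y.
Proof. by apply: label_le_anti => //; apply: inv_wf. Qed.

Lemma arc_label_lt x y : (x, y) \in G -> r y != None -> label_lt r (lab y) (lab x).
Proof.
move=> xy ry; apply: label_le_lt_trans (inv_relaxed inv xy) _.
by apply: push_lt => //; [exact: inv_wf|exact: inv_notin].
Qed.

Lemma walk_label_le z p : walk_to G z p -> label_le r (lab z) (stack r p).
Proof.
elim/last_ind: p z => // p z IHp y.
case: p IHp => [_|a p IHp] /=.
  move/eqP<-; have [_] := inv_tracks inv z; apply.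
  by have [+ _] := inv_walks inv; apply.
rewrite rcons_path last_rcons => /andP[/andP[ap lz] /eqP<-].
rewrite -rcons_cons stack_rcons; apply: label_le_trans (inv_relaxed inv lz) _.
apply: push_mono; [exact: inv_wf|exact: wf_stack|].
by apply: IHp; rewrite /= ap eqxx.
Qed.

Lemma walk_uniq z p : walk_to G z p -> uniq p.
Proof. by move/(walk_to_descending (inv_acyclic inv))/descending_uniq. Qed.

(** Otherwise follow a best walk to [u] up to the last vertex of the label of [u], where the stack
    already equals that label, and continue through [x] to [u]. Reading the ranked [x] lowers the
    stack strictly, against the minimality of the label. If the label is empty, start at [x]. *)
Lemma segment_unranked u x : x \in segment G u (if lab u is a :: l then Some (last a l) else None) ->
  r x = None.
Proof.
move=> xs; apply/eqP/negPn/negP => rx; move: xs.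
case lu: (lab u) => [|a l].
  rewrite inE => /connectP[q xq qu].
  have wq : walk_to G u (x :: q) by rewrite /= xq -qu eqxx.
  have := walk_label_le wq; rewrite lu => /negP; apply.
  by apply: (@stack_cat_lt _ _ r_inj [::] (x :: q) x); rewrite ?(walk_uniq wq) ?mem_head.
move: lu; rewrite lastI; set c := belast a l; set y := last a l => lu.
rewrite /= !inE => /and3P[xy /connectP[q1 yq1 xq1] /connectP[q2 xq2 uq2]].
have [[p pH lup] _] := inv_tracks inv u; rewrite lu in lup.
have [p1 [p2 [ep sp]]] := stack_last (esym lup).
have wp : walk_to G u p by have [_] := inv_walks inv; apply.
have w1 : walk_to G y (rcons p1 y) by rewrite ep in wp; apply: walk_to_prefix wp.
have w2 : walk_to G x (rcons p1 y ++ q1) by apply: walk_to_cat w1 yq1 (esym xq1).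
have w3 : walk_to G u ((rcons p1 y ++ q1) ++ q2) by apply: walk_to_cat w2 xq2 (esym uq2).
have := walk_label_le w3; rewrite lu -sp -catA => /negP; apply.
apply: (@stack_cat_lt _ _ r_inj _ _ x) => //.
  by rewrite catA; apply: walk_uniq w3.
rewrite mem_cat; apply/orP; left.
case/lastP: q1 xq1 {yq1 w2 w3} => [/= e|q1 b]; first by rewrite e eqxx in xy.
by rewrite last_rcons => ->; rewrite mem_rcons mem_head.
Qed.

(** The last vertex of the common label is an ancestor of [w], so [w] lies in the segment unless it
    is that vertex, which is ranked. *)
Lemma same_label_segment u w : connect (arc G) w u -> lab w = lab u ->
  (w \in segment G u (if lab u is a :: l then Some (last a l) else None)) || (r w != None).
Proof.
move=> wu lw; case: (boolP (r w != None)) => rw; rewrite ?orbT // orbF.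
case lu: (lab u) => [|a l]; rewrite /= !inE // wu andbT.
have al : last a l \in lab w by rewrite lw lu mem_last.
rewrite (tracks_connect (inv_tracks inv) (inv_walks inv) al) andbT.
apply: contraNneq rw => ->.
exact: wf_label_ranked (inv_wf w) al.
Qed.

Section Backward.
Variables (u v : 'I_n).
Let G' := rcons G (u, v).

Let next w := if [&& skip, r w != None & w != v] then [::] else in_nbrs G' w.
Let verdict w := if w == v then Some true else if lab w == lab u then None else Some false.

(** [v] answers at once, so it belongs to the set only as the root, when the inserted arc is a
    loop. *)
Definition backward_set w :=
  [&& connect (arc G) w u, lab w == lab u & (w != v) || (u == v)].

Lemma new_arc x y : ((x, y) \in G') = ((x, y) == (u, v)) || ((x, y) \in G).
Proof. by rewrite mem_rcons inE. Qed.

Lemma mem_next w x : x \in next w -> (x, w) \in G'.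
Proof. by rewrite /next; case: ifP => // _; rewrite mem_in_nbrs. Qed.

Lemma backward_root : backward_set u.
Proof. by rewrite /backward_set connect0 eqxx /=; case: (u == v). Qed.

Lemma backward_next w x : backward_set w -> x \in next w -> verdict x = None -> backward_set x.
Proof.
move=> /and3P[wu lw wv] /mem_next xw; rewrite /verdict /backward_set.
case: eqP => // xv; case: eqP => // _ _; rewrite andbT.
move: xw; rewrite new_arc => /predU1P[[-> _]|xw]; first exact: connect0.
by apply: connect_trans wu; apply: connect1.
Qed.

Lemma backward_old_arc w x : backward_set w -> (x, w) \in G' -> u != v -> (x, w) \in G.
Proof.
move=> /and3P[_ _ wv]; rewrite new_arc => /predU1P[[_ ew]|//] uv.
by move: wv; rewrite ew eqxx (negPf uv).
Qed.

Lemma backward_root_next w : backward_set w -> u \in next w -> verdict u != None.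
Proof.
move=> bw /mem_next uw; rewrite /verdict; case: (eqVneq u v) => // uv.
have uw' := backward_old_arc bw uw uv; case/and3P: bw => wu _ _.
by rewrite (negPf (acyclicP _ (inv_acyclic inv) _ _ uw')) in wu.
Qed.

Lemma backward_height w x : backward_set w -> x \in next w -> verdict x = None ->
  height G w < height G x.
Proof.
move=> bw /mem_next xw; rewrite /verdict; case: (eqVneq x v) => // xv _.
apply: height_lt (inv_acyclic inv) _; move: xw; rewrite new_arc => /predU1P[[xu wv]|//].
by case/and3P: bw => _ _; rewrite wv eqxx /= => /eqP uv; rewrite xu uv eqxx in xv.
Qed.

Definition backward_cost := \sum_(w | backward_set w) size (next w).

Lemma backward_cost_le : 2 * backward_cost <= 2 * size G'.
Proof.
rewrite leq_mul2l /= -sum_in_nbrs /backward_cost big_mkcond; apply: leq_sum => w _.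
by case: ifP => // _; rewrite /next; case: ifP.
Qed.

Variable J : nat.
Hypothesis lab_size : forall x, size (lab x) <= J.

(** [v] does not forward the query. If it carries the label of [u], vertices are claimed to be
    reached only up to the height of [v]: heights drop on the way to [u], so [v] is not met after
    [w]. Skipping ranked vertices is harmless, since every vertex after [w] on the path has an
    in-neighbour with its own label, which a ranked vertex never has. *)
Lemma backward_searchP : let: (tr, st) := backward_search skip r G' lab u v in
  [/\ size tr <= 2 * backward_cost,
      forall e, List.In e tr -> light J e,
      forall w, connect (arc G) w u -> lab w = lab u ->
        (lab v != lab u) || (height G w <= height G v) ->
        (w == u) || (senders st w != [::]) &
      connect (arc G) v u -> lab v = lab u -> ayes st u].
Proof.
rewrite /backward_search -/next -/verdict.
set query_time := fun w => _ + _ + scan_time (rho r (lab w)) _.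
have := searchP (BackwardQuery v (lab u)) query_time backward_root backward_next
  backward_root_next backward_height backward_cost_le.
case: search => tr st [sz root_sent sent aye evs].
have reach w : connect (arc G) w u -> lab w = lab u ->
    (lab v != lab u) || (height G w <= height G v) -> (w == u) || (senders st w != [::]).
  case/connectP=> p; elim: p w => [|x p IHp] w /=; first by move=> _ ->; rewrite eqxx.
  case/andP=> wx xp xu lw hw.
  have cx : connect (arc G) x u by apply/connectP; exists p.
  have lx : lab x = lab u.
    apply: label_eq; last exact: connect_label_le.
    by rewrite -lw; apply: connect_label_le; apply: connect1.
  have hx := height_lt (inv_acyclic inv) wx.
  have hxv : (lab v != lab u) || (height G x <= height G v).
    by case/orP: hw => [->//|hw]; apply/orP; right; apply: leq_trans (ltnW hx) hw.
  have xv : x != v.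
    case/orP: hw => [lv|hw]; first by apply: contraNneq lv => <-; rewrite lx.
    by apply: contraTneq hx => ->; rewrite -leqNgt.
  have rx : r x = None.
    apply/eqP/negPn/negP => rx; have := arc_label_lt wx rx.
    by rewrite lx lw /label_lt lex_ltxx.
  have wnext : w \in next x.
    by rewrite /next rx /= andbF mem_in_nbrs new_arc [_ \in G]wx orbT.
  have [/eqP xu'|sx] := orP (IHp x xp xu lx hxv).
    by rewrite root_sent ?orbT // -xu'.
  apply/orP; right; apply: (sent x) => //.
  by rewrite /verdict (negPf xv) lx eqxx.
split=> //.
- move=> e /evs[[em et]|[b [em et]]]; last by rewrite /light em et /=; lia.
  rewrite /light em et /=; split=> //; rewrite /query_time.
  set s1 := scan_time _ _; set s2 := scan_time _ _.
  have s1J : s1 <= J.+1 by apply: leq_trans (scan_time_le _ _) _; rewrite ltnS.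
  have s2J : s2 <= J.+2 by apply: leq_trans (scan_time_le _ _) _; rewrite size_rho !ltnS.
  have := lab_size u; lia.
- move=> vu lv; have [/eqP ev|sv] : (v == u) \/ (senders st v != [::]).
  + by apply/orP/reach => //; rewrite leqnn orbT.
  + apply: (aye u); last by rewrite /verdict ev eqxx.
    apply: root_sent; rewrite /next -ev eqxx !andbF mem_in_nbrs new_arc -ev eqxx //.
  + by apply: (aye v); rewrite // /verdict eqxx.
Qed.

End Backward.

Section Forward.
Variables (u v : 'I_n) (reached : pred 'I_n).
Let G' := rcons G (u, v).
Hypothesis uv : label_lt r (lab u) (lab v).

Let verdict w := if reached w then Some true
  else if lex_lt (rho r (lab u)) (rho r (lab w)) then None else Some false.

Definition forward_set w := connect (arc G) v w && label_lt r (lab u) (lab w).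

Lemma forward_root : forward_set v.
Proof. by rewrite /forward_set connect0. Qed.

Lemma forward_old_arc w x : forward_set w -> x \in out_nbrs G' w -> (w, x) \in G.
Proof.
move=> /andP[_ uw]; rewrite mem_out_nbrs new_arc => /predU1P[[wu _]|//].
by move: uw; rewrite wu /label_lt lex_ltxx.
Qed.

Lemma forward_next w x : forward_set w -> x \in out_nbrs G' w -> verdict x = None ->
  forward_set x.
Proof.
move=> fw xw; have wx := forward_old_arc fw xw; rewrite /verdict /forward_set.
case: ifP => // _; rewrite -/(label_lt r (lab u) (lab x)); case: ifP => // _ _.
by case/andP: fw => vw _; rewrite (connect_trans vw) // connect1.
Qed.

Lemma forward_root_next w : forward_set w -> v \in out_nbrs G' w -> verdict v != None.
Proof.
move=> fw vw; have wv := forward_old_arc fw vw; case/andP: fw => vw' _.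
by rewrite (negPf (acyclicP _ (inv_acyclic inv) _ _ wv)) in vw'.
Qed.

Lemma forward_height w x : forward_set w -> x \in out_nbrs G' w -> verdict x = None ->
  n - height G w < n - height G x.
Proof.
move=> fw xw _; have := height_lt (inv_acyclic inv) (forward_old_arc fw xw).
have := height_le G w; lia.
Qed.

Definition forward_cost := \sum_(w | forward_set w) size (out_nbrs G' w).

Lemma forward_cost_le : 2 * forward_cost <= 2 * size G'.
Proof.
rewrite leq_mul2l /= -sum_out_nbrs /forward_cost big_mkcond; apply: leq_sum => w _.
by case: ifP.
Qed.

Variable J : nat.
Hypothesis lab_size : forall x, size (lab x) <= J.

(** Labels never increase along a path from [v] to [u]. The first vertex on it whose label is not
    above that of [u] has exactly the label of [u], so it was reached by the backward search and
    answers positively. *)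
Lemma forward_searchP : let: (tr, st) := forward_search r G' lab reached u v in
  [/\ size tr <= 2 * forward_cost,
      forall e, List.In e tr -> light J e &
      (forall w, connect (arc G) w u -> lab w = lab u -> reached w) ->
        connect (arc G) v u -> ayes st v].
Proof.
rewrite /forward_search -/verdict.
set query_time := fun w => 1 + _.
have := searchP (ForwardQuery (lab u)) query_time forward_root forward_next
  forward_root_next forward_height forward_cost_le.
case: search => tr st [sz root_sent sent aye evs].
split=> //.
  move=> e /evs[[em et]|[b [em et]]]; last by rewrite /light em et /=; lia.
  rewrite /light em et /=; split=> //; rewrite /query_time.
  set s1 := scan_time _ _.
  have s1J : s1 <= J.+2 by apply: leq_trans (scan_time_le _ _) _; rewrite size_rho !ltnS.
  have := lab_size u; lia.
move=> reachedP.
suff walk w : connect (arc G) w u -> label_lt r (lab u) (lab w) ->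
    (w == v) || (senders st w != [::]) && (verdict w == None) -> ayes st v.
  by move=> vu; apply: (walk v vu uv); rewrite eqxx.
case/connectP => p; elim: p w => [|x p IHp] w /=.
  by move=> _ ->; rewrite /label_lt lex_ltxx.
case/andP=> wx xp xu uw hw.
have cx : connect (arc G) x u by apply/connectP; exists p.
have xw : x \in out_nbrs G' w by rewrite mem_out_nbrs new_arc [_ \in G]wx orbT.
have sx : senders st x != [::].
  case/orP: hw => [/eqP ew|/andP[sw /eqP vw]]; last exact: (sent w).
  by apply: root_sent; rewrite -ew.
case: (boolP (reached x)) => [rx|nrx]; first by apply: (aye x); rewrite // /verdict rx.
have ux : label_lt r (lab u) (lab x).
  case: (boolP (label_lt r (lab u) (lab x))) => // nux.
  case/negP: nrx; apply: reachedP => //; apply: label_eq nux _.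
  exact: connect_label_le.
apply: (IHp x) => //; rewrite sx /verdict (negPf nrx) /=.
by rewrite -/(label_lt r (lab u) (lab x)) ux orbT.
Qed.

End Forward.

Section CycleDetect.
Variables (u v : 'I_n) (J : nat).
Hypothesis lab_size : forall x, size (lab x) <= J.
Hypothesis vu_le : label_le r (lab u) (lab v).

(** The bound by the number of arcs serves for the insertion that ends the run, where no label
    change pays for the search; the finer bound serves for all others. *)
Lemma cycle_detectP : let: (tr, cyc) := cycle_detect skip r (rcons G (u, v)) lab u v in
  [/\ size tr <= 4 * (size G).+1,
      forall e, List.In e tr -> light J e,
      connect (arc G) v u -> cyc &
      ~~ cyc -> size tr <= 2 * backward_cost u v
         + (if label_lt r (lab u) (lab v) then 2 * forward_cost u v else 0)].
Proof.
rewrite /cycle_detect.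
have bG := @backward_cost_le u v; have fG := @forward_cost_le u v; rewrite size_rcons in bG fG.
have := backward_searchP u v lab_size; case: backward_search => btr bst [bsz bl reach baye].
case: ifP => bu; first by split=> //; move: bsz bG; lia.
rewrite -/(label_lt r (lab u) (lab v)); case: ifP => lt; last first.
  split=> //; [by move: bsz bG; lia| |by rewrite addn0].
  move=> vu; rewrite baye // in bu; apply: label_eq; last by [].
  by rewrite /label_le lt.
have := @forward_searchP u v [pred w | (w == u) || (senders bst w != [::])] lt J lab_size.
case: forward_search => ftr fst [fsz fl faye]; split.
- by rewrite size_cat; move: bsz bG fsz fG; lia.
- by move=> e /List.in_app_iff[/bl|/fl].
- move=> vu; apply: faye => // w wu lw; apply: reach => //.
  by apply/orP; left; apply: contraTneq lt => ->; rewrite /label_lt lex_ltxx.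
- by move=> _; rewrite size_cat leq_add.
Qed.

End CycleDetect.
End State.

(** * Cost of an insertion and of a whole run *)

Section Run.
Variables (a : seq ('I_n * 'I_n)) (W recd : 'I_n -> seq (seq 'I_n)) (J E : nat).
Hypothesis recdP : forall z ps l, prefix ps (W z) -> is_best r ps l -> l \in recd z.
Hypothesis recd_size : forall z l, l \in recd z -> size l <= J.
Hypothesis ranked_in_nbrs : forall x, r x != None -> skip || (size (in_nbrs a x) <= E).

Let deg z := size (out_nbrs a z).
Let Phi lab := label_potential r recd deg lab.

(* The backward search from [u] only expands the vertices of one unranked segment
   and at most one ranked vertex. *)
Definition unranked_indegree G u :=
  \max_(ox | [forall z in segment G u ox, r z == None])
    \sum_(z in segment G u ox) size (in_nbrs a z).

Lemma backward_cost_segment G lab H u v : run_inv G lab H ->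
  acyclic (rcons G (u, v)) -> prefix (rcons G (u, v)) a ->
  backward_cost G lab u v <= unranked_indegree G u + E.
Proof.
move=> inv ac pre.
set ox := if lab u is b :: l then Some (last b l) else None.
have unr : [forall z in segment G u ox, r z == None].
  by apply/forall_inP => z /(segment_unranked inv)->.
apply: (@leq_trans (\sum_(z in segment G u ox) size (in_nbrs a z) + E)); last first.
  by rewrite leq_add2r; apply: (@leq_bigmax_cond _ _ (fun ox => \sum_(z in segment G u ox) size (in_nbrs a z))).
rewrite /backward_cost (bigID (mem (segment G u ox))) /= leq_add //.
  rewrite big_mkcond [leqRHS]big_mkcond; apply: leq_sum => w _.
  case: (w \in segment G u ox); rewrite ?andbF // andbT.
  by case: ifP => // _; case: ifP => // _; apply: prefix_in_nbrs.
have single w : backward_set G lab u v w && (w \notin segment G u ox) ->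
    [/\ r w != None, w != v & lab w = lab u].
  case/andP=> /and3P[wu /eqP lw wv] ns.
  have := same_label_segment inv wu lw; rewrite -/ox (negPf ns) /= => rw; split=> //.
  case/orP: wv => // /eqP uv; move: ac; rewrite acyclic_rcons; last exact: inv_acyclic inv.
  by rewrite -uv connect0.
case: (pickP [pred w | backward_set G lab u v w && (w \notin segment G u ox)]) => [w0 P0|none]; last first.
  by rewrite big_pred0.
have [rw0 w0v lw0] := single _ P0.
rewrite (big_pred1 w0).
  rewrite w0v rw0 !andbT; case: skip (ranked_in_nbrs rw0) => //= dE.
  exact: leq_trans (prefix_in_nbrs _ pre) dE.
(* A ranked vertex ends its own label, so two of them sharing the label of [u] coincide. *)
move=> w /=; apply/idP/eqP => [/single[rw _ lw]|->//].
have [c ec] := tracks_rcons (inv_tracks inv) (inv_walks inv) rw.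
have [c0 ec0] := tracks_rcons (inv_tracks inv) (inv_walks inv) rw0.
by move: ec; rewrite lw -lw0 ec0 => /rcons_inj[].
Qed.

(** The factor 3 is 1 for Update plus 2, a query and an answer per arc, for the forward search. An
    arc that closes a cycle leaves the walk lists unchanged, since the run stops there. *)
Lemma insert_ok G lab H u v : run_inv G lab H ->
  prefix (rcons G (u, v)) a ->
  (forall z, prefix (if acyclic (rcons G (u, v)) then extend (rcons G (u, v)) n u v H z else H z) (W z)) ->
  let: (lab', tr, cyc) := insert skip r (rcons G (u, v)) lab u v in
  (forall e, List.In e tr -> light J e) /\
  if cyc return Prop then size tr <= 4 * size a
  else [/\ acyclic (rcons G (u, v)),
           run_inv (rcons G (u, v)) lab' (extend (rcons G (u, v)) n u v H) &
           size tr + 3 * Phi lab' <= 3 * Phi lab + 2 * (unranked_indegree G u + E) + 1].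
Proof.
move=> inv preG preW; set G' := rcons G (u, v) in preG preW *.
have acG := inv_acyclic inv.
have subG : {subset G <= G'} by move=> e eG; rewrite mem_rcons inE eG orbT.
have uvG : (u, v) \in G' by rewrite mem_rcons mem_head.
have lrec z : lab z \in recd z.
  apply: recdP (inv_tracks inv z); apply: prefix_trans (preW z).
  by case: ifP => _; [apply: extend_prefix|apply: prefix_refl].
have lab_size x : size (lab x) <= J by apply: recd_size.
have acE : acyclic G' = ~~ connect (arc G) v u by apply: acyclic_rcons.
have noop : acyclic G' -> label_le r (lab v) (lab u) ->
    run_inv G' lab (extend G' n u v H).
  move=> ac vu.
  have rel x y : (x, y) \in G' -> relaxed r lab x y.
    rewrite new_arc => /predU1P[[-> ->]|]; last exact: (inv_relaxed inv).
    rewrite /relaxed -[lab v](@push_id n r _ v).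
    + by apply: push_mono => //; apply: inv_wf inv _.
    + exact: inv_wf inv _.
    + exact: tracks_rcons (inv_tracks inv) (inv_walks inv).
  split=> //.
    apply: tracks_extend (inv_tracks inv) _ _; first exact: rel.
    by move=> x y _; apply: rel.
  apply: walks_extend => //; case: (inv_walks inv) => H1 wH; split=> // z p /wH.
  exact: sub_walk_to.
have sizeG : (size G).+1 <= size a.
  by have := size_prefix preG; rewrite size_rcons.
rewrite /insert -/(label_lt r (lab v) (lab u)); case: ifP => vu.
  split=> //.
  have ac : acyclic G'.
    by rewrite acE; apply/negP => /(connect_label_le inv); rewrite /label_le vu.
  split=> //; last by rewrite /=; lia.
  exact/noop/label_lt_le.
have {vu} uv_le : label_le r (lab u) (lab v) by rewrite /label_le vu.
have := cycle_detectP inv lab_size uv_le; rewrite -/G'.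
case: cycle_detect => tr cyc [sz4 lightT cycT szT].
case: cyc cycT szT => [_ _|cycT szT] /=.
  by split=> //; apply: leq_trans sz4 _; lia.
have ac : acyclic G' by rewrite acE; apply/negP => /cycT.
have bc := backward_cost_segment inv ac preG.
rewrite ac in preW.
rewrite -/(label_lt r (lab u) (lab v)); move: (szT isT); case: ifP => lt sz; last first.
  split=> //; split=> //; last by move: sz bc; lia.
  by apply: noop => //; rewrite /label_le lt.
have walksG' : walks G' H.
  by case: (inv_walks inv) => H1 wH; split=> // z p /wH; apply: sub_walk_to.
have below : relaxed_below r G' lab v.
  move=> x y vx; rewrite new_arc => /predU1P[[xu _]|]; last exact: (inv_relaxed inv).
  by rewrite xu (negPf (acyclicP _ ac _ _ uvG)) in vx.
have dG z : size (out_nbrs G' z) <= deg z by apply: prefix_out_nbrs.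
have := update_ok r_inj recdP recd_size ac dG uvG (height_le G' v) (inv_tracks inv) walksG' below preW.
case: update => lab' utr [trk le [reluv rel] cost lightU].
have relG x y : (x, y) \in G' -> relaxed r lab' x y.
  move=> xy; case: (boolP (connect (arc G') v x)) => [vx|nvx]; first exact: rel.
  move: xy; rewrite new_arc => /predU1P[[-> ->]//|xy].
  rewrite /relaxed (le x).2 //; apply: label_le_trans (le y).1 _.
  exact: inv_relaxed inv _ _ xy.
have inv' : run_inv G' lab' (extend G' n u v H) by split=> //; apply: walks_extend.
split; first by move=> e /List.in_app_iff[/lightT|/lightU].
split=> //.
(* A vertex of the forward search descends from [v], so its new label is at most that of [u], which
   was below its old label. *)
have fwd : forward_cost G lab u v + Phi lab' <= Phi lab.
  rewrite /Phi /label_potential /forward_cost big_mkcond -big_split; apply: leq_sum => w _ /=.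
  case: ifP => [/andP[vw uw]|_]; last by rewrite leq_mul2l (smaller_le _ _ (le w).1) orbT.
  have lt' : label_lt r (lab' w) (lab w).
    apply: label_le_lt_trans uw; rewrite -(le u).2; last exact: acyclicP _ ac _ _ uvG.
    apply: connect_label_le inv' _ _ _; apply: connect_trans (sub_connect subG vw).
    exact: connect1.
  have lr' : lab' w \in recd w by apply: recdP (preW w) (trk w).
  apply: leq_trans (_ : deg w + deg w * smaller r recd w (lab' w) <= _).
    by rewrite leq_add2r dG.
  by rewrite -mulnS leq_mul2l smaller_lt ?orbT.
rewrite size_cat; move: sz bc fwd cost; rewrite -/(Phi lab) -/(Phi lab'); lia.
Qed.

(** The test is acyclicity of the graph rather than the outcome of the search, so that the walk
    lists depend on the arcs alone. *)
Fixpoint extend_all G H (arcs : seq ('I_n * 'I_n)) :=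
  if arcs is (u, v) :: arcs' then
    let G' := rcons G (u, v) in
    if acyclic G' then extend_all G' (extend G' n u v H) arcs' else H
  else H.

Lemma extend_all_prefix G H arcs z : prefix (H z) (extend_all G H arcs z).
Proof.
elim: arcs G H => [|[u v] arcs IH] G H /=; first exact: prefix_refl.
case: ifP => _; last exact: prefix_refl.
exact: prefix_trans (extend_prefix _ _ _ _ _ _) (IH _ _).
Qed.

Fixpoint search_bound G (arcs : seq ('I_n * 'I_n)) :=
  if arcs is (u, v) :: arcs' then
    2 * (unranked_indegree G u + E) + 1 + search_bound (rcons G (u, v)) arcs'
  else 0.

Lemma insert_all_ok G lab H arcs : run_inv G lab H -> a = G ++ arcs ->
  (forall z, prefix (extend_all G H arcs z) (W z)) ->
  let tr := insert_all skip r G lab arcs in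
  (forall e, List.In e tr -> light J e) /\
  size tr <= 3 * Phi lab + search_bound G arcs + 4 * size a.
Proof.
elim: arcs G lab H => [|[u v] arcs IH] G lab H inv ea preW //=.
have preG : prefix (rcons G (u, v)) a by rewrite ea -cat_rcons prefix_prefix.
have := @insert_ok G lab H u v inv preG.
case: insert => [[lab' tr] cyc] ok.
have {ok} [|lightT] := ok.
  move=> z; apply: prefix_trans (preW z) => /=.
  by case: ifP => _; [apply: extend_all_prefix|apply: prefix_refl].
case: cyc => [sz|[ac inv' cost]]; first by split=> //; lia.
have [||l2 s2] := IH _ _ _ inv'; first by rewrite cat_rcons.
  by move: preW => /=; rewrite ac.
split; first by move=> e /List.in_app_iff[/lightT|/l2].
by rewrite size_cat; lia.
Qed.

End Run.
End Insert.

(** * Ranks given by the order of items *)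

Lemma connect_nil n (x y : 'I_n) : connect (arc ([::] : graph n)) x y = (x == y).
Proof.
apply/connectP/eqP => [[[|z p] //= _ ->//]|->]; by exists [::].
Qed.

Lemma label_from_set0 n (r : 'I_n -> rank) G v k : label_from r G v k set0 = [::].
Proof. by case: k => //= k; case: pickP => // y; rewrite inE. Qed.

Lemma dag_label_nil n (r : 'I_n -> rank) z : dag_label r [::] z = ranked_seq r z.
Proof.
rewrite /dag_label; case: n r z => [|m] r z; first by case: z.
rewrite /=; set A := _ :&: _; have mA x : (x \in A) = (x == z) && (r z != None).
  by rewrite !inE connect_nil; case: eqP => // ->.
rewrite /ranked_seq; case: pickP => [x /andP[]|none]; rewrite ?mA.
  case/andP=> /eqP-> rz _; rewrite rz; congr (_ :: _).
  set B := _ :&: _; have B0 : B = set0.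
    by apply/setP => y; rewrite !inE !connect_nil; case: (y == z); rewrite ?andbF.
  by rewrite B0 label_from_set0.
case: ifP => // rz; have := none z; rewrite mA eqxx rz /=.
move/negP; case; apply/forall_inP => y; rewrite mA => /andP[/eqP-> _].
by rewrite rank_ltxx.
Qed.

Section IndexRank.
Variable n : nat.
Implicit Types (o : seq (option 'I_n)) (r : 'I_n -> rank).

(** A vertex entered by several ranked arcs occurs several times in [o]; [index] finds the first
    occurrence, hence the minimum rank. *)
Definition index_rank o (y : 'I_n) : rank :=
  if Some y \in o then Some (index (Some y) o) else None.

Definition singletons (z : 'I_n) : seq (seq 'I_n) := [:: [:: z]].

Variables (o : seq (option 'I_n)) (r : 'I_n -> rank).
Hypothesis rE : r =1 index_rank o.

Lemma index_rank_inj x y : r x = r y -> r x != None -> x = y.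
Proof.
rewrite !rE /index_rank; case: ifP => // xo; case: ifP => // yo [e] _.
by apply/Some_inj; rewrite -(nth_index None xo) e nth_index.
Qed.

Lemma run_inv_nil : run_inv r [::] (dag_label r [::]) singletons.
Proof.
split=> //.
- move=> z; rewrite dag_label_nil; split; first by exists [:: z]; rewrite ?mem_head.
  by move=> p; rewrite inE => /eqP->; apply: label_lexx.
- split=> [z|z p]; first exact: mem_head.
  by rewrite inE => /eqP->; apply: walk_to1.
Qed.

End IndexRank.

Section RunBound.
Variables (n : nat) (a : seq ('I_n * 'I_n)).
Implicit Types (G : graph n).

Definition visits (z : 'I_n) := extend_all [::] (@singletons n) a z.

Lemma extend_all_acyclic arcs G H : acyclic G -> walks G H ->
  exists2 G', acyclic G' & walks G' (extend_all G H arcs).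
Proof.
elim: arcs G H => [|[u v] arcs IH] G H ac wH /=; first by exists G.
case: ifP => ac'; last by exists G.
apply: IH => //; apply: walks_extend; first by rewrite mem_rcons mem_head.
case: wH => H1 wH; split=> // z p /wH; apply: sub_walk_to => e eG.
by rewrite mem_rcons inE eG orbT.
Qed.

Lemma visits_descending : exists pos : 'I_n -> nat,
  forall z, {in visits z, forall p, descending pos p}.
Proof.
have [||G ac [_ wG]] := @extend_all_acyclic a [::] (@singletons n) => //.
  split=> [z|z p]; first exact: mem_head.
  by rewrite inE => /eqP->; apply: walk_to1.
by exists (height G) => z p /wG; apply: walk_to_descending.
Qed.

Variables (skip : bool) (o : seq (option 'I_n)) (r : 'I_n -> rank) (E : nat).
Hypothesis rE : r =1 index_rank o.
Hypothesis ranked_in_nbrs : forall x, r x != None -> skip || (size (in_nbrs a x) <= E).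

Lemma visits_recordsP z ps l : prefix ps (visits z) -> is_best r ps l ->
  l \in records o (visits z).
Proof.
have [pos dp] := visits_descending.
apply: mem_records => [p /dp/descending_uniq//|p y _ _|p p' y y' _ _ _ _].
  by rewrite rE /index_rank; case: (Some y \in o).
rewrite !rE /index_rank => lt.
have -> : Some y \in o by rewrite -index_mem; apply: leq_trans lt (index_size _ _).
by case: ifP.
Qed.

Lemma run_ok J : (forall z l, l \in records o (visits z) -> size l <= J) ->
  (forall e, List.In e (run skip r a) -> light J e) /\
  size (run skip r a) <=
    3 * (\sum_z size (out_nbrs a z) * size (records o (visits z)))
    + search_bound r a E [::] a + 4 * size a.
Proof.
move=> sJ.
have := insert_all_ok (index_rank_inj rE) visits_recordsP sJ ranked_in_nbrs
  (run_inv_nil r) (erefl _) (fun z => prefix_refl (visits z)).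
case=> lt sz; split=> //; apply: leq_trans sz _.
rewrite !leq_add2r leq_mul2l; apply: leq_sum => z _.
by rewrite leq_mul2l count_size orbT.
Qed.

End RunBound.

Section Items.
Variables (n k : nat) (g : 'I_k -> 'I_n).
Implicit Types (w : ranking k) (L : {set 'I_k}) (s : 'S_k).

Definition item_vertex L i := if i \in L then Some (g i) else None.

(** Unranked items keep their place as [None], so that the place of an item is the value of the
    permutation on it. *)
Definition item_order w := [seq item_vertex w.1 i | i <- [seq (w.2^-1)%g j | j <- enum 'I_k]].

Definition vertex_rank w v : rank :=
  foldr rank_min None [seq ranking_rank w i | i <- enum 'I_k & g i == v].

Lemma foldr_rank_min (s : seq rank) b : b \in s -> {in s, forall c, ~~ rank_lt c b} ->
  foldr rank_min None s = b.
Proof.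
have lower (t : seq rank) c : c \in t -> ~~ rank_lt c (foldr rank_min None t).
  elim: t => //= d t IHt; rewrite inE /rank_min => /predU1P[->|/IHt nc]; case: ifP => lt //.
  - by apply/negP => /(rank_lt_trans lt); rewrite rank_ltxx.
  - by rewrite rank_ltxx.
  - apply/negP => cd; case: (eqVneq c (foldr rank_min None t)) => [e|/rank_lt_total/(_ nc) fc].
      by rewrite -e cd in lt.
    by rewrite (rank_lt_trans fc cd) in lt.
have mem (t : seq rank) : (foldr rank_min None t \in t) || (foldr rank_min None t == None).
  elim: t => //= d t IHt; rewrite inE /rank_min; case: ifP => _; last by rewrite eqxx.
  by case/orP: IHt => ->; rewrite !orbT.
move=> bs bmin; apply/eqP/negPn/negP => neq.
have nlt := lower _ _ bs; have lt := rank_lt_total neq.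
case/orP: (mem s) => [/bmin n1|/eqP e]; first by rewrite (negPf nlt) // in lt; move: (lt n1).
by move: nlt neq; rewrite e; case: (b).
Qed.

Lemma size_item_order w : size (item_order w) = k.
Proof. by rewrite 2!size_map size_enum_ord. Qed.

Lemma nth_item_order w i : nth None (item_order w) (w.2 i) = item_vertex w.1 i.
Proof.
rewrite /item_order -map_comp (nth_map i) ?size_enum_ord //=.
by rewrite nth_ord_enum permK.
Qed.

Lemma vertex_rankE w : vertex_rank w =1 index_rank (item_order w).
Proof.
move=> v; rewrite /vertex_rank /index_rank; case: ifP => vo; last first.
  have : all (pred1 None) [seq ranking_rank w i | i <- enum 'I_k & g i == v].
    apply/allP => c /mapP[i]; rewrite mem_filter => /andP[/eqP gi _] ->.
    rewrite /ranking_rank; case: ifP => //= iL; move/negP: vo; case.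
    rewrite -gi; have := nth_item_order w i; rewrite /item_vertex iL => <-.
    by rewrite mem_nth // size_item_order.
  by elim: map => //= c t IHt /andP[/eqP-> /IHt->].
have jk : index (Some v) (item_order w) < k by rewrite -[ltnRHS](size_item_order w) index_mem.
pose i := (w.2^-1)%g (Ordinal jk).
have si : w.2 i = Ordinal jk by rewrite permKV.
have := nth_item_order w i; rewrite si nth_index // /item_vertex.
case: ifP => // iL [gi]; apply: foldr_rank_min.
  apply/mapP; exists i; first by rewrite mem_filter -gi eqxx mem_enum.
  by rewrite /ranking_rank iL si.
move=> c /mapP[i']; rewrite mem_filter => /andP[/eqP gi' _] ->.
rewrite /ranking_rank; case: ifP => //= i'L; rewrite -leqNgt leqNgt; apply/negP => lt.
have := before_find None lt; rewrite -/(index _ _) /= nth_item_order /item_vertex i'L gi' eqxx.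
by [].
Qed.

(** The item order lists the preimages of 0, 1, ..., and inversion merely reindexes the sum: a
    uniform permutation yields a uniform order. *)
Lemma sum_perms (F : seq 'I_k -> nat) :
  \sum_(s : 'S_k) F [seq (s^-1)%g j | j <- enum 'I_k] =
  \sum_(t <- permutations (enum 'I_k)) F t.
Proof.
rewrite (reindex_inj invg_inj) /=; under eq_bigr => s _ do rewrite invgK.
transitivity (\sum_(t <- [seq [seq fun_of_perm s j | j <- enum 'I_k] | s <- enum 'S_k]) F t).
  by rewrite big_map big_enum.
apply: perm_big.
have u1 : uniq [seq [seq fun_of_perm s j | j <- enum 'I_k] | s <- enum 'S_k].
  rewrite map_inj_uniq ?enum_uniq // => s t /eq_in_map st.
  by apply/permP => j; apply: st; rewrite mem_enum.
have sub : {subset [seq [seq fun_of_perm s j | j <- enum 'I_k] | s <- enum 'S_k]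
    <= permutations (enum 'I_k)}.
  move=> t /mapP[s _ ->]; rewrite mem_permutations; apply: uniq_perm.
  - by rewrite map_inj_uniq ?enum_uniq //; apply: perm_inj.
  - exact: enum_uniq.
  - move=> j; rewrite mem_enum; apply/mapP; exists ((s^-1)%g j); rewrite ?mem_enum //.
    by rewrite permKV.
have sz : size (permutations (enum 'I_k)) <= size [seq [seq fun_of_perm s j | j <- enum 'I_k] | s <- enum 'S_k].
  rewrite size_permutations ?enum_uniq // size_map size_enum_ord -cardE.
  by rewrite card_Sn.
have [_ eqi] := uniq_min_size u1 sub sz.
by apply: uniq_perm => //; apply: permutations_uniq.
Qed.

Section Weighted.
Variables (z : nat) (f : nat -> nat).
Hypothesis f_mono : {homo f : i j / i <= j}.
Hypothesis f0 : 0 < f 0.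
Hypothesis f_sum : forall c, z.+1 * (\sum_(j < c) f j) <= c * f c.

Lemma sum_weight_item_order (a : seq ('I_n * 'I_n)) L x :
  \sum_(s : 'S_k) weight z (records (item_order (L, s)) (visits a x)) <= k`! * f #|L|.
Proof.
have [pos dp] := visits_descending a.
rewrite (sum_perms (fun t => weight z (records [seq item_vertex L i | i <- t] (visits a x)))).
have := @sum_weight_records n _ (item_vertex L) pos z f f_mono f0 f_sum _ _ (enum_uniq 'I_k) (dp x).
rewrite size_enum_ord => /leq_trans; apply; rewrite leq_mul2l f_mono ?orbT //.
have -> : #|L| = count (mem L) (enum 'I_k) by rewrite -sum1_card -sum1_count big_enum_cond.
apply: sub_count => i; rewrite /occurs /item_vertex /=; by case: (i \in L).
Qed.
End Weighted.
End Items.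

Local Open Scope ring_scope.

(** * Expectations *)

Section Expectation.
Variables (R : realType) (k : nat) (q : R).
Hypothesis q01 : 0 <= q <= 1.
Implicit Types (X Y : ranking k -> R) (w : ranking k) (L A : {set 'I_k}).

Definition set_mass L := q ^+ #|L| * (1 - q) ^+ (k - #|L|).

Lemma set_mass_ge0 L : 0 <= set_mass L.
Proof. by case/andP: q01 => q0 q1; rewrite mulr_ge0 ?exprn_ge0 ?subr_ge0. Qed.

Lemma ranking_mass_ge0 w : 0 <= ranking_mass q w.
Proof. by rewrite /ranking_mass -/(set_mass _) divr_ge0 ?set_mass_ge0 ?ler0n. Qed.

Lemma set_massE L : set_mass L = \prod_i (if i \in L then q else 1 - q).
Proof.
rewrite (bigID (mem L)) /=; congr (_ * _).
  by rewrite (eq_bigr (fun=> q)) ?prodr_const // => i ->.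
rewrite (eq_bigr (fun=> 1 - q)) => [|i /negPf-> //].
rewrite prodr_const; congr (_ ^+ _).
by rewrite -[X in (X - _)%N](card_ord k) -(cardC L) addKn; apply: eq_card.
Qed.

Lemma sum_set_mass_avoid A : \sum_(L : {set 'I_k} | [disjoint L & A]) set_mass L = (1 - q) ^+ #|A|.
Proof.
(* Giving membership weight 0 on [A] kills, in the expanded product, exactly the sets that meet
   [A]. *)
pose F i := if i \in A then 0 else q.
have -> : (1 - q) ^+ #|A| = \prod_i (F i + (1 - q)).
  rewrite (bigID (mem A)) /= [X in _ * X]big1 => [|i /negPf iA]; last by rewrite /F iA addrC subrK.
  rewrite mulr1 (eq_bigr (fun=> 1 - q)) ?prodr_const // => i iA.
  by rewrite /F iA add0r.
rewrite bigA_distr big_mkcond; apply: eq_bigr => L _.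
case: (boolP [disjoint L & A]) => [dLA|].
  rewrite set_massE; apply: eq_bigr => i _; case: ifP => // iL.
  by rewrite /F (disjointFr dLA iL).
case/pred0Pn => i /andP[/= iL iA].
by rewrite (bigD1 i) //= iL /F iA mul0r.
Qed.

Lemma sum_set_mass : \sum_L set_mass L = 1.
Proof.
rewrite -(expr0 (1 - q)) -(cards0 'I_k) -sum_set_mass_avoid.
by apply: eq_bigl => L; rewrite disjoint_sym disjoints_subset sub0set.
Qed.

Lemma sum_set_mass_in i : \sum_(L : {set 'I_k} | i \in L) set_mass L = q.
Proof.
have := sum_set_mass; rewrite (bigID (fun L : {set 'I_k} => i \in L)) /=.
have := sum_set_mass_avoid [set i]; rewrite cards1 expr1 => avoid.
rewrite [X in _ + X = _](eq_bigl (fun L : {set 'I_k} => [disjoint L & [set i]])) => [|L].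
  by rewrite avoid => /(canRL (addrK _)) ->; rewrite opprB addrCA subrr addr0.
by rewrite disjoint_sym disjoints1.
Qed.

Lemma sum_set_mass_card : \sum_L set_mass L * #|L|%:R = k%:R * q.
Proof.
transitivity (\sum_(L : {set 'I_k}) \sum_(i in L) set_mass L).
  by apply: eq_bigr => L _; rewrite sumr_const mulr_natr.
rewrite (exchange_big_dep predT) //=.
under eq_bigr => i _ do rewrite sum_set_mass_in.
by rewrite sumr_const card_ord mulr_natl.
Qed.

Lemma expectE X : expect q X = \sum_L set_mass L * ((\sum_s X (L, s)) / (k`!)%:R).
Proof.
transitivity (\sum_L \sum_s ranking_mass q (L, s) * X (L, s)).
  by rewrite pair_bigA; apply: eq_bigr => -[].
apply: eq_bigr => L _; rewrite mulr_suml mulr_sumr; apply: eq_bigr => s _.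
by rewrite /ranking_mass /= /set_mass; rewrite -!mulrA; congr (_ * (_ * _)); apply: mulrC.
Qed.

Lemma probE (P : pred (ranking k)) : prob q P = expect q (fun w => (P w)%:R).
Proof.
rewrite /prob big_mkcond /expect; apply: eq_bigr => w _.
by case: (P w); rewrite ?mulr1 ?mulr0.
Qed.

Lemma ler_expect X Y : (forall w, X w <= Y w) -> expect q X <= expect q Y.
Proof.
by move=> XY; apply: ler_sum => w _; apply: ler_wpM2l (ranking_mass_ge0 w) _ _ (XY w).
Qed.

Lemma expectD X Y : expect q (fun w => X w + Y w) = expect q X + expect q Y.
Proof. by rewrite /expect -big_split; apply: eq_bigr => w _; rewrite mulrDr. Qed.

Lemma expectZ c X : expect q (fun w => c * X w) = c * expect q X.
Proof. by rewrite /expect mulr_sumr; apply: eq_bigr => w _; rewrite mulrCA. Qed.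

Lemma expect_sum (I : finType) (P : pred I) (X : I -> ranking k -> R) :
  expect q (fun w => \sum_(i | P i) X i w) = \sum_(i | P i) expect q (X i).
Proof.
rewrite /expect exchange_big; apply: eq_bigr => w _; exact: mulr_sumr.
Qed.

Lemma fact_neq0 : (k`!)%:R != 0 :> R.
Proof. by rewrite pnatr_eq0 -lt0n fact_gt0. Qed.

Lemma expect_set (X : {set 'I_k} -> R) : expect q (fun w => X w.1) = \sum_L set_mass L * X L.
Proof.
rewrite expectE; apply: eq_bigr => L _; congr (_ * _).
by rewrite /= sumr_const card_Sn -[X L *+ _]mulr_natr mulfK ?fact_neq0.
Qed.

Lemma expect_cst c : expect q (fun _ : ranking k => c) = c.
Proof. by rewrite (expect_set (fun=> c)) -mulr_suml sum_set_mass mul1r. Qed.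

(** The count over random orders holds for each fixed ranked set, so the permutations are averaged
    first and the set last. *)
Lemma expect_nat_le (X : ranking k -> nat) (c : {set 'I_k} -> nat) :
  (forall L, (\sum_s X (L, s) <= k`! * c L)%N) ->
  expect q (fun w => (X w)%:R) <= expect q (fun w => (c w.1)%:R).
Proof.
move=> Xc; rewrite expectE (expect_set (fun L => (c L)%:R)); apply: ler_sum => L _.
apply: ler_wpM2l (set_mass_ge0 L) _ _ _.
rewrite ler_pdivrMr ?ltr0n ?fact_gt0 // -natr_sum -natrM ler_nat mulnC; exact: Xc.
Qed.

Lemma expect_card : expect q (fun w : ranking k => #|w.1|%:R) = k%:R * q.
Proof. by rewrite (expect_set (fun L => #|L|%:R)) sum_set_mass_card. Qed.

Lemma prob_avoid A : prob q (fun w : ranking k => [disjoint w.1 & A]) = (1 - q) ^+ #|A|.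
Proof.
rewrite probE (expect_set (fun L => [disjoint L & A]%:R)) -sum_set_mass_avoid [RHS]big_mkcond.
by apply: eq_bigr => L _; case: ifP => _; rewrite ?mulr1 ?mulr0.
Qed.

Lemma ler_prob (P P' : pred (ranking k)) : (forall w, P w -> P' w) -> prob q P <= prob q P'.
Proof.
move=> PP'; rewrite !probE; apply: ler_expect => w.
by case: (P w) (PP' w) => [->|] //; rewrite ler0n.
Qed.

Lemma probC (P : pred (ranking k)) : prob q P = 1 - prob q (predC P).
Proof.
rewrite -(expect_cst 1) !probE; apply/(addIr (expect q (fun w => (~~ P w)%:R))).
rewrite subrK -expectD; apply: eq_bigr => w _.
by case: (P w); rewrite /= ?addr0 ?add0r.
Qed.

End Expectation.

(** * Expected number of messages and length of labels *)

Lemma weight1 n (ls : seq (seq 'I_n)) : weight 1 ls = size ls.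
Proof.
by rewrite /weight (eq_bigr (fun=> 1%N)) => [|l _]; rewrite ?exp1n // sum1_size.
Qed.

Lemma sum_succ_le c : (2 * (\sum_(j < c) j.+1) <= c * c.+1)%N.
Proof.
elim: c => [|c IHc]; rewrite ?big_ord0 // big_ord_recr /= mulnDr.
by apply: leq_trans (leq_add IHc (leqnn _)) _; nia.
Qed.

Lemma sum_succ2_le c : (3 * (\sum_(j < c) j.+1 * j.+2) <= c * (c.+1 * c.+2))%N.
Proof.
elim: c => [|c IHc]; rewrite ?big_ord0 // big_ord_recr /= mulnDr.
by apply: leq_trans (leq_add IHc (leqnn _)) _; nia.
Qed.

Section Messages.
Variables (R : realType) (n k : nat) (g : 'I_k -> 'I_n) (q : R) (a : seq ('I_n * 'I_n)).
Hypothesis q01 : 0 <= q <= 1.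
Implicit Types w : ranking k.

Lemma expect_records z :
  expect q (fun w => (size (records (item_order g w) (visits a z)))%:R) <= k%:R * q + 1.
Proof.
have -> : k%:R * q + 1 = expect q (fun w : ranking k => (#|w.1|.+1)%:R).
  rewrite -(expect_card k q) -[X in _ + X](expect_cst k q) -expectD.
  by apply: eq_bigr => w _; rewrite -natr1.
apply: (expect_nat_le q01 (c := fun L => #|L|.+1)) => L.
apply: leq_trans (@sum_weight_item_order n k g 1 succn (fun i j ij => ij) isT sum_succ_le a L z).
by apply: leq_sum => s _; rewrite weight1.
Qed.

Definition long_record J w :=
  [exists z, has (fun l => J < size l)%N (records (item_order g w) (visits a z))].

(** Markov's inequality for the sum of [2 ^ size l] over all vertices and records: one record longer
    than [J] already contributes [2 ^ J]. *)
Lemma prob_long_record J :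
  prob q (long_record J) <= n%:R * (k.+1 * k.+2)%:R / 2%:R ^+ J.
Proof.
rewrite ler_pdivlMr ?exprn_gt0 // mulrC probE -expectZ.
have -> : n%:R * (k.+1 * k.+2)%:R = expect q (fun w : ranking k => (n * (k.+1 * k.+2))%:R) :> R.
  by rewrite expect_cst // -natrM.
rewrite -natrX.
apply: le_trans (expect_nat_le q01 (X := fun w => (2 ^ J * long_record J w)%N)
   (c := fun=> (n * (k.+1 * k.+2))%N) _).
  by apply: ler_expect => // w; rewrite natrM.
move=> L; apply: (@leq_trans (\sum_(s : 'S_k) \sum_z
    weight 2 (records (item_order g (L, s)) (visits a z)))).
  apply: leq_sum => s _; case: (boolP (long_record J (L, s))) => [/existsP[z /hasP[l lz lJ]]|]; last by rewrite muln0.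
  rewrite muln1 (bigD1 z) //=; apply: leq_trans (leq_addr _ _).
  rewrite /weight (big_rem l) //=; apply: leq_trans (leq_addr _ _).
  by rewrite leq_exp2l // ltnW.
rewrite exchange_big mulnCA -[X in (_ <= X * _)%N]card_ord -sum_nat_const.
apply: leq_sum => z _.
apply: leq_trans (@sum_weight_item_order n k g 2 (fun j => (j.+1 * j.+2)%N) _ isT sum_succ2_le a L z) _.
  by move=> i j ij; apply: leq_mul; rewrite ltnS.
have Lk : (#|L| <= k)%N by rewrite -[leqRHS]card_ord max_card.
by rewrite leq_mul2l leq_mul ?orbT ?ltnS.
Qed.

Definition items_into (S : {set 'I_n}) : {set 'I_k} := [set i | g i \in S].

Lemma unranked_avoid w (S : {set 'I_n}) :
  [forall z in S, vertex_rank g w z == None] -> [disjoint w.1 & items_into S].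
Proof.
move=> /forall_inP unr; rewrite disjoint_sym disjoints_subset; apply/subsetP => i.
rewrite !inE => /unr; rewrite vertex_rankE /index_rank; case: ifP => // nord _.
apply: contraFN nord => iL; have := nth_item_order g w i; rewrite /item_vertex iL => <-.
by rewrite mem_nth // size_item_order.
Qed.

(** [K] bounds the in-arcs that one item stands for: the degree bound if items are vertices, 1 if
    they are arcs. A set entered by more than [B] items is left unranked with probability at most
    [delta]. *)
Variables (K B : nat) (delta : R).
Hypothesis in_nbrs_items : forall x, (size (in_nbrs a x) <= K * #|[set i | g i == x]|)%N.
Hypothesis avoid_le : forall A : {set 'I_k}, (B < #|A|)%N -> (1 - q) ^+ #|A| <= delta.
Hypothesis delta_ge0 : 0 <= delta.

Lemma sum_in_nbrs_items (S : {set 'I_n}) :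
  (\sum_(z in S) size (in_nbrs a z) <= K * #|items_into S|)%N.
Proof.
apply: (@leq_trans (\sum_(z in S) K * #|[set i | g i == z]|)%N).
  by apply: leq_sum => z _.
rewrite -big_distrr leq_mul2l /=; apply/orP; right.
rewrite -sum1_card (partition_big g (mem S)) => [|i]; last by rewrite inE.
apply: leq_sum => z zS; rewrite -sum1_card big_mkcond [leqRHS]big_mkcond.
by apply: leq_sum => i _; rewrite !inE; case: eqP => [->|]; rewrite ?zS ?andbF.
Qed.

(** A segment receiving at most [K * B] arcs costs no more than that; any other one is unranked with
    probability at most [delta], and then costs at most all arcs. The union bound applies because
    the [n.+1] segments depend on [G] and [u] only. *)
Lemma expect_unranked_indegree G u :
  expect q (fun w => (unranked_indegree (vertex_rank g w) a G u)%:R)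
    <= (K * B)%:R + (size a)%:R * (n.+1)%:R * delta.
Proof.
pose wt ox := (\sum_(z in segment G u ox) size (in_nbrs a z))%N.
pose big ox := (K * B < wt ox)%N.
pose A ox := items_into (segment G u ox).
apply: (@le_trans _ _ (expect q (fun w : ranking k => (K * B)%:R +
   (size a)%:R * \sum_(ox | big ox) [disjoint w.1 & A ox]%:R))).
  apply: ler_expect => // w; rewrite -natr_sum -natrM -natrD ler_nat.
  apply/bigmax_leqP => ox unr; rewrite -/(wt ox).
  case: (leqP (wt ox) (K * B)) => [/leq_trans->//|bigox]; first by rewrite leq_addr.
  apply: leq_trans (leq_addl _ _).
  apply: (@leq_trans (size a * 1)%N).
    rewrite muln1 -sum_in_nbrs /wt big_mkcond; apply: leq_sum => z _.
    by case: ifP.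
  rewrite leq_mul2l (bigD1 ox) //= (unranked_avoid unr); apply/orP; right.
  exact: leq_addr.
rewrite expectD expect_cst // expectZ lerD2l -mulrA ler_wpM2l ?ler0n //.
rewrite expect_sum; apply: (@le_trans _ _ (\sum_(ox | big ox) delta)).
  apply: ler_sum => ox bigox; rewrite -probE prob_avoid //; apply: avoid_le.
  have := leq_trans bigox (sum_in_nbrs_items _); rewrite -/(A ox).
  by rewrite ltn_mul2l => /andP[].
rewrite sumr_const -[delta *+ _]mulr_natl ler_wpM2r // ler_nat.
by apply: leq_trans (max_card _) _; rewrite card_option card_ord.
Qed.

Lemma expect_search_bound E G arcs :
  expect q (fun w => (search_bound (vertex_rank g w) a E G arcs)%:R)
    <= (size arcs)%:R * (2 * ((K * B)%:R + (size a)%:R * (n.+1)%:R * delta + E%:R) + 1).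
Proof.
elim: arcs G => [|[u v] arcs IH] G; first by rewrite expect_cst // mul0r.
apply: (@le_trans _ _ (expect q (fun w : ranking k =>
    (2 * ((unranked_indegree (vertex_rank g w) a G u)%:R + E%:R) + 1)
    + (search_bound (vertex_rank g w) a E (rcons G (u, v)) arcs)%:R))).
  by apply: ler_expect => // w; rewrite -natrD -natrM natr1 -natrD /= addn1.
rewrite !expectD expectZ !expectD !expect_cst //.
have -> : (size ((u, v) :: arcs))%:R = (size arcs)%:R + 1 :> R by rewrite natr1.
have := expect_unranked_indegree G u; have := IH (rcons G (u, v)); lra.
Qed.

Variables (skip : bool) (E : nat).
Hypothesis ranked_in_nbrs : skip \/ (forall x, (size (in_nbrs a x) <= E)%N).

Lemma run_vertex_rank w J : ~~ long_record J w ->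
  (forall e, List.In e (run skip (vertex_rank g w) a) -> light J e) /\
  (size (run skip (vertex_rank g w) a) <=
    3 * (\sum_z size (out_nbrs a z) * size (records (item_order g w) (visits a z)))
    + search_bound (vertex_rank g w) a E [::] a + 4 * size a)%N.
Proof.
move=> nl; apply: run_ok; first exact: vertex_rankE.
  by move=> x _; case: ranked_in_nbrs => [->//|->]; rewrite orbT.
move=> z l lz; rewrite leqNgt; apply: contra nl => lJ.
by apply/existsP; exists z; apply/hasP; exists l.
Qed.

Lemma expect_run :
  expect q (fun w => num_messages R (run skip (vertex_rank g w) a)) <=
  (size a)%:R * (3 * (k%:R * q) + 2 * ((K * B)%:R + (size a)%:R * (n.+1)%:R * delta + E%:R) + 8).
Proof.
apply: (@le_trans _ _ (expect q (fun w : ranking k =>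
   3 * (\sum_z (size (out_nbrs a z))%:R * (size (records (item_order g w) (visits a z)))%:R)
    + (search_bound (vertex_rank g w) a E [::] a)%:R + 4 * (size a)%:R))).
  apply: ler_expect => // w; rewrite /num_messages.
  under eq_bigr => z _ do rewrite -natrM.
  rewrite -natr_sum -!natrM -!natrD ler_nat.
  (* The message count holds whatever the lengths: [J] is the longest record of this particular
     outcome. *)
  pose J := (\max_z \max_(l <- records (item_order g w) (visits a z)) size l)%N.
  apply: (run_vertex_rank (J := J) _).2.
  apply/existsPn => z; rewrite -all_predC; apply/allP => l lz /=; rewrite -leqNgt.
  apply: leq_trans (leq_bigmax z).
  exact: (leq_bigmax_seq (P := predT) (F := size)).
rewrite !expectD !expectZ expect_cst //.
rewrite (expect_sum _ predT (fun z w => (size (out_nbrs a z))%:R * (size (records (item_order g w) (visits a z)))%:R)).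
have sb := expect_search_bound E [::] a.
suff rec : \sum_z expect q (fun w => (size (out_nbrs a z))%:R * (size (records (item_order g w) (visits a z)))%:R)
   <= (size a)%:R * (k%:R * q + 1) by move: sb rec; lra.
rewrite -[in leRHS](sum_out_nbrs a) natr_sum mulr_suml; apply: ler_sum => z _.
by rewrite expectZ ler_wpM2l ?ler0n // expect_records.
Qed.

End Messages.

(** * Estimates for logarithms and square roots *)

Section Logarithms.
Variable R : realType.
Implicit Types (n m j : nat) (x q : R).

Lemma ln2_gt0 : 0 < ln 2 :> R.
Proof. by apply: ln_gt0; rewrite ltr1n. Qed.

Lemma ln_nat_ge2 n : (1 < n)%N -> ln 2 <= ln n%:R :> R.
Proof. by move=> n1; rewrite ler_ln ?posrE ?ltr0n ?ler_nat // ltnW. Qed.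

Lemma ln_nat_gt0 n : (1 < n)%N -> 0 < ln n%:R :> R.
Proof. by move=> /ln_nat_ge2; apply: lt_le_trans ln2_gt0. Qed.

Lemma ln_exp2_le j n : (2 ^ j <= n)%N -> j%:R * ln 2 <= ln n%:R :> R.
Proof.
move=> jn; have n0 : (0 < n)%N by apply: leq_trans jn; rewrite expn_gt0.
rewrite mulr_natl -lnXn // ler_ln ?posrE ?exprn_gt0 ?ltr0n //.
by rewrite -natrX ler_nat.
Qed.

Lemma up_log_le n : (1 < n)%N -> (up_log 2 n)%:R * ln 2 <= 2 * ln n%:R :> R.
Proof.
move=> n1; have := up_log_gtn (isT : 1 < 2)%N n1.
case: (up_log 2 n) => [_|j /= /ltnW/ln_exp2_le].
  by rewrite mul0r mulr_ge0 // ltW // ln_nat_gt0.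
by have := ln_nat_ge2 n1; rewrite -natr1; lra.
Qed.

Lemma trunc_log_le n j : (1 < n)%N -> (j <= n * n)%N ->
  (trunc_log 2 j)%:R * ln 2 <= 2 * ln n%:R :> R.
Proof.
move=> n1 jn; case: (posnP j) => [->|j0].
  by rewrite trunc_log0 mul0r mulr_ge0 // ltW // ln_nat_gt0.
apply: le_trans (ln_exp2_le (leq_trans (trunc_logP _ j0) jn)) _ => //.
by rewrite natrM lnM ?posrE ?ltr0n ?(ltnW n1) // mulr2n mulrDl mul1r.
Qed.

Lemma one_sub_exp_le q j x : 0 <= q <= 1 -> x <= q * j%:R -> (1 - q) ^+ j <= expR (- x).
Proof.
case/andP=> q0 q1 xj; apply: (@le_trans _ _ (expR (- q) ^+ j)).
  by apply: lerXn2r; rewrite ?nnegrE ?subr_ge0 ?expR_ge0 // expR_ge1Dx.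
by rewrite -expRM_natr ler_expR mulNr lerN2.
Qed.

Lemma expR_ln_nat n j : (1 < n)%N -> expR (- (j%:R * ln n%:R)) = n%:R ^- j :> R.
Proof.
by move=> n1; rewrite expRN expRM_natl lnK // posrE ltr0n ltnW.
Qed.

Lemma powR_3_2 n : powR n%:R (3%:R / 2%:R) = n%:R * Num.sqrt n%:R :> R.
Proof.
case: (posnP n) => [->|n0].
  by rewrite powR0 ?mul0r // mulf_neq0 ?invr_eq0 ?pnatr_eq0.
have -> : 3%:R / 2%:R = 1 + 2^-1 :> R by field.
by rewrite powRD ?powRr1 ?powR12_sqrt ?ler0n // pnatr_eq0 -lt0n n0 implybT.
Qed.

Lemma sqrt_ln_ge n m : (1 < n)%N -> (0 < m)%N ->
  Num.sqrt (ln 2) <= Num.sqrt (m%:R * ln n%:R) :> R.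
Proof.
move=> n1 m0; apply: ler_wsqrtr; apply: le_trans (ln_nat_ge2 n1) _.
by rewrite ler_peMl ?ler1n // ltW // ln_nat_gt0.
Qed.

Lemma mul_sqrt_div x y : 0 < x -> 0 < y -> x * Num.sqrt (y / x) = Num.sqrt (x * y).
Proof.
move=> x0 y0; rewrite -{1}(ger0_norm (ltW x0)) -sqrtr_sqr -sqrtrM ?exprn_ge0 ?ltW //.
by congr Num.sqrt; field; rewrite gt_eqF.
Qed.

Lemma div_sqrt_div x y : 0 < x -> 0 < y -> y / Num.sqrt (y / x) = Num.sqrt (x * y).
Proof.
move=> x0 y0; have s0 : 0 < Num.sqrt (y / x) by rewrite sqrtr_gt0 divr_gt0.
apply: (mulIf (lt0r_neq0 s0)); rewrite divfK ?gt_eqF // -sqrtrM ?mulr_ge0 ?ltW //.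
have -> : x * y * (y / x) = y ^+ 2 by field; rewrite gt_eqF.
by rewrite sqrtr_sqr ger0_norm ?ltW.
Qed.

Lemma sqrt_ln2_gt0 : 0 < Num.sqrt (ln 2) :> R.
Proof. by rewrite sqrtr_gt0 ln2_gt0. Qed.

End Logarithms.

(** * Message size and processing time with high probability *)

Section HighProbability.
Variables (R : realType) (n k : nat) (g : 'I_k -> 'I_n) (q : R) (a : seq ('I_n * 'I_n)).
Variables (skip : bool) (c : nat).
Hypothesis q01 : 0 <= q <= 1.
Hypothesis n_gt1 : (1 < n)%N.
Hypothesis k_le : (k <= n * n)%N.

(** The probability of a longer record is at most [n * (k.+1 * k.+2) / 2 ^ J]. As [k <= n ^ 2], the
    numerator is at most [n ^ 7], while [2 ^ J] is at least [n ^ (c + 7)]. *)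
Let J := ((c + 7) * up_log 2 n)%N.
Let D : R := 2 * (c + 7)%:R / ln 2.

Lemma record_size_le : J%:R <= D * ln n%:R.
Proof.
rewrite /J /D natrM mulrAC ler_pdivlMr ?ln2_gt0 // -[2 * _ * _]mulrA [2 * _]mulrC -mulrA.
by rewrite -[leRHS]mulrA ler_wpM2l ?ler0n // [ln _ * 2]mulrC up_log_le.
Qed.

Lemma one_le_ln : 1 <= (ln 2)^-1 * ln n%:R :> R.
Proof. by rewrite mulrC ler_pdivlMr ?ln2_gt0 // mul1r ln_nat_ge2. Qed.

Lemma prob_short_record : 1 - n%:R ^- c <= prob q (predC (long_record g a J)).
Proof.
rewrite [leRHS]probC //; rewrite lerD2l lerN2.
have -> : prob q (predC (predC (long_record g a J))) = prob q (long_record g a J).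
  by apply: eq_bigl => w; rewrite !inE negbK.
apply: le_trans (prob_long_record g a q01 J) _.
have n0 : 0 < n%:R :> R by rewrite ltr0n ltnW.
rewrite ler_pdivrMr ?exprn_gt0 // [leRHS]mulrC ler_pdivlMr ?exprn_gt0 //.
rewrite -natrX -!natrM -natrX ler_nat /J mulnC [((c + 7) * _)%N]mulnC expnM.
apply: (@leq_trans (n ^ (c + 7))); last by rewrite leq_exp2r ?addnS // up_logP.
rewrite expnD leq_mul2l; apply/orP; right.
rewrite (expnS n 6) leq_mul2l; apply/orP; right.
apply: (@leq_trans (n ^ 3 * n ^ 3)); last by rewrite -expnD.
by apply: leq_mul; rewrite !expnS expn0 muln1; nia.
Qed.

Lemma light_time (e : event n) : light J e -> (ev_time e)%:R <= (7 * D + 6 / ln 2) * ln n%:R.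
Proof.
case=> _ et; apply: (@le_trans _ _ (7 * J%:R + 6)).
  by rewrite -natrM -natrD ler_nat.
by have := record_size_le; have := one_le_ln; rewrite [_^-1 * _]mulrC; lra.
Qed.

Lemma vertex_rank_lt w x i : vertex_rank g w x = Some i -> (i < k)%N.
Proof.
rewrite vertex_rankE /index_rank; case: ifP => // ox [<-].
by rewrite -[ltnRHS](size_item_order g w) index_mem.
Qed.

Lemma light_bits w (e : event n) : light J e ->
  (msg_bits (vertex_rank g w) (ev_msg e))%:R
    <= (14 / ln 2 ^+ 2 + 14 * D / ln 2) * ln n%:R ^+ 2.
Proof.
case=> sJ _; set U := up_log 2 n; set T := trunc_log 2 k.
have letters (l : seq 'I_n) : (size l <= J)%N ->
    (label_letters (vertex_rank g w) l <= J * (U + T + 3))%N.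
  move=> lJ; apply: leq_trans (leq_mul lJ (leqnn _)); rewrite /label_letters.
  rewrite -sum1_size big_distrl /= leq_sum // => x _; rewrite mul1n.
  case rx: (vertex_rank g w x) => [i|]; rewrite ?trunc_log0.
    have := leq_trunc_log 2 (ltnW (vertex_rank_lt rx)); rewrite -/T -/U; lia.
  rewrite -/U; lia.
have : (msg_bits (vertex_rank g w) (ev_msg e) <= 2 * (5 + U + J * (U + T + 3)))%N.
  rewrite /msg_bits leq_mul2l /=.
  case: (ev_msg e) sJ => [v l|l|b|l] /= sJ; rewrite -/U; try have := letters l sJ; lia.
rewrite -(ler_nat R) => /le_trans; apply; rewrite natrM !natrD natrM !natrD.
(* [y] is the binary logarithm of [n], at least 1. Hence [5 + U <= 7 * y ^ 2] and
   [U + T + 3 <= 7 * y]; two bits per letter give both constants 14. *)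
pose y : R := (ln 2)^-1 * ln n%:R; have y1 : 1 <= y := one_le_ln.
have Uy : U%:R <= 2 * y.
  by rewrite /y mulrCA mulrC ler_pdivlMr ?ln2_gt0 // up_log_le.
have Ty : T%:R <= 2 * y.
  by rewrite /y mulrCA mulrC ler_pdivlMr ?ln2_gt0 // trunc_log_le.
have -> : (14 / ln 2 ^+ 2 + 14 * D / ln 2) * ln n%:R ^+ 2 = 14 * y ^+ 2 + 14 * (D * ln n%:R) * y.
  by rewrite /y; field; rewrite gt_eqF ?ln2_gt0.
have Jy := record_size_le; have J0 : 0 <= J%:R :> R := ler0n _ _.
apply: (@le_trans _ _ (2 * (5 * y ^+ 2 + 2 * y ^+ 2 + (D * ln n%:R) * (7 * y)))); last by lra.
rewrite ler_wpM2l // lerD //.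
  rewrite lerD //; first by rewrite ler_peMr // expr_ge1 // (le_trans ler01).
  by apply: le_trans Uy _; rewrite expr2 ler_wpM2l // ler_peMl // (le_trans ler01).
apply: ler_pM => //; first by rewrite !addr_ge0 ?ler0n.
move: Uy Ty y1; lra.
Qed.

Lemma run_light w : ~~ long_record g a J w ->
  forall e, List.In e (run skip (vertex_rank g w) a) -> light J e.
Proof.
move=> short; apply: (run_vertex_rank (E := size a) _ short).1.
by right=> x; rewrite size_map size_filter count_size.
Qed.

Let C := 14 / ln 2 ^+ 2 + 14 * D / ln 2 + (7 * D + 6 / ln 2).

Lemma run_bits_time_prob :
  1 - n%:R ^- c <= prob q (fun w =>
     bits_at_most (vertex_rank g w) (C * ln n%:R ^+ 2) (run skip (vertex_rank g w) a)) /\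
  1 - n%:R ^- c <= prob q (fun w =>
     time_at_most (C * ln n%:R) (run skip (vertex_rank g w) a)).
Proof.
have l0 := ln2_gt0 R.
have D0 : 0 <= D by rewrite divr_ge0 ?mulr_ge0 // ltW.
have i0 : 0 <= (ln 2)^-1 :> R by rewrite invr_ge0 ltW.
have n0 : 0 <= ln n%:R :> R by rewrite ltW ?ln_nat_gt0.
split; apply: le_trans prob_short_record _; apply: ler_prob => // w short;
  have := run_light short; rewrite /bits_at_most /time_at_most;
  elim: run => //= e tr IH lt; apply/andP; split;
  try (by apply: IH => e' tre; apply: lt; right).
  apply: le_trans (light_bits w (lt e (or_introl erefl))) _.
  by rewrite ler_wpM2r ?exprn_ge0 // lerDl addr_ge0 ?mulr_ge0.
apply: le_trans (light_time (lt e (or_introl erefl))) _.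
by rewrite ler_wpM2r // lerDr addr_ge0 ?mulr_ge0 ?invr_ge0 ?exprn_ge0 // ltW.
Qed.

End HighProbability.

(** * The two labelings *)

Lemma uniq_arcs_size n (a : seq ('I_n * 'I_n)) : uniq a -> (size a <= n * n)%N.
Proof. by move/card_uniqP <-; apply: leq_trans (max_card _) _; rewrite card_prod card_ord. Qed.

Lemma ranking_rank_vertex n (w : ranking n) : ranking_rank w = vertex_rank id w.
Proof.
apply/funext => v; rewrite /vertex_rank (eq_filter (a2 := pred1 v)) //.
by rewrite filter_pred1_uniq ?enum_uniq ?mem_enum //= /rank_min; case: ranking_rank.
Qed.

Lemma size_in_nbrs_tuple n m (a : m.-tuple ('I_n * 'I_n)) x :
  size (in_nbrs a x) = #|[set i | (tnth a i).2 == x]|.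
Proof.
rewrite size_map size_filter -{1}(map_tnth_enum a) count_map.
by rewrite cardE -sum1_size -sum1_count big_enum_cond /= big_enum /=; apply: eq_bigl => i; rewrite inE.
Qed.

Section Estimate.
Variables (R : realType) (n k : nat) (g : 'I_k -> 'I_n) (q : R) (a : seq ('I_n * 'I_n)).
Variables (skip : bool) (K B E : nat).
Hypothesis q01 : 0 <= q <= 1.
Hypothesis n_gt1 : (1 < n)%N.
Hypothesis a_le : (size a <= n * n)%N.
Hypothesis in_nbrs_items : forall x, (size (in_nbrs a x) <= K * #|[set i | g i == x]|)%N.
Hypothesis B_ge : forall A : {set 'I_k}, (B < #|A|)%N -> 3%:R * ln n%:R <= q * #|A|%:R.
Hypothesis ranked_in_nbrs : skip \/ (forall x, (size (in_nbrs a x) <= E)%N).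

Lemma expect_run_le :
  expect q (fun w => num_messages R (run skip (vertex_rank g w) a)) <=
  (size a)%:R * (3 * (k%:R * q) + 2 * ((K * B)%:R + E%:R) + 12).
Proof.
have n0 : 0 < n%:R :> R by rewrite ltr0n ltnW.
(* The exponent 3 makes the exceptional term bounded: with at most [n ^ 2] arcs,
   [size a * n.+1 / n ^ 3] is at most 2. *)
have avoid (A : {set 'I_k}) : (B < #|A|)%N -> (1 - q) ^+ #|A| <= n%:R ^- 3.
  by move=> BA; rewrite -expR_ln_nat //; apply: one_sub_exp_le => //; apply: B_ge.
have d0 : 0 <= n%:R ^- 3 :> R by rewrite invr_ge0 exprn_ge0 // ltW.
apply: le_trans (expect_run q01 in_nbrs_items avoid d0 ranked_in_nbrs) _.
apply: ler_wpM2l; first exact: ler0n.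
suff : (size a)%:R * n.+1%:R * n%:R ^- 3 <= 2 :> R by lra.
rewrite ler_pdivrMr ?exprn_gt0 // -natrM -natrX -natrM ler_nat.
by rewrite !expnS expn0 muln1; nia.
Qed.

Lemma expect_run_powR (s c1 c2 c3 : R) : s = Num.sqrt ((size a)%:R * ln n%:R) ->
  k%:R * q <= c1 * s -> B%:R <= c2 * s -> E%:R <= c3 * s ->
  expect q (fun w => num_messages R (run skip (vertex_rank g w) a)) <=
  (3 * c1 + 2 * (K%:R * c2 + c3) + 12 / Num.sqrt (ln 2))
    * powR (size a)%:R (3%:R / 2%:R) * Num.sqrt (ln n%:R).
Proof.
move=> es kq Bs Es; apply: le_trans expect_run_le _; rewrite powR_3_2.
case: (posnP (size a)) => [->|a0]; first by rewrite !mul0r mulr0 mul0r.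
(* Constant terms are absorbed into [s], which is at least [sqrt (ln 2)] as soon as there is an
   arc. *)
have s1 : 1 <= s / Num.sqrt (ln 2).
  by rewrite es ler_pdivlMr ?sqrt_ln2_gt0 // mul1r sqrt_ln_ge.
have KB : (K * B)%:R <= K%:R * (c2 * s) :> R by rewrite natrM ler_wpM2l.
rewrite -[leRHS]mulrA -[(size a)%:R * _ * _]mulrA -sqrtrM ?ler0n // -es [leRHS]mulrCA.
by apply: ler_wpM2l; [exact: ler0n|lra].
Qed.

End Estimate.

Theorem theorem2 (R : realType) :
  (* graphs of constant degree: q-labeling with q = sqrt (log n / n) *)
  (forall Delta K : nat,
     let q (n : nat) : R := Num.sqrt (ln n%:R / n%:R) in
     let admissible n m (a : m.-tuple ('I_n * 'I_n)) : Prop :=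
       [/\ (1 < n)%N, uniq a, (n <= K * m)%N &
           forall v : 'I_n, (size (in_nbrs a v) <= Delta)%N /\
                            (size (out_nbrs a v) <= Delta)%N] in
     (exists C : R, forall n m (a : m.-tuple ('I_n * 'I_n)), admissible n m a ->
        expect (q n) (fun w : ranking n =>
            num_messages R (run false (ranking_rank w) a))
          <= C * powR m%:R (3%:R / 2%:R) * Num.sqrt (ln n%:R))
  /\ (forall c : nat, exists C : R,
        forall n m (a : m.-tuple ('I_n * 'I_n)), admissible n m a ->
        1 - n%:R ^- c <= prob (q n) (fun w : ranking n =>
            bits_at_most (ranking_rank w) (C * ln n%:R ^+ 2)
              (run false (ranking_rank w) a))
     /\ 1 - n%:R ^- c <= prob (q n) (fun w : ranking n =>
            time_at_most (C * ln n%:R) (run false (ranking_rank w) a))))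
  /\
  (* general graphs: q-arc labeling with q = 1 / sqrt m up to sqrt (log n) *)
  (exists q : nat -> nat -> R,
     (exists c1 c2 : R, 0 < c1 /\
        forall n m : nat, (1 < n)%N -> (0 < m)%N ->
          [/\ 0 <= q n m, q n m <= 1, c1 / Num.sqrt m%:R <= q n m &
              q n m <= c2 * Num.sqrt (ln n%:R) / Num.sqrt m%:R])
  /\ (forall K : nat, exists C : R,
        forall (skip : bool) n m (a : m.-tuple ('I_n * 'I_n)),
        (1 < n)%N -> uniq a ->
        (skip \/ forall v : 'I_n,
           (size (in_nbrs a v))%:R <= K%:R * Num.sqrt (m%:R * ln n%:R) :> R) ->
        expect (q n m) (fun w : ranking m =>
            num_messages R (run skip (arc_ranking_rank a w) a))
          <= C * powR m%:R (3%:R / 2%:R) * Num.sqrt (ln n%:R))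
  /\ (forall c : nat, exists C : R,
        forall (skip : bool) n m (a : m.-tuple ('I_n * 'I_n)),
        (1 < n)%N -> uniq a ->
        1 - n%:R ^- c <= prob (q n m) (fun w : ranking m =>
            bits_at_most (arc_ranking_rank a w) (C * ln n%:R ^+ 2)
              (run skip (arc_ranking_rank a w) a))
     /\ 1 - n%:R ^- c <= prob (q n m) (fun w : ranking m =>
            time_at_most (C * ln n%:R) (run skip (arc_ranking_rank a w) a)))).
Proof.
split.
- move=> Delta K q admissible.
  have n_gt0 n : (1 < n)%N -> 0 < n%:R :> R by move=> n1; rewrite ltr0n ltnW.
  have q01 n : (1 < n)%N -> 0 <= q n <= 1.
    move=> n1; have n0 := n_gt0 n n1; rewrite sqrtr_ge0 -sqrtr1 ler_wsqrtr //.
    by rewrite ler_pdivrMr // mul1r ltW // ln_sublinear.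
  split.
    exists (3 * K%:R + 2 * (Delta%:R * (3 * K%:R) + Delta%:R / Num.sqrt (ln 2))
            + 12 / Num.sqrt (ln 2)) => n m a [n1 ua nK deg].
    have [n0 l0] := (n_gt0 n n1, ln_nat_gt0 R n1).
    have m0 : (0 < m)%N by case: (m) nK n1 => //; rewrite muln0 leqn0 => /eqP->.
    pose s : R := Num.sqrt (m%:R * ln n%:R).
    (* [n <= K * m] converts bounds in [n] into bounds in [m]; [K <= K ^ 2] avoids the square root
       of [K]. *)
    have ns : Num.sqrt (n%:R * ln n%:R) <= K%:R * s.
      rewrite -{1}(ger0_norm (ler0n R K)) -sqrtr_sqr -sqrtrM ?exprn_ge0 //.
      apply: ler_wsqrtr; rewrite mulrA ler_wpM2r ?(ltW l0) // -natrX -natrM ler_nat.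
      apply: leq_trans nK _; rewrite leq_mul2r expnS expn1.
      by apply/orP; right; case: (K) => // j; rewrite leq_pmulr.
    pose B := Num.truncn (3 * ln n%:R / q n).
    have qn0 : 0 < q n by rewrite sqrtr_gt0 divr_gt0.
    have /truncn_itv/andP[Ble ltB] : 0 <= 3 * ln n%:R / q n.
      by rewrite divr_ge0 ?mulr_ge0 // ltW.
    have lq : ln n%:R / q n = Num.sqrt (n%:R * ln n%:R) by apply: div_sqrt_div.
    have nq : n%:R * q n = Num.sqrt (n%:R * ln n%:R) by apply: mul_sqrt_div.
    have items x : (size (in_nbrs a x) <= Delta * #|[set i | id i == x]|)%N.
      have -> : [set i | id i == x] = [set x] by apply/setP => i; rewrite !inE.
      by rewrite cards1 muln1; case: (deg x).
    have Bge (A : {set 'I_n}) : (B < #|A|)%N -> 3%:R * ln n%:R <= q n * #|A|%:R.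
      move=> BA; rewrite [leRHS]mulrC -ler_pdivrMr //; apply: le_trans (ltW ltB) _.
      by rewrite ler_nat.
    have sk : false \/ (forall x, (size (in_nbrs a x) <= Delta)%N) by right=> x; case: (deg x).
    have aN : (size a <= n * n)%N by apply: uniq_arcs_size.
    have -> : (fun w : ranking n => num_messages R (run false (ranking_rank w) a)) =
        (fun w => num_messages R (run false (vertex_rank id w) a)).
      by apply/funext => w; rewrite ranking_rank_vertex.
    rewrite -[in leRHS](size_tuple a).
    apply: (expect_run_powR (q01 n n1) n1 aN items Bge sk (s := s)).
    + by rewrite /s size_tuple.
    + by rewrite nq.
    + by apply: le_trans Ble _; rewrite -mulrA lq -mulrA ler_wpM2l.
    + rewrite mulrAC -mulrA ler_peMr // ler_pdivlMr ?sqrt_ln2_gt0 // mul1r.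
      exact: sqrt_ln_ge.
  move=> c; eexists => n m a [n1 ua _ _].
  have nn : (n <= n * n)%N by rewrite leq_pmulr // ltnW.
  have := run_bits_time_prob id a false c (q01 n n1) n1 nn.
  have -> : vertex_rank id = @ranking_rank n by apply/funext => w; rewrite ranking_rank_vertex.
  exact.
(* The minimum keeps [q] a probability when [ln n] exceeds [m]. *)
pose q n m : R := Num.min 1 (Num.sqrt (ln n%:R / m%:R)).
have q01 n m : 0 <= q n m <= 1.
  by rewrite le_min ler01 sqrtr_ge0 ge_min lexx.
exists q; split; last split.
- exists (Num.min 1 (Num.sqrt (ln 2))), 1; split; first by rewrite lt_min ltr01 sqrt_ln2_gt0.
  move=> n m n1 m0; have l0 := ln_nat_gt0 R n1.
  have m1 : 1 <= Num.sqrt m%:R :> R by rewrite -[leLHS]sqrtr1 ler_wsqrtr // ler1n.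
  have sm0 : 0 < Num.sqrt m%:R :> R by apply: lt_le_trans m1.
  have qE : Num.sqrt (ln n%:R / m%:R) = Num.sqrt (ln n%:R) / Num.sqrt m%:R :> R.
    by rewrite sqrtrM ?ltW // sqrtrV // ler0n.
  have /andP[q0 q1] := q01 n m; split=> //; last by rewrite mul1r -qE ge_min lexx orbT.
  rewrite le_min qE; apply/andP; split.
    by rewrite ler_pdivrMr // mul1r; apply: le_trans m1; rewrite ge_min lexx.
  rewrite ler_wpM2r ?invr_ge0 ?(ltW sm0) // ge_min; apply/orP; right.
  by apply: ler_wsqrtr; apply: ln_nat_ge2.
- move=> K; exists (3 * 1 + 2 * (1%N%:R * 3 + K%:R) + 12 / Num.sqrt (ln 2)) => skip n m a n1 ua deg.
  have l0 := ln_nat_gt0 R n1.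
  pose s : R := Num.sqrt (m%:R * ln n%:R); have s0 : 0 <= s := sqrtr_ge0 _.
  (* When [q] is capped at 1, [ln n] may be much larger than [s]; but no set has more than [m]
     items, and in that case [m <= s]. *)
  pose B := minn m (Num.truncn (3 * ln n%:R / q n m)).
  pose E := if skip then 0%N else (\max_x size (in_nbrs a x))%N.
  have items x : (size (in_nbrs a x) <= 1 * #|[set i | (tnth a i).2 == x]|)%N.
    by rewrite mul1n size_in_nbrs_tuple.
  have Bge (A : {set 'I_m}) : (B < #|A|)%N -> 3%:R * ln n%:R <= q n m * #|A|%:R.
    have Am : (#|A| <= m)%N by rewrite -[leqRHS]card_ord max_card.
    rewrite /B gtn_min ltnNge Am /= => BA.
    have m0 : (0 < m)%N by apply: leq_trans Am; apply: leq_trans BA.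
    have qn0 : 0 < q n m by rewrite lt_min ltr01 sqrtr_gt0 divr_gt0 ?ltr0n.
    have /truncn_itv/andP[_ ltB] : 0 <= 3 * ln n%:R / q n m.
      by rewrite divr_ge0 ?mulr_ge0 // ltW.
    rewrite [leRHS]mulrC -ler_pdivrMr //; apply: le_trans (ltW ltB) _.
    by rewrite ler_nat.
  have sk : skip \/ (forall x, (size (in_nbrs a x) <= E)%N).
    rewrite /E; case: (skip); first by left.
    by right=> x; apply: (leq_bigmax (F := fun x => size (in_nbrs a x))).
  have aN : (size a <= n * n)%N by apply: uniq_arcs_size.
  rewrite -[in leRHS](size_tuple a).
  apply: (expect_run_powR (g := fun i => (tnth a i).2) (q01 n m) n1 aN items Bge sk (s := s)).
  + by rewrite /s size_tuple.
  + rewrite mul1r; case: (posnP m) => [m0|m0].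
      by rewrite {1}m0 mul0r.
    by rewrite /s -mul_sqrt_div ?ltr0n // ler_wpM2l ?ler0n // ge_min lexx orbT.
  + case: (posnP m) => [m0|m0]; first by rewrite /B m0 min0n mulr_ge0.
    have m0' : 0 < m%:R :> R by rewrite ltr0n.
    case: (leP 1 (Num.sqrt (ln n%:R / m%:R) : R)) => [ge1|/ltW le1].
      apply: (@le_trans _ _ m%:R); first by rewrite ler_nat geq_minl.
      apply: (@le_trans _ _ s); last by rewrite ler_peMl // ler1n.
      by rewrite /s -mul_sqrt_div // ler_peMr // ltW.
    have qE : q n m = Num.sqrt (ln n%:R / m%:R) by apply/min_idPr.
    have /truncn_itv/andP[Ble _] : 0 <= 3 * ln n%:R / q n m.
      by rewrite qE divr_ge0 ?sqrtr_ge0 ?mulr_ge0 // ltW.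
    apply: (@le_trans _ _ (Num.truncn (3 * ln n%:R / q n m))%:R).
      by rewrite ler_nat geq_minr.
    by apply: le_trans Ble _; rewrite -mulrA qE div_sqrt_div.
  + rewrite /E; case: deg => [->|deg]; first by rewrite mulr_ge0.
    case: (skip); first by rewrite mulr_ge0.
    have [x _ ->] : exists2 x, x \in predT & (\max_x size (in_nbrs a x))%N = size (in_nbrs a x).
      have n0 : (0 < #|'I_n|)%N by rewrite card_ord ltnW.
      by have [x ->] := @bigop.eq_bigmax _ (fun x => size (in_nbrs a x)) n0; exists x.
    exact: deg.
move=> c; eexists => skip n m a n1 ua.
have mn : (m <= n * n)%N by have := uniq_arcs_size ua; rewrite size_tuple.
exact: (run_bits_time_prob (fun i => (tnth a i).2) a skip c (q01 n m) n1 mn).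
Qed.
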